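(* $\mathrm{QMA}(1,<\!1)\subseteq\mathrm{PSPACE}$.
   Context: $\mathrm{QMA}(1,<\!1)=\mathrm{QIP}(1,1,<\!1)$ is the class of promise problems $A=(A_{\mathrm{yes}},A_{\mathrm{no}})$ having a one-message quantum interactive proof system (the prover sends a quantum state to a polynomial-time quantum verifier, who then decides to accept or reject) such that on $x\in A_{\mathrm{yes}}$ some prover message makes the verifier accept with probability $1$, and on $x\in A_{\mathrm{no}}$ every prover message makes the verifier accept with probability strictly smaller than $1$. The verifier's circuits use a gate set consisting of finitely many gates, each of whose matrix entries (amplitudes) are algebraic numbers. *)

(* Defs.v *)
From mathcomp Require Import all_boot all_order all_algebra.
From mathcomp Require Import complex reals.
Set Implicit Arguments. Unset Strict Implicit. Unset Printing Implicit Defensive.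
Import Order.TTheory GRing.Theory Num.Theory.

Inductive move := MoveL | MoveR | Stay.

(* Tape alphabet: option (bool + W); None = blank, Some (inl b) = bit b,
   Some (inr w) = auxiliary work symbol.  [trans q s = None] means halt. *)
Record TM := mkTM {
  tm_state : finType;
  tm_work : finType;
  tm_start : tm_state;
  tm_trans : tm_state -> option (bool + tm_work) ->
             option (tm_state * option (bool + tm_work) * move);
  tm_accept : pred tm_state }.

Definition tm_sym (M : TM) := option (bool + tm_work M).

Record config (M : TM) := Config {
  cf_state : tm_state M; cf_head : int; cf_tape : int -> tm_sym M }.

Definition init_config (M : TM) (x : seq bool) : config M :=
  Config (tm_start M) 0%R
    (fun j : int => match j with
                    | Posz k => if k < size x then Some (inl (nth false x k)) else None
                    | Negz _ => None end).

Definition tm_step (M : TM) (c : config M) : config M :=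
  match tm_trans (cf_state c) (cf_tape c (cf_head c)) with
  | None => c
  | Some (q', s, mv) =>
      let h := cf_head c in
      Config q'
        (match mv with MoveL => (h - 1)%R | MoveR => (h + 1)%R | Stay => h end)
        (fun j => if j == h then s else cf_tape c j)
  end.

Definition tm_run (M : TM) (x : seq bool) (t : nat) : config M :=
  iter t (@tm_step M) (init_config M x).

Definition halted (M : TM) (c : config M) : bool :=
  if tm_trans (cf_state c) (cf_tape c (cf_head c)) is None then true else false.

Definition tm_space (M : TM) (x : seq bool) (t : nat) : nat :=
  size (undup [seq cf_head (tm_run M x i) | i <- iota 0 t.+1]).

Fixpoint read_bits (M : TM) (tape : int -> tm_sym M) (pos : nat) (fuel : nat)
  : seq bool :=
  match fuel with
  | 0 => [::]
  | fuel'.+1 => match tape (Posz pos) with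
                | Some (inl b) => b :: read_bits tape pos.+1 fuel'
                | _ => [::] end
  end.

(* After t steps, every cell at position >= t + |x| is blank. *)
Definition tm_output (M : TM) (x : seq bool) (t : nat) : seq bool :=
  read_bits (cf_tape (tm_run M x t)) 0 (t + size x).+1.

Definition polytime_computable (f : seq bool -> seq bool) : Prop :=
  exists (M : TM) (k : nat), forall x, exists t,
    t <= size x ^ k + k /\ halted (tm_run M x t) /\ tm_output M x t = f x.

Definition in_PSPACE (Ayes Ano : pred (seq bool)) : Prop :=
  exists (M : TM) (k : nat), forall x, exists t,
    [/\ halted (tm_run M x t), tm_space M x t <= size x ^ k + k,
        Ayes x -> tm_accept (cf_state (tm_run M x t))
      & Ano x -> ~~ tm_accept (cf_state (tm_run M x t))].

Local Open Scope ring_scope.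

Section Quantum.
Variable R : realType.
Notation C := R[i].

(* A gate on [garity] qubits, given by its matrix in the computational basis:
   gmat y x = <y| G |x>. *)
Record gate := Gate {
  garity : nat;
  gmat : {ffun 'I_garity -> bool} -> {ffun 'I_garity -> bool} -> C }.
Arguments gmat : clear implicits.

Definition unitary_gate (G : gate) : Prop :=
  forall i j, \sum_k (gmat G k i)^* * gmat G k j = (i == j)%:R.

Definition algebraic (c : C) : Prop :=
  exists p : {poly rat}, p != 0 /\ root (map_poly (@ratr C) p) c.

Definition algebraic_gate (G : gate) : Prop :=
  forall y x, algebraic (gmat G y x).

Definition id_gate : gate := @Gate 0 (fun _ _ => 1).

Definition basis (n : nat) := {ffun 'I_n -> bool}.
Definition qstate (n : nat) := basis n -> C.

Definition bit (n : nat) (z : basis n) (k : nat) : bool :=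
  if insub k is Some i then z i else false.

(* Circuit description output by the verifier's generator:
   (m, n, gates): n qubits in total, the first m form the prover's register,
   the remaining n - m are ancillas initialised to |0>; each gate is given by
   its index in the gate set and the list of qubits it acts on; qubit 0 is
   measured at the end, outcome 1 = accept. *)
Definition desc := (nat * nat * seq (nat * seq nat))%type.

Definition enc_nat (k : nat) : seq bool := rcons (nseq k true) false.
Definition enc_list (s : seq nat) : seq bool :=
  enc_nat (size s) ++ flatten (map enc_nat s).
Definition enc_desc (d : desc) : seq bool :=
  let: (m, n, gs) := d in
  enc_nat m ++ enc_nat n ++ enc_nat (size gs) ++
  flatten [seq enc_nat g.1 ++ enc_list g.2 | g <- gs].

Definition valid_desc (gs : seq gate) (d : desc) : bool :=
  let: (m, n, cs) := d in
  [&& (0 < n)%N, (m <= n)%N &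
      all (fun g => [&& (g.1 < size gs)%N, size g.2 == garity (nth id_gate gs g.1),
                        uniq g.2 & all (fun q => (q < n)%N) g.2]) cs].

Definition apply_gate (n : nat) (G : gate) (ts : seq nat) (psi : qstate n)
  : qstate n :=
  fun y => \sum_(x : basis n)
    (if [forall i : 'I_n, (nat_of_ord i \notin ts) ==> (y i == x i)]
     then gmat G [ffun j : 'I_(garity G) => bit y (nth 0 ts j)]
                 [ffun j : 'I_(garity G) => bit x (nth 0 ts j)]
     else 0) * psi x.

Definition run_circuit (gs : seq gate) (n : nat) (cs : seq (nat * seq nat))
  (psi : qstate n) : qstate n :=
  foldl (fun phi g => apply_gate (nth id_gate gs g.1) g.2 phi) psi cs.

(* Valid prover message: a unit vector on the first m qubits, tensored with
   |0...0> on the ancillas (represented as an n-qubit vector vanishing on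
   basis states with a nonzero ancilla bit). *)
Definition witness (n m : nat) (psi : qstate n) : Prop :=
  (forall z : basis n, [exists i : 'I_n, (m <= i)%N && z i] -> psi z = 0) /\
  \sum_z `|psi z| ^+ 2 = 1.

Definition accept_prob (gs : seq gate) (d : desc) (psi : qstate d.1.2) : C :=
  \sum_(z : basis d.1.2 | bit z 0) `|run_circuit gs d.2 psi z| ^+ 2.

Definition in_QMA1_lt1 (gs : seq gate) (Ayes Ano : pred (seq bool)) : Prop :=
  exists V : seq bool -> desc,
    [/\ polytime_computable (fun x => enc_desc (V x)),
        forall x, valid_desc gs (V x),
        forall x, Ayes x -> exists psi : qstate (V x).1.2,
            witness (V x).1.1 psi /\ accept_prob gs psi = 1
      & forall x, Ano x -> forall psi : qstate (V x).1.2,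
            witness (V x).1.1 psi -> accept_prob gs psi < 1].

End Quantum.

(* Main.v *)
(** Let U be the verifier's circuit, P_W the projection on the states whose
    ancillas are 0 and Pi the projection on acceptance. Since all the factors of
    X = P_W U^* Pi U are contractions and U is unitary, some witness is accepted
    with probability 1 iff X fixes a nonzero vector. As X is a product of
    sparse matrices X_0, ..., X_(L-1), this holds iff the block-cyclic matrix
    with blocks 1 and -X_t is singular. Replacing every algebraic number by a
    matrix of rationals having it as an eigenvalue, with one common eigenvector
    whose coordinates are independent over Q, turns it into an integer matrix
    of exponential dimension, with the same singularity and easily computed
    entries.

    An integer determinant of absolute value below 2^m vanishes iff it vanishes
    modulo all q <= 2m, because lcm(1, ..., 2m) >= 2^m. The determinant of a matrix
    is a signed count of sequences of closed walks (clow sequences), hence an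
    entry of the 2^l-th power of an explicit sparse matrix, which Savitch's
    recursion evaluates modulo q in polynomial space.

    Space, and not time, is what matters, so the algorithm is a composition of
    bounded iterations on natural numbers, compiled to a register machine whose
    registers are the bit tracks of a Turing machine tape. *)

Require Import Defs.
From mathcomp Require Import all_boot all_order all_algebra.
From mathcomp Require Import perm ring zify.
From Stdlib Require Import Classical FunctionalExtensionality.
Set Implicit Arguments. Unset Strict Implicit. Unset Printing Implicit Defensive.

(** * Register programs on Turing machines *)

(** No gap separates the two cases, so no approximation of the acceptance probability decides
    between them: the test must be exact, which is why integers replace the algebraic entries. Since
    the gate set is finite and fixed, their representation has constant dimension and fits in a
    finite table. The entries of X itself are exponentially long sums of products; stringing the
    factors around a cycle keeps every entry local, and the dimension is multiplied only by the
    number of factors. Independence over Q serves one direction: an integer singular matrix has a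
    rational null vector, and this must stay nonzero after contraction with the eigenvector.

    A function is admissible when all intermediate values are polynomial in its largest argument.
    Powers, stacks and tapes are not, so a budget S = 2^poly is passed as one more argument, the
    iterations that build them are cut off at S, and correctness includes that the cut never acts.
    The circuit description is obtained by simulating its generator in the same framework, as a
    single number whose digits are the tape. *)

Definition store := nat -> nat.

Definition upd (st : store) r v : store := fun r' => if r' == r then v else st r'.

Inductive instr :=
  | IInc of nat & nat
  | IDec of nat & nat
  | IJz of nat & nat & nat.

Inductive mstep (B : nat) (P : seq instr) : nat * store -> nat * store -> Prop :=
  | MInc pc st r nx : onth P pc = Some (IInc r nx) -> st r < B ->
      mstep B P (pc, st) (nx, upd st r (st r).+1)
  | MDec pc st r nx : onth P pc = Some (IDec r nx) -> 0 < st r ->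
      mstep B P (pc, st) (nx, upd st r (st r).-1)
  | MJz pc st r z nz : onth P pc = Some (IJz r z nz) ->
      mstep B P (pc, st) (if st r == 0 then z else nz, st).

Inductive msteps (B : nat) (P : seq instr) : nat * store -> nat * store -> Prop :=
  | MRefl c : msteps B P c c
  | MTrans c1 c2 c3 : mstep B P c1 c2 -> msteps B P c2 c3 -> msteps B P c1 c3.

(** Jump targets may lie beyond the end of the program: execution halts there, and distinct such
    targets tell acceptance from rejection. *)
Definition instr_ok (K N : nat) (i : instr) : bool :=
  match i with
  | IInc r nx | IDec r nx => (r < K) && (nx < N)
  | IJz r z nz => [&& r < K, z < N & nz < N]
  end.

Section Sweep.
Variables (K' N' : nat) (P : seq instr) (acc : nat).
Notation K := K'.+2.
Notation N := N'.+1.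
Hypothesis P_ok : all (instr_ok K N) P.

Definition cell := {ffun 'I_K -> bool}.
Definition csym := (bool + cell)%type.

(* The input bit string is read as two registers: register 0 holds the bits
   and register 1 has a one in every input position. *)
Definition cbit (s : csym) (r : nat) : bool :=
  match s with
  | inl b => if r == 0 then b else r == 1
  | inr c => if insub r is Some i then c i else false
  end.

Definition cset (s : csym) (r : nat) (v : bool) : csym :=
  inr [ffun i : 'I_K => if val i == r then v else cbit s i].

Definition czero : csym := inr [ffun=> false].

Arguments cbit : simpl never.
Arguments cset : simpl never.

Lemma cbit_cset s r v r' : r < K -> cbit (cset s r v) r' = if r' == r then v else cbit s r'.
Proof.
move=> hr; rewrite /cset {1}/cbit; case: insubP => [i hi <-|]; first by rewrite ffunE.
rewrite -leqNgt => h; have -> : (r' == r) = false by lia.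
case: s => [b|c]; rewrite /cbit; last by rewrite insubF //; lia.
by do 2 (case: eqP => [?|_]; first lia).
Qed.

Definition regs (cs : seq csym) : store :=
  fun r => foldr (fun s a => cbit s r + a.*2) 0 cs.

Fixpoint incs r cs : seq csym :=
  if cs is s :: cs' then
    if cbit s r then cset s r false :: incs r cs' else cset s r true :: cs'
  else [:: cset czero r true].

Fixpoint decs r cs : seq csym :=
  if cs is s :: cs' then
    if cbit s r then cset s r false :: cs' else cset s r true :: decs r cs'
  else [::].

Lemma cbit_czero r : cbit czero r = false.
Proof. by rewrite /cbit /=; case: insubP => // i _ _; rewrite ffunE. Qed.

Lemma regs_incs r cs : r < K -> regs (incs r cs) = upd (regs cs) r (regs cs r).+1.
Proof.
move=> hr; apply: functional_extensionality => r'; rewrite /upd.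
elim: cs => [|s cs IH] /=.
  rewrite cbit_cset // cbit_czero; by case: (eqVneq r' r) => [?|_] //; subst r'.
case E: (cbit s r) => /=; rewrite cbit_cset // ?IH;
  by case: (eqVneq r' r) => [?|_] //=; try subst r'; rewrite ?E; lia.
Qed.

Lemma regs_decs r cs : r < K -> 0 < regs cs r ->
  regs (decs r cs) = upd (regs cs) r (regs cs r).-1.
Proof.
move=> hr hp; apply: functional_extensionality => r'; rewrite /upd.
elim: cs hp => [|s cs IH] //=.
case E: (cbit s r) => /= hp; rewrite cbit_cset // ?IH;
  by case: (eqVneq r' r) => [?|_] //=; try subst r'; rewrite ?E; lia.
Qed.

Lemma size_decs r cs : size (decs r cs) = size cs.
Proof. by elim: cs => //= s cs IH; case: ifP => //=; rewrite IH. Qed.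

(** The list grows only when the carry runs through every cell, that is, when all bits of register
    [r] are 1. The new value is then 2 to the power [size cs], so a value below [2 ^ W] never needs
    more than [W] cells. *)
Lemma size_incs r cs W : (regs cs r).+1 < 2 ^ W -> size (incs r cs) <= maxn (size cs) W.
Proof.
elim: cs W => [|s cs IH] W /=; first by case: W => // W; rewrite max0n.
case: W => [|W]; first by rewrite expn0 ltnS.
case: (cbit s r) => /=; last by move=> _; rewrite leq_max leqnn.
rewrite expnS => h; rewrite maxnSS ltnS; apply: IH; rewrite /regs in h *; lia.
Qed.

Definition mtgt (pc : nat) (b : bool) : nat :=
  match onth P pc with
  | Some (IInc _ nx) | Some (IDec _ nx) => nx
  | Some (IJz _ z nz) => if b then z else nz
  | None => 0
  end.

(* In mode [None] the head scans to the right from cell 0; in mode [Some b] it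
   returns to cell 0 and then jumps, [b] recording the outcome of a zero test. *)
Definition mtrans (qm : 'I_N * option bool) (s : option csym) :
    option (('I_N * option bool) * option csym * move) :=
  let: (q, md) := qm in
  if onth P q isn't Some i then None else
  match md with
  | Some b => if s is Some _ then Some ((q, md), s, MoveL)
              else Some ((inord (mtgt q b), None), None, MoveR)
  | None =>
    match i with
    | IInc r _ =>
        let c := odflt czero s in
        if cbit c r then Some ((q, None), Some (cset c r false), MoveR)
        else Some ((q, Some false), Some (cset c r true), MoveL)
    | IDec r _ =>
        if s is Some c then
          if cbit c r then Some ((q, Some false), Some (cset c r false), MoveL)
          else Some ((q, None), Some (cset c r true), MoveR)
        else Some ((q, Some false), None, MoveL)
    | IJz r _ _ =>
        if s is Some c then
          if cbit c r then Some ((q, Some false), s, MoveL)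
          else Some ((q, None), s, MoveR)
        else Some ((q, Some true), None, MoveL)
    end
  end.

Definition mTM : TM :=
  @mkTM ('I_N * option bool)%type cell (ord0, None) mtrans
        (fun q => val q.1 == acc).

Definition ctape (cs : seq csym) : int -> option csym :=
  fun j => if j is Posz k then onth cs k else None.

Definition mconf pc md h cs : config mTM := @Config mTM (inord pc, md) h (ctape cs).

(** Cell -1 is always blank and marks the left end for the returning head, hence the lower bound -1
    and the [W.+2] visited cells further on. *)
Definition reach (W : nat) (c c' : config mTM) : Prop :=
  exists t, iter t (@tm_step mTM) c = c' /\
    forall i, i <= t -> ((-1)%Z <= cf_head (iter i (@tm_step mTM) c))%R /\
                        (cf_head (iter i (@tm_step mTM) c) <= W%:Z)%R.

Lemma reach_refl W c : ((-1)%Z <= cf_head c)%R -> (cf_head c <= W%:Z)%R -> reach W c c.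
Proof. by move=> h1 h2; exists 0; split=> // -[]. Qed.

Lemma reach_trans W c2 c1 c3 : reach W c1 c2 -> reach W c2 c3 -> reach W c1 c3.
Proof.
move=> [t1 [h1 b1]] [t2 [h2 b2]]; exists (t2 + t1); split; first by rewrite iterD h1.
move=> i hi; case: (leqP i t1) => [/b1 //|lt].
have -> : i = (i - t1) + t1 by lia.
by rewrite iterD h1; apply: b2; lia.
Qed.

Lemma reach_step W c c' : tm_step c = c' -> ((-1)%Z <= cf_head c)%R -> (cf_head c <= W%:Z)%R ->
  ((-1)%Z <= cf_head c')%R -> (cf_head c' <= W%:Z)%R -> reach W c c'.
Proof. by move=> h *; exists 1; split=> // -[|[|]] //=; rewrite h. Qed.

Lemma ctape_cat pre s cs : ctape (pre ++ s :: cs) (Posz (size pre)) = Some s.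
Proof. by rewrite /= onth_cat ltnn subnn. Qed.

Lemma ctape_end pre : ctape pre (Posz (size pre)) = None.
Proof. by rewrite /= onth_default. Qed.

Lemma ctape_upd pre s s' cs :
  (fun j => if j == Posz (size pre) then Some s' else ctape (pre ++ s :: cs) j)
  = ctape (pre ++ s' :: cs).
Proof.
apply: functional_extensionality => -[k|k] //=.
rewrite !onth_cat; case: eqP => [[->]|hne]; first by rewrite ltnn subnn.
case: ltnP => // hk; case E: (k - size pre) => [|m] //=; case: hne; congr Posz; lia.
Qed.

Lemma ctape_ext pre s' :
  (fun j => if j == Posz (size pre) then Some s' else ctape pre j)
  = ctape (pre ++ [:: s']).
Proof.
apply: functional_extensionality => -[k|k] //=.
rewrite !onth_cat; case: eqP => [[->]|hne]; first by rewrite ltnn subnn.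
case: ltnP => // hk; rewrite onth_default //.
case E: (k - size pre) => [|m] /=; rewrite ?onth0n //; case: hne; congr Posz; lia.
Qed.

Lemma ctape_same cs k :
  (fun j => if j == k then ctape cs k else ctape cs j) = ctape cs.
Proof. by apply: functional_extensionality => j; case: eqP => [->|]. Qed.

Lemma P_instr pc i : onth P pc = Some i -> instr_ok K N i.
Proof.
move=> h; have hs : pc < size P by rewrite -onthTE h.
by have := elimT (all_nthP i) P_ok _ hs; rewrite -odflt_onth h.
Qed.

Lemma mstep_back pc b i s h tp : onth P pc = Some i -> pc < N -> tp h = Some s ->
  tm_step (@Config mTM (inord pc, Some b) h tp) =
  @Config mTM (inord pc, Some b) (h - 1)%R (fun j => if j == h then Some s else tp j).
Proof.
by move=> hi hpc hs; rewrite /tm_step /= inordK // hi hs.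
Qed.

(** The return starts at cell [k - 1] with [k <= size cs], so all cells crossed are filled and the
    first blank met is cell -1, where the jump is taken. *)
Lemma back_reach W pc b i k cs : onth P pc = Some i -> pc < N -> k <= size cs -> k <= W ->
  reach W (mconf pc (Some b) (k%:Z - 1)%R cs) (mconf (mtgt pc b) None 0%Z cs).
Proof.
move=> hi hpc; elim: k => [|k IH] hk hW.
  apply: reach_step => //=; rewrite /tm_step /= inordK // hi.
  by rewrite /mconf; congr Config; apply: (ctape_same cs (Negz 0)).
apply: (@reach_trans _ (mconf pc (Some b) (k%:Z - 1)%R cs)); last by apply: IH; lia.
have -> : (k.+1%:Z - 1 = k)%R by lia.
apply: reach_step => //=; try lia.
have [s hs] : exists s, ctape cs k = Some s.
  have := onthTE cs k; rewrite hk /=; case: (onth cs k) => // s _; by exists s.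
by rewrite /mconf (mstep_back _ hi hpc hs) -hs ctape_same.
Qed.

(** [pre] is the part already swept, which makes induction on the rest possible; [k] is the cell
    where the carry stops, from which the head has just stepped left. *)
Lemma scan_inc W pc r nx pre cs : onth P pc = Some (IInc r nx) -> pc < N ->
  size pre + size (incs r cs) <= W ->
  exists2 k, k <= size (pre ++ incs r cs) &
  reach W (mconf pc None (size pre)%:Z (pre ++ cs))
          (mconf pc (Some false) (k%:Z - 1)%R (pre ++ incs r cs)).
Proof.
move=> hi hpc; elim: cs pre => [|s cs IH] pre /= hW.
  exists (size pre); first by rewrite size_cat leq_addr.
  rewrite cats0; apply: reach_step => //=; try lia.
  rewrite /tm_step [LHS]/= inordK // hi onth_default //= cbit_czero /=.
  by rewrite /mconf -(ctape_ext pre).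
have hs := ctape_cat pre s cs.
case: ifP hW => E /= hW; last first.
  exists (size pre); first by rewrite size_cat leq_addr.
  apply: reach_step => //=; try lia.
  rewrite /tm_step [LHS]/= inordK // hi -[onth _ _]/(ctape _ (Posz _)) hs /= E /=.
  by rewrite /mconf -(ctape_upd pre s (cset s r true)).
have [|k hk hr] := IH (rcons pre (cset s r false)).
  by rewrite size_rcons; lia.
exists k; first by rewrite -cat_rcons.
rewrite -(cat_rcons (cset s r false)); apply: reach_trans hr; rewrite size_rcons.
apply: reach_step => //=; try lia.
rewrite /tm_step [LHS]/= inordK // hi -[onth _ _]/(ctape _ (Posz _)) hs /= E /=.
rewrite cat_rcons /mconf -(ctape_upd pre s (cset s r false)); congr Config; lia.
Qed.

Lemma scan_dec W pc r nx pre cs : onth P pc = Some (IDec r nx) -> pc < N ->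
  0 < regs cs r -> size pre + size cs <= W ->
  exists2 k, k <= size (pre ++ decs r cs) &
  reach W (mconf pc None (size pre)%:Z (pre ++ cs))
          (mconf pc (Some false) (k%:Z - 1)%R (pre ++ decs r cs)).
Proof.
move=> hi hpc; elim: cs pre => [|s cs IH] pre //= hpos hW.
have hs := ctape_cat pre s cs.
case: ifP hpos => E hpos.
  exists (size pre); first by rewrite size_cat leq_addr.
  apply: reach_step => //=; try lia.
  rewrite /tm_step [LHS]/= inordK // hi -[onth _ _]/(ctape _ (Posz _)) hs /= E /=.
  by rewrite /mconf -(ctape_upd pre s (cset s r false)).
have [||k hk hr] := IH (rcons pre (cset s r true)).
- by move: hpos; rewrite add0n double_gt0.
- by rewrite size_rcons; lia.
exists k; first by rewrite -cat_rcons.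
rewrite -(cat_rcons (cset s r true)); apply: reach_trans hr; rewrite size_rcons.
apply: reach_step => //=; try lia.
rewrite /tm_step [LHS]/= inordK // hi -[onth _ _]/(ctape _ (Posz _)) hs /= E /=.
rewrite cat_rcons /mconf -(ctape_upd pre s (cset s r true)); congr Config; lia.
Qed.

Lemma scan_jz W pc r z nz pre cs : onth P pc = Some (IJz r z nz) -> pc < N ->
  size pre + size cs <= W ->
  exists2 k, k <= size (pre ++ cs) &
  reach W (mconf pc None (size pre)%:Z (pre ++ cs))
          (mconf pc (Some (regs cs r == 0)) (k%:Z - 1)%R (pre ++ cs)).
Proof.
move=> hi hpc; elim: cs pre => [|s cs IH] pre /= hW.
  exists (size pre); rewrite ?cats0 //; apply: reach_step => //=; try lia.
  rewrite /tm_step [LHS]/= inordK // hi onth_default //= /mconf; congr Config.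
  by rewrite -{2}(ctape_same pre (size pre)) ctape_end.
have hs := ctape_cat pre s cs.
case E: (cbit s r) => /=.
  exists (size pre); first by rewrite size_cat leq_addr.
  apply: reach_step => //=; try lia.
  rewrite /tm_step [LHS]/= inordK // hi -[onth _ _]/(ctape _ (Posz _)) hs /= E /=.
  by rewrite /mconf -hs ctape_same.
have [|k hk hr] := IH (rcons pre s); first by rewrite size_rcons; lia.
exists k; first by rewrite -cat_rcons.
rewrite -cat_rcons add0n double_eq0; apply: reach_trans hr; rewrite size_rcons.
apply: reach_step => //=; try lia.
rewrite /tm_step [LHS]/= inordK // cat_rcons hi -[onth _ _]/(ctape _ (Posz _)) hs /= E /=.
by rewrite /mconf -hs ctape_same; congr Config; lia.
Qed.

(** Each instruction costs one sweep to the right and one return; as [B < 2 ^ W], an increment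
    bounded by [B] never makes the tape longer than [W]. *)
Lemma mstep_reach W B c c' cs : B < 2 ^ W -> size cs <= W -> c.1 < N -> c.2 = regs cs ->
  mstep B P c c' ->
  exists cs', [/\ c'.2 = regs cs', size cs' <= W, c'.1 < N &
    reach W (mconf c.1 None 0%Z cs) (mconf c'.1 None 0%Z cs')].
Proof.
move=> hB hs hpc hst h; case: h hpc hst => {c c'} [pc st r nx hi hr|pc st r nx hi hr|pc st r z nz hi] /= hpc est;
  have := P_instr hi; rewrite /= est; try rewrite est in hr.
- move=> /andP[hK hN]; have hs' : size (incs r cs) <= W.
    have : size (incs r cs) <= maxn (size cs) W by apply: size_incs; lia.
    by rewrite (maxn_idPr hs).
  exists (incs r cs); split=> //; first by rewrite regs_incs.
  have [k hk hre] := @scan_inc W pc r nx [::] cs hi hpc hs'.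
  apply: reach_trans hre _; have -> : nx = mtgt pc false by rewrite /mtgt hi.
  by apply: back_reach hi hpc hk (leq_trans hk hs').
- move=> /andP[hK hN]; exists (decs r cs); rewrite size_decs; split=> //; first by rewrite regs_decs.
  have [k hk hre] := @scan_dec W pc r nx [::] cs hi hpc hr hs.
  apply: reach_trans hre _; have -> : nx = mtgt pc false by rewrite /mtgt hi.
  have hk' : k <= W by apply: (leq_trans hk); rewrite size_decs.
  exact: (back_reach _ hi hpc hk hk').
- move=> /and3P[hK hz hnz]; exists cs; split=> //; first by case: ifP.
  have [k hk hre] := @scan_jz W pc r z nz [::] cs hi hpc hs.
  apply: reach_trans hre _.
  have -> : (if regs cs r == 0 then z else nz) = mtgt pc (regs cs r == 0) by rewrite /mtgt hi.
  by apply: back_reach hi hpc hk (leq_trans hk hs).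
Qed.

Lemma msteps_reach W B c c' cs : B < 2 ^ W -> size cs <= W -> c.1 < N -> c.2 = regs cs ->
  msteps B P c c' ->
  exists cs', [/\ c'.2 = regs cs', size cs' <= W, c'.1 < N &
    reach W (mconf c.1 None 0%Z cs) (mconf c'.1 None 0%Z cs')].
Proof.
move=> hB hs hpc hst h; elim: h cs hs hpc hst => {c c'} [c|c1 c2 c3 h12 _ IH] cs hs hpc hst.
  by exists cs; split=> //; apply: reach_refl.
have [cs2 [h1 h2 h3 h4]] := mstep_reach hB hs hpc hst h12.
have [cs3 [k1 k2 k3 k4]] := IH _ h2 h3 h1.
by exists cs3; split=> //; apply: reach_trans h4 k4.
Qed.

Lemma reach_space W x t :
  (forall i, i <= t -> ((-1)%Z <= cf_head (tm_run mTM x i))%R /\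
                       (cf_head (tm_run mTM x i) <= W%:Z)%R) ->
  tm_space mTM x t <= W.+2.
Proof.
move=> h; rewrite /tm_space; set s := undup _.
have -> : W.+2 = size [seq (k%:Z - 1)%R | k <- iota 0 W.+2] by rewrite size_map size_iota.
apply: uniq_leq_size; first exact: undup_uniq.
move=> z; rewrite mem_undup => /mapP[i]; rewrite mem_iota => hi ->.
have [h1 h2] := h i ltac:(lia).
apply/mapP; exists (absz (cf_head (tm_run mTM x i) + 1)%R); last lia.
rewrite mem_iota; lia.
Qed.

Definition inregs (x : seq bool) : store :=
  fun r => if r == 0 then foldr (fun (b : bool) a => b + a.*2) 0 x
           else if r == 1 then (2 ^ size x).-1 else 0.

Lemma regs_input x : regs (map inl x) = inregs x.
Proof.
apply: functional_extensionality => r; rewrite /inregs.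
elim: x => [|b x] /=; first by case: r => [|[]].
rewrite /cbit => ->; case: (r == 0) => //; case: (r == 1) => //=.
by rewrite expnS; have := expn_gt0 2 (size x); lia.
Qed.

Lemma minsky_space W B x h st : B < 2 ^ W -> size x <= W ->
  msteps B P (0, inregs x) (h, st) -> size P <= h ->
  exists t, [/\ halted (tm_run mTM x t), tm_space mTM x t <= W.+2 &
                 tm_accept (cf_state (tm_run mTM x t)) = (h == acc)].
Proof.
move=> hB hx hP hh.
have [] := @msteps_reach W B _ _ (map inl x) hB _ _ _ hP => //.
- by rewrite size_map.
- by rewrite regs_input.
move=> cs [_ _ hN [t [ht hb]]].
have e0 : mconf 0 None 0%Z (map inl x) = init_config mTM x.
  rewrite /mconf /init_config; congr Config; first by congr (_, _); apply: val_inj; rewrite /= inordK.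
  apply: functional_extensionality => -[k|k] //=; rewrite onth_map.
  case: ltnP => hk; last by rewrite onth_default.
  by have := odflt_onth false x k; have := onthTE x k; rewrite hk; case: onth => //= b _ ->.
rewrite e0 in ht hb; exists t; rewrite /tm_run; split.
- by rewrite ht /halted /= inordK // onth_default.
- exact: reach_space hb.
- by rewrite ht /= inordK.
Qed.
End Sweep.

(** * Loop programs and their compilation to register programs *)

Inductive cmd :=
  | CSkip
  | CInc of nat
  | CDec of nat
  | CSeq of cmd & cmd
  | CWhile of nat & cmd.

(* Every value ever stored is at most [B]. *)
Inductive exec (B : nat) : cmd -> store -> store -> Prop :=
  | XSkip st : exec B CSkip st st
  | XInc r st : st r < B -> exec B (CInc r) st (upd st r (st r).+1)
  | XDec r st : 0 < st r -> exec B (CDec r) st (upd st r (st r).-1)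
  | XSeq c1 c2 st1 st2 st3 : exec B c1 st1 st2 -> exec B c2 st2 st3 ->
      exec B (CSeq c1 c2) st1 st3
  | XDone r c st : st r = 0 -> exec B (CWhile r c) st st
  | XLoop r c st1 st2 st3 : 0 < st1 r -> exec B c st1 st2 ->
      exec B (CWhile r c) st2 st3 -> exec B (CWhile r c) st1 st3.

Fixpoint csize c :=
  match c with
  | CSkip | CInc _ | CDec _ => 1
  | CSeq c1 c2 => csize c1 + csize c2
  | CWhile _ c => (csize c).+1
  end.

Fixpoint cregs c :=
  match c with
  | CSkip => 0
  | CInc r | CDec r => r.+1
  | CSeq c1 c2 => maxn (cregs c1) (cregs c2)
  | CWhile r c => maxn r.+1 (cregs c)
  end.

(** [b] is the address of the code and [nx] the address at which to continue; [CSkip] becomes an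
    unconditional jump, a test with equal branches. *)
Fixpoint comp c b nx : seq instr :=
  match c with
  | CSkip => [:: IJz 0 nx nx]
  | CInc r => [:: IInc r nx]
  | CDec r => [:: IDec r nx]
  | CSeq c1 c2 => comp c1 b (b + csize c1) ++ comp c2 (b + csize c1) nx
  | CWhile r c => IJz r nx b.+1 :: comp c b.+1 b
  end.

Lemma size_comp c b nx : size (comp c b nx) = csize c.
Proof. by elim: c b nx => //= [c1 IH1 c2 IH2|_ c IH] b nx; rewrite ?size_cat ?IH1 ?IH2 ?IH. Qed.

Lemma comp_instr_ok K N c b nx : 0 < K -> cregs c <= K -> b + csize c < N -> nx < N ->
  all (instr_ok K N) (comp c b nx).
Proof.
move=> hK; elim: c b nx => [|r|r|c1 IH1 c2 IH2|r c IH] /= *; rewrite ?all_cat; try lia.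
  by rewrite IH1 ?IH2; lia.
by rewrite IH; lia.
Qed.

Lemma msteps_trans B P c2 c1 c3 : msteps B P c1 c2 -> msteps B P c2 c3 -> msteps B P c1 c3.
Proof. by elim=> // a b c h _ IH /IH; apply: MTrans h. Qed.

Lemma mstep1 B P c1 c2 : mstep B P c1 c2 -> msteps B P c1 c2.
Proof. by move=> h; apply: MTrans h (MRefl _ _ _). Qed.

(** [P] has to agree with the compiled code only on the window of that code, so the statement
    applies to a subprogram placed anywhere. *)
Lemma comp_exec B c st st' P b nx : exec B c st st' ->
  (forall i, i < csize c -> onth P (b + i) = onth (comp c b nx) i) ->
  msteps B P (b, st) (nx, st').
Proof.
move=> h; elim: h P b nx => {c st st'}.
- move=> st P b nx /(_ 0 isT); rewrite addn0 /= => h.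
  by apply: mstep1; have := MJz B st h; case: ifP.
- by move=> r st hr P b nx /(_ 0 isT); rewrite addn0 /= => h; apply: mstep1; apply: MInc.
- by move=> r st hr P b nx /(_ 0 isT); rewrite addn0 /= => h; apply: mstep1; apply: MDec.
- move=> c1 c2 st1 st2 st3 _ IH1 _ IH2 P b nx /= h.
  apply: (@msteps_trans _ _ (b + csize c1, st2)).
    apply: IH1 => i hi; rewrite h; last lia.
    by rewrite onth_cat size_comp hi.
  apply: IH2 => i hi; rewrite -addnA h; last lia.
  by rewrite onth_cat size_comp ltnNge leq_addr /= addKn.
- move=> r c st hr P b nx /(_ 0 isT); rewrite addn0 /= => h.
  by apply: mstep1; have := MJz B st h; rewrite hr.
- move=> r c st1 st2 st3 hr _ IH1 _ IH2 P b nx h.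
  have h0 := h 0 isT; rewrite addn0 /= in h0.
  apply: MTrans (MJz B st1 h0) _; rewrite gtn_eqF //.
  apply: (@msteps_trans _ _ (b, st2)); last exact: IH2.
  by apply: IH1 => i hi; rewrite addSnnS h.
Qed.

Theorem cmd_space (c : cmd) (r : nat) : exists M : TM, forall x W B st,
  exec B c (inregs x) st -> B < 2 ^ W -> size x <= W ->
  exists t, [/\ halted (tm_run M x t), tm_space M x t <= W.+2 &
                tm_accept (cf_state (tm_run M x t)) = (st r != 0)].
Proof.
(* A last test jumps to [L.+1] or [L.+2]. Both lie outside the program, so the machine halts, and
   [L.+2], taken when [r] is nonzero, is the accepting address. *)
set L := csize c; set P := comp c 0 L ++ [:: IJz r L.+1 L.+2].
set K := maxn (cregs c) r.
have sP : size P = L.+1 by rewrite size_cat size_comp addn1.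
have okP : all (instr_ok K.+2 L.+3) P.
  rewrite all_cat /= comp_instr_ok //; rewrite /K -/L; lia.
exists (mTM K L.+2 P L.+2) => x W B st hex hB hx.
have hs : msteps B P (0, inregs x) (if st r == 0 then L.+1 else L.+2, st).
  apply: (@msteps_trans _ _ (L, st)).
    apply: comp_exec hex _ => i hi; rewrite add0n onth_cat size_comp hi //.
  by apply/mstep1/MJz; rewrite onth_cat size_comp ltnn subnn.
have hh : size P <= (if st r == 0 then L.+1 else L.+2) by rewrite sP; case: ifP.
have [t [h1 h2 h3]] := minsky_space L.+2 okP hB hx hs hh.
exists t; split=> //; rewrite h3; case: ifP => // _.
  by rewrite ltn_eqF.
by rewrite eqxx.
Qed.

(** * Expressions and their space *)

(* Expressions denote vectors. The body of [EIter n i b] is evaluated in the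
   environment made of the current vector followed by the ambient one. *)
Inductive expr :=
  | EVar of nat
  | EZero
  | ESucc of expr
  | ENil
  | ECons of expr & expr
  | EComp of expr & expr
  | EIter of expr & expr & expr.

Fixpoint eval (e : expr) (env : seq nat) : seq nat :=
  match e with
  | EVar i => [:: nth 0 env i]
  | EZero => [:: 0]
  | ESucc e => [:: (nth 0 (eval e env) 0).+1]
  | ENil => [::]
  | ECons a b => eval a env ++ eval b env
  | EComp f g => eval f (eval g env)
  | EIter n i b =>
      iter (nth 0 (eval n env) 0) (fun vs => eval b (vs ++ env)) (eval i env)
  end.

Fixpoint wd (e : expr) : nat :=
  match e with
  | EVar _ | EZero | ESucc _ => 1
  | ENil => 0
  | ECons a b => wd a + wd b
  | EComp f _ => wd f
  | EIter _ i _ => wd i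
  end.

Fixpoint wf (e : expr) : bool :=
  match e with
  | EVar _ | EZero | ENil => true
  | ESucc e => wf e && (wd e == 1)
  | ECons a b | EComp a b => wf a && wf b
  | EIter n i b => [&& wf n, wf i, wf b, wd n == 1 & wd i == wd b]
  end.

(* No value arising in the evaluation of [e] exceeds [B]. *)
Fixpoint ok (B : nat) (e : expr) (env : seq nat) : Prop :=
  match e with
  | EVar i => nth 0 env i <= B
  | EZero | ENil => True
  | ESucc e => ok B e env /\ nth 0 (eval e env) 0 < B
  | ECons a b => ok B a env /\ ok B b env
  | EComp f g => ok B g env /\ ok B f (eval g env)
  | EIter n i b => [/\ ok B n env, ok B i env &
      forall k, k < nth 0 (eval n env) 0 ->
        ok B b (iter k (fun vs => eval b (vs ++ env)) (eval i env) ++ env)]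
  end.

Lemma size_eval e env : wf e -> size (eval e env) = wd e.
Proof.
elim: e env => //= [a IHa b IHb|f IHf g IHg|n IHn i IHi b IHb] env.
- by case/andP=> ha hb; rewrite size_cat IHa ?IHb.
- by case/andP=> hf hg; rewrite IHf.
- case/and5P=> hn hi hb _ /eqP hw; elim: (nth _ _ _) => [|k IH] /=; first exact: IHi.
  by rewrite IHb.
Qed.

Lemma ok_le B e env j : ok B e env -> nth 0 (eval e env) j <= B.
Proof.
elim: e env j => [i|||||f IHf g IHg|] /=.
- by move=> env [|j] //= _; rewrite nth_nil.
- by move=> env [|[|]].
- by move=> e _ env [|[|j]] [] //=.
- by move=> env j; rewrite nth_nil.
- by move=> a IHa b IHb env j [ha hb]; rewrite nth_cat; case: ifP => _; auto.
- by move=> env j [hg hf]; auto.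
- move=> n IHn i IHi b IHb env j [hn hi hb].
  case: (nth _ _ _) hb => [|k] hb /=; first exact: IHi.
  by apply: IHb; apply: hb.
Qed.

Lemma ok_mono B B' e env : B <= B' -> ok B e env -> ok B' e env.
Proof.
move=> hB; elim: e env => [i||||||] //=.
- by move=> env h; apply: leq_trans hB.
- by move=> e IH env [/IH ? h]; split=> //; apply: leq_trans hB.
- by move=> a IHa b IHb env [/IHa ? /IHb].
- by move=> f IHf g IHg env [/IHg ? /IHf].
- move=> n IHn i IHi b IHb env [/IHn ? /IHi ? hb]; split=> // k /hb; exact: IHb.
Qed.

(** * Compilation of expressions into loop programs *)

Definition clear r := CWhile r (CDec r).
Definition pour x y := CWhile x (CSeq (CDec x) (CInc y)).
Definition move_reg x y := CSeq (clear y) (pour x y).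
(** A counter can only be read destructively: [x] is emptied into two registers at once and restored
    from the scratch register [t.+1]. *)
Definition copy x t :=
  CSeq (clear t) (CSeq (clear t.+1) (CSeq
    (CWhile x (CSeq (CDec x) (CSeq (CInc t) (CInc t.+1))))
    (pour t.+1 x))).
Fixpoint move_up x y n :=
  if n is n'.+1 then CSeq (move_reg x y) (move_up x.+1 y.+1 n') else CSkip.
(** For [x = y] a transfer would clear its own source; this occurs in [EComp] when the inner vector
    is empty. *)
Definition moves x y n := if y < x then move_up x y n else CSkip.

(* The value of [e] is left in the registers from [t] on; [rho] lists the
   registers holding the environment, all below [t]. *)
Fixpoint code (e : expr) (rho : seq nat) (t : nat) : cmd :=
  match e with
  | EVar i => if i < size rho then copy (nth 0 rho i) t else clear t
  | EZero => clear t
  | ESucc e => CSeq (code e rho t) (CInc t)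
  | ENil => CSkip
  | ECons a b => CSeq (code a rho t) (code b rho (t + wd a))
  | EComp f g =>
      CSeq (code g rho t)
           (CSeq (code f (iota t (wd g)) (t + wd g)) (moves (t + wd g) t (wd f)))
  | EIter n i b =>
      CSeq (code n rho t) (CSeq (code i rho t.+1)
        (CSeq (CWhile t (CSeq (CDec t)
                 (CSeq (code b (iota t.+1 (wd i) ++ rho) (t.+1 + wd i))
                       (moves (t.+1 + wd i) t.+1 (wd i)))))
              (move_up t.+1 t (wd i))))
  end.

Ltac store_eq := let r := fresh "r" in
  apply: functional_extensionality => r; rewrite /upd;
  repeat match goal with x := _ |- _ => clearbody x end;
  repeat case: eqP => //; intros; subst; try lia.

Ltac upd_lia := rewrite /upd; repeat (case: eqP => //; intros); try lia.

Lemma exec_clear B r st : exec B (clear r) st (upd st r 0).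
Proof.
move E: (st r) => n; elim: n st E => [|n IH] st E.
  have -> : upd st r 0 = st by store_eq.
  exact: XDone.
apply: (@XLoop _ _ _ _ (upd st r n)); first by rewrite E.
  by have := @XDec B r st; rewrite E; apply.
have -> : upd st r 0 = upd (upd st r n) r 0 by store_eq.
by apply: IH; rewrite /upd eqxx.
Qed.

Lemma exec_pour B x y st : x != y -> st x + st y <= B ->
  exec B (pour x y) st (upd (upd st y (st x + st y)) x 0).
Proof.
move=> hxy; move E: (st x) => n; elim: n st E => [|n IH] st E h.
  have -> : upd (upd st y (0 + st y)) x 0 = st by store_eq.
  exact: XDone.
pose st1 := upd st x n; pose st2 := upd st1 y (st y).+1.
have eq1 : st1 y = st y by rewrite /st1 /upd eq_sym (negbTE hxy).
apply: (@XLoop _ _ _ _ st2); first by rewrite E.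
  apply: (@XSeq _ _ _ _ st1); first by have := @XDec B x st; rewrite E; apply.
  by have := @XInc B y st1; rewrite /st2 eq1; apply; lia.
have e2 : st2 x = n by rewrite /st2 /st1 /upd (negbTE hxy) eqxx.
have e3 : st2 y = (st y).+1 by rewrite /st2 /upd eqxx.
have -> : upd (upd st y (n.+1 + st y)) x 0 = upd (upd st2 y (n + st2 y)) x 0.
  by rewrite e3 /st2 /st1; store_eq.
by apply: IH => //; rewrite e3; lia.
Qed.

Lemma exec_move B x y st : x != y -> st x <= B ->
  exec B (move_reg x y) st (upd (upd st y (st x)) x 0).
Proof.
move=> hxy h; apply: (XSeq (exec_clear B y st)).
have e1 : upd st y 0 x = st x by rewrite /upd (negbTE hxy).
have e2 : upd st y 0 y = 0 by rewrite /upd eqxx.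
have := @exec_pour B x y (upd st y 0) hxy; rewrite e1 e2 addn0 => /(_ h).
have -> // : upd (upd (upd st y 0) y (st x)) x 0 = upd (upd st y (st x)) x 0.
by store_eq.
Qed.

Lemma exec_copy B x t st : x < t -> st x <= B ->
  exec B (copy x t) st (upd (upd st t (st x)) t.+1 0).
Proof.
move=> hxt h; apply: XSeq (exec_clear _ _ _) _; apply: XSeq (exec_clear _ _ _) _.
have loop n st0 : st0 x = n -> st0 t + n <= B -> st0 t.+1 + n <= B ->
  exec B (CWhile x (CSeq (CDec x) (CSeq (CInc t) (CInc t.+1)))) st0
    (upd (upd (upd st0 t (st0 t + n)) t.+1 (st0 t.+1 + n)) x 0).
  elim: n st0 => [|n IH] st0 E h1 h2.
    rewrite !addn0; have -> : upd (upd (upd st0 t (st0 t)) t.+1 (st0 t.+1)) x 0 = st0 by store_eq.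
    exact: XDone.
  pose st1 := upd st0 x n; pose st2 := upd st1 t (st0 t).+1.
  pose st3 := upd st2 t.+1 (st0 t.+1).+1.
  have a1 : st1 t = st0 t by rewrite /st1; upd_lia.
  have a2 : st2 t.+1 = st0 t.+1 by rewrite /st2 /st1; upd_lia.
  apply: (@XLoop _ _ _ _ st3); first by rewrite E.
    apply: (@XSeq _ _ _ _ st1); first by have := @XDec B x st0; rewrite E; apply.
    apply: (@XSeq _ _ _ _ st2).
      by have := @XInc B t st1; rewrite a1; apply; lia.
    by have := @XInc B t.+1 st2; rewrite a2; apply; lia.
  have b1 : st3 x = n by rewrite /st3 /st2 /st1; upd_lia.
  have b2 : st3 t = (st0 t).+1 by rewrite /st3 /st2; upd_lia.
  have b3 : st3 t.+1 = (st0 t.+1).+1 by rewrite /st3; upd_lia.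
  have := IH st3 b1; rewrite b2 b3 !addSnnS => /(_ h1 h2).
  set s1 := upd _ _ _; set s2 := upd _ _ _; have -> // : s1 = s2.
  by rewrite /s1 /s2 /st3 /st2 /st1; store_eq.
set st0 := upd _ _ _.
have c1 : st0 x = st x by rewrite /st0; upd_lia.
have c2 : st0 t = 0 by rewrite /st0; upd_lia.
have c3 : st0 t.+1 = 0 by rewrite /st0; upd_lia.
have := loop (st x) st0 c1; rewrite c2 c3 !add0n => /(_ h h) hl.
apply: XSeq hl _; set st1 := upd _ _ _.
have d1 : st1 x = 0 by rewrite /st1; upd_lia.
have d2 : st1 t.+1 = st x by rewrite /st1; upd_lia.
have hne : t.+1 != x by rewrite gtn_eqF //; lia.
have := @exec_pour B t.+1 x st1 hne; rewrite d1 d2 addn0 => /(_ h).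
set s1 := upd _ _ _; set s2 := upd _ _ _; have -> // : s1 = s2.
by rewrite /s1 /s2 /st1 /st0; store_eq.
Qed.

(** The block moves to lower addresses in increasing order, so a target can coincide with a source
    only after that source has been moved. *)
Lemma exec_move_up B n x y st : y < x -> (forall j, j < n -> st (x + j) <= B) ->
  exists st', [/\ exec B (move_up x y n) st st',
    forall j, j < n -> st' (y + j) = st (x + j) & forall r, r < y -> st' r = st r].
Proof.
move=> hyx; elim: n x y st hyx => [|n IH] x y st hyx h /=.
  by exists st; split=> //; apply: XSkip.
have hx : st x <= B by have := h 0 isT; rewrite addn0.
have hxy : x != y by rewrite gtn_eqF.
set st1 := upd (upd st y (st x)) x 0.
have e1 j : st1 (x.+1 + j) = st (x.+1 + j) by rewrite /st1; upd_lia.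
have [|j hj|st2 [k1 k2 k3]] := IH x.+1 y.+1 st1; first by [].
  by rewrite e1 addSnnS; apply: h.
exists st2; split; first exact: XSeq (exec_move hxy hx) k1.
- case=> [_|j hj]; last by rewrite -!addSnnS k2 // e1.
  by rewrite !addn0 k3 // /st1 /upd ltn_eqF // eqxx.
- by move=> r hr; rewrite k3 ?/st1 /upd ?ltn_eqF //; lia.
Qed.

Lemma exec_moves B n x y st : y <= x -> (forall j, j < n -> st (x + j) <= B) ->
  exists st', [/\ exec B (moves x y n) st st',
    forall j, j < n -> st' (y + j) = st (x + j) & forall r, r < y -> st' r = st r].
Proof.
move=> hyx h; rewrite /moves; case: ltnP => hxy; first exact: exec_move_up.
have -> : y = x by lia.
by exists st; split=> //; apply: XSkip.
Qed.

Lemma eq_map_below (st st' : store) rho t : all (fun r => r < t) rho ->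
  (forall r, r < t -> st' r = st r) -> map st' rho = map st rho.
Proof. by move=> /allP h1 h2; apply/eq_in_map => r /h1 /h2. Qed.

Lemma map_iota_eval (st : store) t e env : wf e ->
  (forall j, j < wd e -> st (t + j) = nth 0 (eval e env) j) ->
  map st (iota t (wd e)) = eval e env.
Proof.
move=> hw h; apply: (@eq_from_nth _ 0); first by rewrite size_map size_iota size_eval.
move=> j; rewrite size_map size_iota => hj.
by rewrite (nth_map 0) ?size_iota // nth_iota // h.
Qed.

(** Preservation of the registers below [t] lets the environment, and results already computed,
    survive the evaluation of the next subexpression. *)
Theorem code_exec B e rho t st : wf e -> all (fun r => r < t) rho -> ok B e (map st rho) ->
  exists st', [/\ exec B (code e rho t) st st', forall r, r < t -> st' r = st r &
    forall j, j < wd e -> st' (t + j) = nth 0 (eval e (map st rho)) j].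
Proof.
elim: e rho t st => [i||e IHe||a IHa b IHb|f IHf g IHg|n IHn i IHi b IHb] rho t st /=.
- move=> _ hrho h; case: ifP => hi; last first.
    exists (upd st t 0); split; first exact: exec_clear.
      by move=> r hr; rewrite /upd ltn_eqF.
    by case=> // _; rewrite addn0 /upd eqxx /= nth_default // size_map leqNgt hi.
  rewrite (nth_map 0) // in h *; have hx := allP hrho _ (mem_nth 0 hi).
  eexists; split; first exact: exec_copy h.
    by move=> r hr; rewrite /upd !ltn_eqF //; lia.
  by case=> // _; rewrite addn0 /upd eqxx ltn_eqF.
- move=> _ hrho _; exists (upd st t 0); split; first exact: exec_clear.
    by move=> r hr; rewrite /upd ltn_eqF.
  by case=> // _; rewrite addn0 /upd eqxx.
- case/andP=> hw /eqP hwd hrho [hok hlt].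
  have [st1 [k1 k2 k3]] := IHe _ _ _ hw hrho hok.
  have e1 : st1 t = nth 0 (eval e (map st rho)) 0 by rewrite -k3 ?addn0 ?hwd.
  exists (upd st1 t (st1 t).+1); split.
  + by apply: XSeq k1 _; apply: XInc; rewrite e1.
  + by move=> r hr; rewrite /upd ltn_eqF // k2.
  + by case=> // _; rewrite addn0 /upd eqxx e1.
- by move=> _ _ _; exists st; split=> //; apply: XSkip.
- case/andP=> ha hb hrho [oa ob].
  have [st1 [k1 k2 k3]] := IHa _ _ _ ha hrho oa.
  have em := eq_map_below hrho k2.
  have hrho' : all (fun r => r < t + wd a) rho by apply: sub_all hrho => r hr; lia.
  have [|st2 [l1 l2 l3]] := IHb _ _ st1 hb hrho'; first by rewrite em.
  exists st2; split; first exact: XSeq k1 l1.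
    by move=> r hr; rewrite l2 ?k2 //; lia.
  move=> j hj; rewrite nth_cat size_eval //; case: ltnP => hja.
    by rewrite l2 ?k3 //; lia.
  by rewrite -em -l3; [congr st2; lia|lia].
- case/andP=> hf hg hrho [okg okf].
  have [st1 [k1 k2 k3]] := IHg _ _ _ hg hrho okg.
  have em := map_iota_eval hg k3.
  have hi : all (fun r => r < t + wd g) (iota t (wd g)).
    by apply/allP => r; rewrite mem_iota; lia.
  have [|st2 [l1 l2 l3]] := IHf _ _ st1 hf hi; first by rewrite em.
  rewrite em in l3.
  have [|j hj|st3 [m1 m2 m3]] := @exec_moves B (wd f) (t + wd g) t st2; first lia.
    by rewrite l3 // ok_le.
  exists st3; split; first exact: XSeq k1 (XSeq l1 m1).
    by move=> r hr; rewrite m3 // l2 ?k2 //; lia.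
  by move=> j hj; rewrite m2 // l3.
- case/and5P=> hn hi hb /eqP hwn /eqP hwi hrho [on oi ob].
  have [st1 [k1 k2 k3]] := IHn _ _ _ hn hrho on.
  have em1 := eq_map_below hrho k2.
  have hrho1 : all (fun r => r < t.+1) rho by apply: sub_all hrho => r hr; lia.
  have [|st2 [l1 l2 l3]] := IHi _ _ st1 hi hrho1; first by rewrite em1.
  rewrite em1 in l3.
  set env := map st rho in on oi ob k3 l3 em1 *.
  have em2 : map st2 rho = env by rewrite -em1; apply: eq_map_below hrho _ => r hr; apply: l2; lia.
  have ev2 := map_iota_eval hi l3.
  have st2t : st2 t = nth 0 (eval n env) 0 by rewrite l2 // -k3 ?addn0 ?hwn.
  set F := (fun vs => eval b (vs ++ env)) in ob *.
  (* Loop invariant: the counter is in [t], the current vector starts at [t.+1], and the ambient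
     environment is untouched. *)
  have loop c s : s t = c -> map s rho = env ->
      (forall k, k < c -> ok B b (iter k F (map s (iota t.+1 (wd i))) ++ env)) ->
      exists s', [/\ exec B (CWhile t (CSeq (CDec t)
                 (CSeq (code b (iota t.+1 (wd i) ++ rho) (t.+1 + wd i))
                       (moves (t.+1 + wd i) t.+1 (wd i))))) s s',
        forall r, r < t -> s' r = s r &
        map s' (iota t.+1 (wd i)) = iter c F (map s (iota t.+1 (wd i)))].
    elim: c s => [|c IH] s hs he hk; first by exists s; split=> //; apply: XDone.
    pose s1 := upd s t c.
    have x1 : exec B (CDec t) s s1 by have := @XDec B t s; rewrite hs; apply.
    have x2 : map s1 (iota t.+1 (wd i) ++ rho) = map s (iota t.+1 (wd i)) ++ env.
      rewrite map_cat; congr (_ ++ _).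
        by apply/eq_in_map => r; rewrite mem_iota => hr; rewrite /s1 /upd gtn_eqF //; lia.
      by rewrite -he; apply: eq_map_below hrho _ => r hr; rewrite /s1 /upd ltn_eqF.
    have hr1 : all (fun r => r < t.+1 + wd i) (iota t.+1 (wd i) ++ rho).
      rewrite all_cat; apply/andP; split; last by apply: sub_all hrho => r hr; lia.
      by apply/allP => r; rewrite mem_iota; lia.
    have [|s2 [y1 y2 y3]] := IHb _ _ s1 hb hr1; first by rewrite x2; apply: (hk 0).
    rewrite x2 in y3.
    have [|j hj|s3 [z1 z2 z3]] := @exec_moves B (wd i) (t.+1 + wd i) t.+1 s2; first lia.
       rewrite y3 -?hwi //; apply: ok_le; exact: (hk 0).
    have e3 : map s3 (iota t.+1 (wd i)) = F (map s (iota t.+1 (wd i))).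
      by rewrite hwi /F; apply: map_iota_eval hb _ => j hj; rewrite z2 ?y3 // hwi.
    have [|||s4 [w1 w2 w3]] := IH s3.
    + by rewrite z3 // y2 ?/s1 /upd ?eqxx //; lia.
    + rewrite -he; apply: eq_map_below hrho _ => r hr.
      by rewrite z3 ?y2 ?/s1 /upd ?ltn_eqF //; lia.
    + by move=> k hkc; rewrite e3 -iterSr; apply: hk.
    exists s4; split.
    + by apply: XLoop w1; [rewrite hs|exact: XSeq x1 (XSeq y1 z1)].
    + by move=> r hr; rewrite w2 // z3 ?y2 ?/s1 /upd ?ltn_eqF //; lia.
    + by rewrite w3 e3 -iterSr.
  have [|s3 [m1 m2 m3]] := loop _ st2 st2t em2; first by rewrite ev2.
  rewrite ev2 in m3.
  have sz : size (iter (nth 0 (eval n env) 0) F (eval i env)) = wd i.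
    by have := @size_eval (EIter n i b) env; apply; rewrite /= hn hi hb hwn hwi !eqxx.
  have v3 j : j < wd i -> s3 (t.+1 + j) = nth 0 (iter (nth 0 (eval n env) 0) F (eval i env)) j.
    move=> hj; rewrite -m3 (nth_map 0) ?size_iota // nth_iota //.
  have [|j hj|s4 [n1 n2 n3]] := @exec_move_up B (wd i) t.+1 t s3; first lia.
    rewrite v3 //; apply: (@ok_le B (EIter n i b) env j); split=> //.
  exists s4; split.
  + exact: XSeq k1 (XSeq l1 (XSeq m1 n1)).
  + by move=> r hr; rewrite n3 // m2 // l2 ?k2 //; lia.
  + by move=> j hj; rewrite n2 // v3.
Qed.

Theorem expr_space e : wf e -> wd e = 1 -> exists M : TM, forall x W B,
  let env := [:: inregs x 0; inregs x 1] in
  ok B e env -> B < 2 ^ W -> size x <= W ->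
  exists t, [/\ halted (tm_run M x t), tm_space M x t <= W.+2 &
                tm_accept (cf_state (tm_run M x t)) = (nth 0 (eval e env) 0 != 0)].
Proof.
move=> hwf hwd; have [M hM] := cmd_space (code e [:: 0; 1] 2) 2.
exists M => x W B env hok hB hx.
have [//|st [h1 _ h3]] := @code_exec B e [:: 0; 1] 2 (inregs x) hwf isT.
have [t [? ? ht]] := hM _ _ _ _ h1 hB hx; exists t; split=> //.
by rewrite ht -/env -[2]addn0 h3 ?hwd.
Qed.

(** * Linear-space functions *)

Definition mx (env : seq nat) := foldr maxn 0 env.

(* Functions of k numbers computable with all intermediate values polynomial
   in the largest argument, that is, in space linear in the input length. *)
Definition LSv (k w : nat) (F : seq nat -> seq nat) : Prop :=
  exists e c, [/\ wf e, wd e = w & forall env, size env = k ->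
    eval e env = F env /\ ok ((mx env + 2) ^ c) e env].

Definition LS (k : nat) (f : seq nat -> nat) : Prop := LSv k 1 (fun env => [:: f env]).

Lemma mx_nth env i : nth 0 env i <= mx env.
Proof.
elim: env i => [|x env IH] [|i] //=; first by rewrite leq_maxl.
by rewrite leq_max IH orbT.
Qed.

Lemma mx_le env B : (forall i, i < size env -> nth 0 env i <= B) -> mx env <= B.
Proof.
elim: env => //= x env IH h; rewrite geq_max (h 0) //=.
by apply: IH => i hi; apply: (h i.+1).
Qed.

Lemma mx_cat s t : mx (s ++ t) = maxn (mx s) (mx t).
Proof. by elim: s => [|x s IH] /=; rewrite ?max0n // IH maxnA. Qed.

Lemma pow_mono X a b : a <= b -> (X + 2) ^ a <= (X + 2) ^ b.
Proof. by move=> h; rewrite leq_pexp2l // addn2. Qed.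

Lemma pow_ge1 X c : 0 < (X + 2) ^ c.
Proof. by rewrite expn_gt0 addn2. Qed.

Lemma pow_add2 X c : (X + 2) ^ c + 2 <= (X + 2) ^ c.+2.
Proof. by rewrite !expnS; have := pow_ge1 X c; nia. Qed.

(** Composition multiplies the exponents; [c.+2] in place of [c] pays for the [+ 2] in the base. *)
Lemma pow_compose X Y c d : Y <= (X + 2) ^ c -> (Y + 2) ^ d <= (X + 2) ^ (c.+2 * d).
Proof.
move=> h; rewrite expnM; case: d => // d; rewrite leq_exp2r //.
by apply: leq_trans (pow_add2 X c); rewrite leq_add2r.
Qed.

Lemma LSv_size k w F env : LSv k w F -> size env = k -> size (F env) = w.
Proof. by move=> [e [c [hw <- h]]] /h [<- _]; exact: size_eval. Qed.

Lemma LSv_bound k w F : LSv k w F ->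
  exists c, forall env, size env = k -> mx (F env) <= (mx env + 2) ^ c.
Proof.
move=> [e [c [_ _ h]]]; exists c => env /h [<- hok].
by apply: mx_le => i _; apply: ok_le.
Qed.

Lemma LS_bound k f : LS k f -> exists c, forall env, size env = k -> f env <= (mx env + 2) ^ c.
Proof. by move=> /LSv_bound [c h]; exists c => env /h; rewrite /= maxn0. Qed.

Lemma LSv_ext k w F G : (forall env, size env = k -> F env = G env) -> LSv k w F -> LSv k w G.
Proof.
by move=> hFG [e [c [h1 h2 h3]]]; exists e, c; split=> // env hs; rewrite -hFG //; apply: h3.
Qed.

Lemma LS_ext k f g : (forall env, size env = k -> f env = g env) -> LS k f -> LS k g.
Proof. by move=> h; apply: LSv_ext => env /h ->. Qed.

Lemma LS_var k i : LS k (fun env => nth 0 env i).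
Proof.
exists (EVar i), 1; split=> // env _; split=> //=; rewrite expn1.
by apply: leq_trans (mx_nth _ _) _; rewrite leq_addr.
Qed.

Lemma LSv_comp k w v F G : LSv w v F -> LSv k w G -> LSv k v (fun env => F (G env)).
Proof.
move=> hF hG; have sG := LSv_size hG; have [cG bG] := LSv_bound hG.
case: hF hG => [eF [cF [wF dF hF]]] [eG [c [wG dG hG]]].
exists (EComp eF eG), (maxn c (cG.+2 * cF)); split=> //=; first by rewrite wF.
move=> env hs; have [e1 o1] := hG env hs; have [e2 o2] := hF (G env) (sG _ hs).
rewrite e1 e2; split=> //; split; first by apply: ok_mono o1; apply: pow_mono; rewrite leq_maxl.
apply: ok_mono o2; apply: leq_trans (pow_compose cF (bG _ hs)) _.
by apply: pow_mono; rewrite leq_maxr.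
Qed.

Lemma LSv_nil k : LSv k 0 (fun=> [::]).
Proof. by exists ENil, 0; split. Qed.

Lemma LSv_cons k w f G : LS k f -> LSv k w G -> LSv k w.+1 (fun env => f env :: G env).
Proof.
move=> [eF [cF [wF dF hF]]] [eG [c [wG dG hG]]].
exists (ECons eF eG), (maxn c cF); split=> /=; [by rewrite wF|by rewrite dF dG|].
move=> env hs; have [e1 o1] := hG env hs; have [e2 o2] := hF env hs.
rewrite e1 e2; split=> //; split; [apply: ok_mono o2|apply: ok_mono o1];
  by apply: pow_mono; rewrite ?leq_maxl ?leq_maxr.
Qed.

Lemma LS_comp k w f G : LS w f -> LSv k w G -> LS k (fun env => f (G env)).
Proof. exact: LSv_comp. Qed.

Lemma LS_nth k w F i : LSv k w F -> LS k (fun env => nth 0 (F env) i).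
Proof. exact: (LS_comp (LS_var w i)). Qed.

Lemma LS_0 k : LS k (fun=> 0).
Proof. by exists EZero, 0; split. Qed.

Lemma LS_S k f : LS k f -> LS k (fun env => (f env).+1).
Proof.
move=> [e [c [hw hd h]]]; exists (ESucc e), c.+2; split=> //=; first by rewrite hw hd.
move=> env hs; have [he o] := h env hs; have := ok_le 0 o; rewrite he /= => hf; split=> //.
split; first by apply: ok_mono o; apply: pow_mono; lia.
by have := pow_add2 (mx env) c; lia.
Qed.

(** Iteration can outgrow every polynomial, so a bound on the iterates is assumed. It concerns only
    the inputs of the body, hence [i < n env]; the last iterate is a value of the body and bounded
    as such. *)
Lemma LSv_iter k w n I F : LS k n -> LSv k w I -> LSv (w + k) w F ->
  (exists c, forall env, size env = k -> forall i, i < n env ->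
     mx (iter i (fun vs => F (vs ++ env)) (I env)) <= (mx env + 2) ^ c) ->
  LSv k w (fun env => iter (n env) (fun vs => F (vs ++ env)) (I env)).
Proof.
move=> hn hI hF [c0 b0]; have sI := LSv_size hI; have sF := LSv_size hF.
case: hn hI hF => [en [cn [wn dn hn]]] [ei [ci [wi di hi]]] [ef [cf [wF dF hF]]].
pose c1 := maxn c0 1; pose c := maxn cn (maxn ci (c1.+2 * cf)).
exists (EIter en ei ef), c; split=> //=; first by rewrite wn wi wF dn di dF !eqxx.
move=> env hs; have [e1 o1] := hn env hs; have [e2 o2] := hi env hs.
rewrite e1 e2 /=.
have sit i : size (iter i (fun vs => F (vs ++ env)) (I env)) = w.
  by elim: i => [|i IH] /=; [exact: sI|rewrite sF // size_cat IH hs].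
have eit i : iter i (fun vs => eval ef (vs ++ env)) (I env) =
             iter i (fun vs => F (vs ++ env)) (I env).
  by elim: i => //= i ->; have [] := hF (iter i (fun vs => F (vs ++ env)) (I env) ++ env); rewrite // size_cat sit hs.
split; first exact: eit.
split; [apply: ok_mono o1|apply: ok_mono o2|]; try by apply: pow_mono; rewrite /c !leq_max leqnn ?orbT.
move=> i hin; rewrite eit; set vs := iter _ _ _.
have [_ o3] := hF (vs ++ env) ltac:(by rewrite size_cat sit hs).
apply: ok_mono o3; apply: (@leq_trans ((mx env + 2) ^ (c1.+2 * cf))); last first.
  by apply: pow_mono; rewrite /c !leq_max leqnn ?orbT.
apply: pow_compose; rewrite mx_cat geq_max; apply/andP; split.
  by apply: leq_trans (b0 _ hs _ hin) _; apply: pow_mono; rewrite leq_maxl.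
apply: (@leq_trans ((mx env + 2) ^ 1)); first by rewrite expn1 leq_addr.
by apply: pow_mono; rewrite leq_maxr.
Qed.

Lemma LS_iter k n a (f : nat -> seq nat -> nat) : LS k n -> LS k a ->
  LS k.+1 (fun e => f (nth 0 e 0) (behead e)) ->
  (exists c, forall env, size env = k -> forall i, i < n env ->
     iter i (f^~ env) (a env) <= (mx env + 2) ^ c) ->
  LS k (fun env => iter (n env) (f^~ env) (a env)).
Proof.
move=> hn ha hf [c b].
have eq1 env i : iter i (fun vs => [:: f (nth 0 (vs ++ env) 0) (behead (vs ++ env))]) [:: a env]
                 = [:: iter i (f^~ env) (a env)].
  by elim: i => //= i ->.
have h : LSv k 1 (fun env => iter (n env)
    (fun vs => [:: f (nth 0 (vs ++ env) 0) (behead (vs ++ env))]) [:: a env]).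
  apply: (LSv_iter hn ha hf); exists c => env hs i hi.
  by rewrite eq1 /= maxn0; apply: b.
by apply: LSv_ext h => env _; rewrite eq1.
Qed.

Lemma LS_vars k n (m : nat) : LSv k n (fun e => [seq nth 0 e i | i <- iota m n]).
Proof. by elim: n m => [|n IH] m; [exact: LSv_nil|exact: LSv_cons (LS_var _ _) (IH _)]. Qed.

Lemma LS_behead k f : LS k f -> LS k.+1 (fun e => f (behead e)).
Proof.
move=> hf; apply: LS_ext (LS_comp hf (LS_vars k.+1 k 1)) => -[|x env] //= [hs].
congr f; apply: (@eq_from_nth _ 0); rewrite size_map size_iota // => i hi.
by rewrite (nth_map 0) ?size_iota // nth_iota.
Qed.

Definition LSf1 (F : nat -> nat) := forall k a, LS k a -> LS k (fun e => F (a e)).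
Definition LSf2 (F : nat -> nat -> nat) := forall k a b, LS k a -> LS k b ->
  LS k (fun e => F (a e) (b e)).
Definition LSf3 (F : nat -> nat -> nat -> nat) := forall k a b c, LS k a -> LS k b -> LS k c ->
  LS k (fun e => F (a e) (b e) (c e)).
Definition LSf4 (F : nat -> nat -> nat -> nat -> nat) := forall k a b c d,
  LS k a -> LS k b -> LS k c -> LS k d -> LS k (fun e => F (a e) (b e) (c e) (d e)).
Definition LSf6 (F : nat -> nat -> nat -> nat -> nat -> nat -> nat) := forall k a b c d g h,
  LS k a -> LS k b -> LS k c -> LS k d -> LS k g -> LS k h ->
  LS k (fun e => F (a e) (b e) (c e) (d e) (g e) (h e)).

Ltac vars_cons := repeat (first [apply: LSv_cons => //|exact: LSv_nil]).

Lemma LSf1I F : LS 1 (fun e => F (nth 0 e 0)) -> LSf1 F.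
Proof. by move=> h k a ha; apply: (LS_comp (G := fun e => [:: a e]) h); vars_cons. Qed.
Lemma LSf2I F : LS 2 (fun e => F (nth 0 e 0) (nth 0 e 1)) -> LSf2 F.
Proof. by move=> h k a b ha hb; apply: (LS_comp (G := fun e => [:: a e; b e]) h); vars_cons. Qed.
Lemma LSf3I F : LS 3 (fun e => F (nth 0 e 0) (nth 0 e 1) (nth 0 e 2)) -> LSf3 F.
Proof.
by move=> h k a b c *; apply: (LS_comp (G := fun e => [:: a e; b e; c e]) h); vars_cons.
Qed.
Lemma LSf4I F : LS 4 (fun e => F (nth 0 e 0) (nth 0 e 1) (nth 0 e 2) (nth 0 e 3)) -> LSf4 F.
Proof.
by move=> h k a b c d *; apply: (LS_comp (G := fun e => [:: a e; b e; c e; d e]) h); vars_cons.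
Qed.
Lemma LSf6I F : LS 6 (fun e => F (nth 0 e 0) (nth 0 e 1) (nth 0 e 2) (nth 0 e 3) (nth 0 e 4) (nth 0 e 5)) ->
  LSf6 F.
Proof.
by move=> h k a b c d g l *; apply: (LS_comp (G := fun e => [:: a e; b e; c e; d e; g e; l e]) h); vars_cons.
Qed.

(** * Arithmetic, bounded sums and tests in linear space *)

Lemma LS_const k n : LS k (fun=> n).
Proof. by elim: n => [|n IH]; [exact: LS_0|exact: LS_S IH]. Qed.

Lemma LS_add : LSf2 addn.
Proof.
apply: LSf2I.
apply: LS_ext (@LS_iter 2 (nth 0 ^~ 1) (nth 0 ^~ 0) (fun v _ => v.+1) (LS_var _ _) (LS_var _ _) (LS_S (LS_var _ _)) _).
  by move=> env _; rewrite iter_succn.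
exists 2 => env _ i hi; rewrite iter_succn.
have := mx_nth env 0; have := mx_nth env 1; rewrite !expnS; nia.
Qed.

(** With the successor as the only arithmetic primitive, the predecessor comes from iterating a
    shift on a pair, which ends as [n.-1] and [n]. *)
Lemma LS_pred : LSf1 predn.
Proof.
apply: LSf1I.
pose F (vs : seq nat) := [:: nth 0 vs 1; (nth 0 vs 1).+1].
have it n (env : seq nat) : iter n (fun vs => F (vs ++ env)) [:: 0; 0] = [:: n.-1; n].
  by elim: n => //= n ->.
have h : LSv 1 2 (fun env => iter (nth 0 env 0) (fun vs => F (vs ++ env)) [:: 0; 0]).
  apply: (@LSv_iter 1 2 (nth 0 ^~ 0) (fun=> [:: 0; 0]) F).
  - exact: LS_var.
  - by apply: LSv_cons (LS_0 _) (LS_const _ _).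
  - by apply: LSv_cons (LS_var _ _) _; apply: LS_S (LS_var _ _).
  exists 1 => env _ i hi; rewrite it expn1 /=; have := mx_nth env 0; lia.
by apply: LS_ext (LS_nth 0 h) => env _; rewrite it.
Qed.

Lemma LS_sub : LSf2 subn.
Proof.
apply: LSf2I.
have it a i : iter i predn a = a - i by elim: i => [|i IH] /=; rewrite ?IH; lia.
apply: LS_ext (@LS_iter 2 (nth 0 ^~ 1) (nth 0 ^~ 0) (fun v _ => v.-1) (LS_var _ _) (LS_var _ _) (LS_pred (LS_var _ _)) _).
  by move=> env _; rewrite it.
exists 1 => env _ i hi; rewrite it expn1.
have := mx_nth env 0; lia.
Qed.

Lemma LS_mul : LSf2 muln.
Proof.
apply: LSf2I.
have it a i : iter i (addn^~ a) 0 = a * i by elim: i => [|i IH] /=; rewrite ?IH; lia.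
apply: LS_ext (@LS_iter 2 (nth 0 ^~ 1) (fun=> 0) (fun v e => v + nth 0 e 0) (LS_var _ _) (LS_0 _) _ _).
- by move=> env _; rewrite it.
- by apply: LS_add (LS_var _ _) (LS_behead (LS_var _ _)).
exists 2 => env _ i hi; rewrite it.
have := mx_nth env 0; have := mx_nth env 1; rewrite !expnS expn0; nia.
Qed.

(** A loop on the pair of index and partial sum. Its length may be exponential in the bit size of
    the arguments; only the size of the values is paid for. *)
Lemma LS_sum k n (f : nat -> seq nat -> nat) : LS k n ->
  LS k.+1 (fun e => f (nth 0 e 0) (behead e)) ->
  LS k (fun env => \sum_(i < n env) f i env).
Proof.
move=> hn hf.
pose F (vs : seq nat) := [:: (nth 0 vs 0).+1; nth 0 vs 1 + f (nth 0 vs 0) (behead (behead vs))].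
have it env i : iter i (fun vs => F (vs ++ env)) [:: 0; 0] = [:: i; \sum_(j < i) f j env].
  by elim: i => [|i IH]; rewrite /= ?big_ord0 // IH /F /= big_ord_recr.
have h : LSv k 2 (fun env => iter (n env) (fun vs => F (vs ++ env)) [:: 0; 0]).
  apply: (@LSv_iter k 2 n (fun=> [:: 0; 0]) F) => //.
  - by apply: LSv_cons (LS_0 _) (LS_const _ _).
  - apply: LSv_cons; first by apply: LS_S (LS_var _ _).
    apply: LS_add; first exact: LS_var.
    pose G (e : seq nat) := nth 0 e 0 :: [seq nth 0 e i | i <- iota 2 k].
    have hG : LSv (2 + k) k.+1 G by apply: LSv_cons (LS_var _ _) (LS_vars _ _ _).
    apply: LS_ext (LS_comp hf hG) => -[|x [|y env]] //= [hs]; congr f.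
    apply: (@eq_from_nth _ 0); rewrite size_map size_iota // => i hi.
    by rewrite (nth_map 0) ?size_iota // nth_iota.
  have [cn bn] := LS_bound hn; have [cf bf] := LS_bound hf.
  pose c := maxn cn 1; exists (maxn cn (cn + c.+2 * cf)) => env hs i hi.
  rewrite it /= maxn0 geq_max; apply/andP; split.
    by apply: leq_trans (ltnW hi) _; apply: leq_trans (bn _ hs) _; apply: pow_mono; rewrite leq_maxl.
  apply: (@leq_trans (\sum_(j < i) (mx env + 2) ^ (c.+2 * cf))); last first.
    rewrite sum_nat_const card_ord; apply: leq_trans (pow_mono _ (leq_maxr _ _)).
    by rewrite expnD leq_mul2r (leq_trans (ltnW hi) (bn _ hs)) orbT.
  apply: leq_sum => j _; have := bf (val j :: env); rewrite /= hs => /(_ erefl) h.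
  apply: leq_trans h _; apply: pow_compose; rewrite geq_max; apply/andP; split.
    have : j < n env by apply: ltn_trans hi.
    move=> /ltnW h; apply: leq_trans h _; apply: leq_trans (bn _ hs) _.
    by apply: pow_mono; rewrite leq_maxl.
  apply: (@leq_trans ((mx env + 2) ^ 1)); first by rewrite expn1 leq_addr.
  by apply: pow_mono; rewrite leq_maxr.
by apply: LS_ext (LS_nth 1 h) => env _; rewrite it.
Qed.

Definition LSb k (p : seq nat -> bool) := LS k (fun e => nat_of_bool (p e)).

Lemma LS_leq k a b : LS k a -> LS k b -> LSb k (fun e => a e <= b e).
Proof.
move=> ha hb; apply: LS_ext (LS_sub (LS_const k 1) (LS_sub ha hb)) => e _; lia.
Qed.

Lemma LS_ltn k a b : LS k a -> LS k b -> LSb k (fun e => a e < b e).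
Proof. by move=> ha; apply: LS_leq (LS_S ha). Qed.

Lemma LS_and k p q : LSb k p -> LSb k q -> LSb k (fun e => p e && q e).
Proof. by move=> hp hq; apply: LS_ext (LS_mul hp hq) => e _; rewrite mulnb. Qed.

Lemma LS_not k p : LSb k p -> LSb k (fun e => ~~ p e).
Proof. by move=> hp; apply: LS_ext (LS_sub (LS_const k 1) hp) => e _; case: (p e). Qed.

Lemma LS_or k p q : LSb k p -> LSb k q -> LSb k (fun e => p e || q e).
Proof.
move=> hp hq; apply: LS_ext (LS_not (LS_and (LS_not hp) (LS_not hq))) => e _.
by rewrite -negb_or negbK.
Qed.

Lemma LS_eqn k a b : LS k a -> LS k b -> LSb k (fun e => a e == b e).
Proof.
move=> ha hb; apply: LS_ext (LS_and (LS_leq ha hb) (LS_leq hb ha)) => e _.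
by rewrite -eqn_leq.
Qed.

Lemma LS_if k p f g : LSb k p -> LS k f -> LS k g -> LS k (fun e => if p e then f e else g e).
Proof.
move=> hp hf hg; apply: LS_ext (LS_add (LS_mul hp hf) (LS_mul (LS_not hp) hg)) => e _.
by case: (p e); rewrite /= ?mul1n ?mul0n ?addn0 ?add0n.
Qed.

Lemma LS_all k n (p : nat -> seq nat -> bool) : LS k n ->
  LSb k.+1 (fun e => p (nth 0 e 0) (behead e)) ->
  LSb k (fun e => [forall i : 'I_(n e), p i e]).
Proof.
move=> hn hp; pose q i e := nat_of_bool (~~ p i e).
apply: LS_ext (LS_eqn (LS_sum (f := q) hn (LS_not hp)) (LS_const k 0)) => e _.
congr nat_of_bool; rewrite sum_nat_eq0; apply: eq_forallb => i.
by rewrite /q; case: (p i e).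
Qed.

Lemma sum_ltn a m : m <= a -> \sum_(i < a) nat_of_bool (i < m) = m.
Proof.
move=> h; transitivity (\sum_(i < a | i < m) 1); first by rewrite [RHS]big_mkcond.
by rewrite -(big_ord_widen _ (fun=> 1)) // sum1_card card_ord.
Qed.

(** The quotient counts the [i < a] with [i.+1 * b <= a]; the leading factor returns 0 for [b = 0],
    as [divn] does. *)
Lemma LS_div : LSf2 divn.
Proof.
apply: LSf2I.
pose f (i : nat) e := nat_of_bool (i.+1 * nth 0 e 1 <= nth 0 e 0).
have hf : LS 3 (fun e => f (nth 0 e 0) (behead e)).
  apply: LS_leq (LS_behead (LS_var _ _)).
  by apply: LS_mul (LS_S (LS_var _ _)) (LS_behead (LS_var _ _)).
apply: LS_ext (LS_mul (LS_ltn (LS_0 _) (LS_var 2 1)) (LS_sum (LS_var 2 0) hf)) => e _.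
rewrite /f; move: (nth 0 e 0) (nth 0 e 1) => a b /=.
case: b => [|b]; first by rewrite divn0 mul0n.
rewrite mul1n (eq_bigr (fun i : 'I_a => nat_of_bool (i < a %/ b.+1))); last first.
  by move=> i _; rewrite leq_divRL.
by rewrite sum_ltn // leq_div.
Qed.

Lemma LS_mod : LSf2 modn.
Proof.
apply: LSf2I.
have h := LS_sub (LS_var 2 0) (LS_mul (LS_div (LS_var 2 0) (LS_var 2 1)) (LS_var 2 1)).
by apply: LS_ext h => e _; rewrite {1}(divn_eq (nth 0 e 0) (nth 0 e 1)) addKn.
Qed.

Definition shr b x i := x %/ b ^ i.
Definition dig b x i := shr b x i %% b.

Lemma iter_div b x i : iter i (divn^~ b) x = shr b x i.
Proof.
by elim: i => [|i IH] /=; rewrite /shr ?divn1 // IH /shr expnSr divnMA.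
Qed.

Lemma LS_shr : LSf3 shr.
Proof.
apply: LSf3I.
apply: LS_ext (@LS_iter 3 (nth 0 ^~ 2) (nth 0 ^~ 1) (fun v e => v %/ nth 0 e 0) (LS_var _ _) (LS_var _ _) _ _).
- by move=> e _; rewrite iter_div.
- by apply: LS_div (LS_var _ _) (LS_behead (LS_var _ _)).
exists 1 => e _ i _; rewrite iter_div expn1; apply: leq_trans (leq_div _ _) _.
have := mx_nth e 1; lia.
Qed.

Lemma LS_dig : LSf3 dig.
Proof. by move=> k a b c ha hb hc; apply: LS_mod (LS_shr _ _ _) _. Qed.

Lemma LS_exp k a c : LS k a -> LS k (fun e => a e ^ c).
Proof.
move=> ha; elim: c => [|c IH]; first exact: LS_const.
by apply: LS_ext (LS_mul ha IH) => e _; rewrite expnS.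
Qed.

Lemma LS_min : LSf2 minn.
Proof. by move=> k a b ha hb; apply: LS_ext (LS_sub ha (LS_sub ha hb)) => e _; lia. Qed.

(** * Iterations truncated at a cap *)

Definition capv (C : nat) := map (minn C).

Lemma LSv_of k w F : (forall e, size e = k -> size (F e) = w) ->
  (forall i, i < w -> LS k (fun e => nth 0 (F e) i)) -> LSv k w F.
Proof.
move=> hs h; pose G m e := [seq nth 0 (F e) i | i <- iota m (w - m)].
suff hG m : m <= w -> LSv k (w - m) (G m).
  apply: (@LSv_ext _ _ (G 0)); last by have := hG 0 (leq0n _); rewrite subn0.
  move=> e he; apply: (@eq_from_nth _ 0); rewrite size_map size_iota subn0 ?hs // => i hi.
  by rewrite /G subn0 (nth_map 0) ?size_iota // nth_iota.
move=> hm; rewrite -(subKn hm); set d := w - m; move: (leq_subr m w).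
rewrite -/d; elim: d => [|d IH] hd; first by rewrite subn0 /G subnn; apply: LSv_nil.
apply: (@LSv_ext _ _ (fun e => nth 0 (F e) (w - d.+1) :: G (w - d) e)).
  move=> e _; rewrite /G !subKn ?(ltnW hd) //=; congr (_ :: map _ (iota _ _)); lia.
rewrite subKn //; apply: LSv_cons; first by apply: h; lia.
by have := IH (ltnW hd); rewrite subKn // ltnW.
Qed.

(** Cutting every iterate at [C e] supplies the bound that [LSv_iter] demands; that the cut leaves
    the intended values alone is proved where the lemma is used. *)
Lemma LSv_itercap k w n I F C : LS k n -> LS k C -> LSv k w I -> LSv (w + k) w F ->
  LSv k w (fun e => iter (n e) (fun vs => capv (C e) (F (vs ++ e))) (capv (C e) (I e))).
Proof.
move=> hn hC hI hF; have sI := LSv_size hI; have sF := LSv_size hF.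
pose C' (vs : seq nat) := C (drop w vs).
have hC' : LS (w + k) C'.
  apply: LS_ext (LS_comp hC (LS_vars (w + k) k w)) => e he; congr C.
  apply: (@eq_from_nth _ 0); rewrite size_map size_iota ?size_drop; first by lia.
  by move=> i hi; rewrite (nth_map 0) ?size_iota // nth_iota // nth_drop.
pose F' vs := capv (C' vs) (F vs).
have hF' : LSv (w + k) w F'.
  apply: LSv_of => [e he|i hi]; first by rewrite size_map sF.
  apply: LS_ext (LS_min hC' (LS_nth i hF)) => e he.
  by rewrite /F' /capv (nth_map 0) // sF.
pose I' e := capv (C e) (I e).
have hI' : LSv k w I'.
  apply: LSv_of => [e he|i hi]; first by rewrite size_map sI.
  apply: LS_ext (LS_min hC (LS_nth i hI)) => e he.
  by rewrite /I' /capv (nth_map 0) // sI.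
have it e i : size e = k -> size (iter i (fun vs => F' (vs ++ e)) (I' e)) = w /\
   iter i (fun vs => F' (vs ++ e)) (I' e) = iter i (fun vs => capv (C e) (F (vs ++ e))) (I' e).
  move=> he; elim: i => [|i [h1 h2]] /=; first by split=> //; rewrite size_map sI.
  split; first by rewrite size_map sF // size_cat h1 he.
  by rewrite -h2 /F' /C' drop_size_cat.
apply: (@LSv_ext _ _ (fun e => iter (n e) (fun vs => F' (vs ++ e)) (I' e))).
  by move=> e he; have [_ ->] := it e (n e) he.
apply: LSv_iter => //; have [c hc] := LS_bound hC; exists c => e he i _.
have [_ ->] := it e i he; apply: leq_trans (hc e he).
apply: mx_le => j; case: i => [|i] /=; rewrite size_map => hj; rewrite /capv (nth_map 0) //; exact: geq_minl.
Qed.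

Lemma LS_itercap k n a C (f : nat -> seq nat -> nat) : LS k n -> LS k C -> LS k a ->
  LS k.+1 (fun e => f (nth 0 e 0) (behead e)) ->
  LS k (fun e => iter (n e) (fun v => minn (C e) (f v e)) (minn (C e) (a e))).
Proof.
move=> hn hC ha hf; apply: LS_ext (LS_nth 0 (@LSv_itercap k 1 n _ _ C hn hC ha hf)) => e _.
set s := iter _ _ _; suff -> : s = [:: iter (n e) (fun v => minn (C e) (f v e)) (minn (C e) (a e))] by [].
by rewrite /s; elim: (n e) => //= i ->.
Qed.

Definition powcap C b i := minn C (b ^ i).

(** A power is not polynomial in its arguments, hence the cap. The base is a successor because a
    positive base keeps the product above [C] once it has got there. *)
Lemma LS_powcap : LSf3 (fun C b i => powcap C b.+1 i).
Proof.
apply: LSf3I.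
have h := @LS_itercap 3 (nth 0 ^~ 2) (fun=> 1) (nth 0 ^~ 0) (fun v e => v * (nth 0 e 1).+1)
  (LS_var _ _) (LS_var _ _) (LS_const _ _) (LS_mul (LS_var _ _) (LS_S (LS_behead (LS_var _ _)))).
apply: LS_ext h => e _; elim: (nth 0 e 2) => [|i IH] //=.
rewrite IH /powcap expnSr; set X := _ ^ i; set C := nth 0 e 0; set b := nth 0 e 1.
case: (leqP C X) => hC //.
by rewrite !(minn_idPl _) // ?leq_pmulr //; apply: leq_trans hC _; rewrite leq_pmulr.
Qed.

(** The number of nonzero right shifts, a form to which [LS_sum] applies; the range [x] is wide
    enough because [x < 2 ^ x]. *)
Definition bitlen x := \sum_(i < x) nat_of_bool (0 < shr 2 x i).

Lemma LS_bitlen : LSf1 bitlen.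
Proof.
apply: LSf1I.
apply: (@LS_sum 1 (nth 0 ^~ 0) (fun i e => nat_of_bool (0 < shr 2 (nth 0 e 0) i)) (LS_var _ _)).
by apply: LS_ltn (LS_0 _) (LS_shr (LS_const _ 2) (LS_behead (LS_var _ _)) (LS_var _ _)).
Qed.

Lemma bitlen_bounds x n : x < 2 ^ n -> 2 ^ n <= x.*2 + 1 -> bitlen x = n.
Proof.
move=> h1 h2; rewrite /bitlen.
have hn : n <= x.
  have := ltn_expl n (ltnSn 1); case: n h1 h2 => // n; rewrite expnS => *.
  have := ltn_expl n (ltnSn 1); lia.
rewrite (eq_bigr (fun i : 'I_x => nat_of_bool (i < n))); last first.
  move=> i _; congr nat_of_bool; rewrite /shr divn_gt0 ?expn_gt0 //.
  apply/idP/idP => [h|h]; first by rewrite -(ltn_exp2l _ _ (ltnSn 1)); apply: leq_ltn_trans h1.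
  have : 2 ^ i.+1 <= 2 ^ n by rewrite leq_exp2l.
  by rewrite expnS; lia.
exact: sum_ltn.
Qed.

(** A finite table built into the expression, so [f] may be any function at all: this is how
    transition functions and data depending on complex gate entries enter a machine. *)
Definition tab (f : nat -> nat) N x := if x < N then f x else 0.

Lemma LS_tab f N : LSf1 (tab f N).
Proof.
apply: LSf1I; elim: N => [|N IH]; first exact: LS_0.
apply: LS_ext (LS_if (LS_eqn (LS_var 1 0) (LS_const 1 N)) (LS_const 1 (f N)) IH) => e _.
rewrite /tab; case: eqP => [->|h]; first by rewrite leqnn.
by have -> : (nth 0 e 0 < N.+1) = (nth 0 e 0 < N) by lia.
Qed.

(** * Entries of powers of succinct matrices *)

Lemma LS_drop m k f : LS k f -> LS (m + k) (fun e => f (drop m e)).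
Proof.
move=> hf; apply: LS_ext (LS_comp hf (LS_vars (m + k) k m)) => e he; congr f.
apply: (@eq_from_nth _ 0); rewrite size_map size_iota ?size_drop ?he; first by lia.
by move=> i hi; rewrite (nth_map 0) ?size_iota // nth_iota // nth_drop.
Qed.

(** Entry [(s, t)] of the power [2 ^ d] of the matrix [w] modulo [q], by repeated squaring: the
    recursion has depth [d] although the walks counted have length [2 ^ d]. *)
Fixpoint sqpow (w : nat -> nat -> nat) (q Z d : nat) (s t : nat) : nat :=
  if d is d'.+1 then (\sum_(z < Z) sqpow w q Z d' s z * sqpow w q Z d' z t) %% q
  else w s t %% q.

Section Dfs.
Variables (w : nat -> nat -> nat) (q Z l C : nat).
Notation b := (Z + q + 2).

(** A stack is a number in base [b], which exceeds all that is pushed: vertices, residues modulo [q]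
    and flags. Adding 1 to a stack, as [dfs] does to [z] and [p], therefore changes only its top. *)
Definition push x X := x + b * X.
Definition top X := X %% b.
Definition pop X := X %/ b.

Lemma top_push x X : x < b -> top (push x X) = x.
Proof. by move=> h; rewrite /top /push addnC mulnC modnMDl modn_small. Qed.

Lemma pop_push x X : x < b -> pop (push x X) = X.
Proof. by move=> h; rewrite /pop /push addnC mulnC divnMDl ?divn_small ?addn0 //; lia. Qed.

Lemma push_lt x X h : x < b -> X < b ^ h -> push x X < b ^ h.+1.
Proof. by move=> hx hX; rewrite expnS /push; nia. Qed.

(* A depth-first evaluation of [sqpow]. A state is the list: mode (0 = call,
   1 = return), depth, returned value, then six stacks holding, for every
   suspended call, its arguments s and t, the summation index z, the partial
   sum, the first factor, and which factor is being computed. *)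
Definition dfs (S : seq nat) : seq nat :=
  let: m := nth 0 S 0 in let: d := nth 0 S 1 in let: v := nth 0 S 2 in
  let: s := nth 0 S 3 in let: t := nth 0 S 4 in let: z := nth 0 S 5 in
  let: a := nth 0 S 6 in let: f := nth 0 S 7 in let: p := nth 0 S 8 in
  let: a' := (top a + top f * v) %% q in
  let: more := (top z).+1 < Z in
  if m == 0 then
    if d == 0 then [:: 1; d; w (top s) (top t) %% q; pop s; pop t; z; a; f; p]
    else [:: 0; d.-1; v; push (top s) s; push 0 t; push 0 z; push 0 a; push 0 f; push 0 p]
  else if d == l then S
  else if top p == 0 then
    [:: 0; d; v; push (top z) s; push (top t) t; z; a; push v (pop f); p.+1]
  else if more then
    [:: 0; d; v; push (top s) s; push (top z).+1 t; z.+1; push a' (pop a); f; p.-1]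
  else [:: 1; d.+1; a'; pop s; pop t; pop z; pop a; pop f; pop p].

Definition steps n S S' := exists2 m, m <= n & iter m (capv C \o dfs) S = S'.

Lemma steps_trans n m S2 S1 S3 : steps n S1 S2 -> steps m S2 S3 -> steps (n + m) S1 S3.
Proof.
move=> [i hi h1] [j hj h2]; exists (j + i); first lia.
by rewrite iterD h1.
Qed.

Lemma steps1 S S' : dfs S = S' -> all (fun x => x <= C) S' -> steps 1 S S'.
Proof.
move=> h hC; exists 1; rewrite //= h /capv -[RHS]map_id; apply/eq_in_map => x.
by move/(allP hC) => hx; apply/minn_idPr.
Qed.

Lemma sqpow_lt d s t : 0 < q -> sqpow w q Z d s t < q.
Proof. by case: d => [|d] hq /=; rewrite ltn_pmod. Qed.

(** A call returns its value and leaves the stacks below its arguments as they were; [h] bounds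
    their height, and the cap leaves room for height [h + d + 1]. A call at depth [d.+1] makes
    [2 * Z] calls at depth [d] and [2 * Z + 1] further steps, whence the factor [4 * Z + 1]. *)
Lemma dfs_eval d h s t v0 Ss Ts Zs As Fs Ps : 0 < q -> 0 < Z ->
  d <= l -> s < Z -> t < Z -> v0 < b ->
  b ^ (h + d).+1 <= C -> l <= C ->
  Ss < b ^ h -> Ts < b ^ h -> Zs < b ^ h -> As < b ^ h -> Fs < b ^ h -> Ps < b ^ h ->
  steps ((4 * Z + 1) ^ d) [:: 0; d; v0; push s Ss; push t Ts; Zs; As; Fs; Ps]
    [:: 1; d; sqpow w q Z d s t; Ss; Ts; Zs; As; Fs; Ps].
Proof.
move=> hq hZ; elim: d h s t v0 Ss Ts Zs As Fs Ps => [|d IH] h s t v0 Ss Ts Zs As Fs Ps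
  hd hs ht hv hC hlC h1 h2 h3 h4 h5 h6.
  have hb : b ^ h <= C by apply: leq_trans hC; rewrite addn0 leq_exp2l //; lia.
  have hqC : q <= C by apply: leq_trans hC; rewrite addn0 expnS; have := expn_gt0 b h; nia.
  apply: steps1; first by rewrite /dfs /= !top_push ?pop_push //; lia.
  have := sqpow_lt 0 s t hq; rewrite /=; lia.
have hb : b ^ h.+1 <= C by apply: leq_trans hC; rewrite leq_exp2l //; lia.
have hb2 : b ^ h.+2 <= C by apply: leq_trans hC; rewrite leq_exp2l //; lia.
have hbC : b <= C by apply: leq_trans hb; rewrite expnS; have := expn_gt0 b h; nia.
have hbb : b ^ h <= C by apply: leq_trans hb; rewrite leq_exp2l //; lia.
have bZ : Z < b by lia.
have bq : q < b by lia.
have le_pushC x X : x < b -> X < b ^ h -> push x X <= C.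
  by move=> hx hX; apply: ltnW; apply: leq_trans (push_lt hx hX) hb.
have le_push2C x y X : x < b -> y < b -> X < b ^ h -> push x (push y X) <= C.
  by move=> hx hy hX; apply: ltnW; apply: leq_trans (push_lt hx (push_lt hy hX)) hb2.
have b0 : 0 < b by lia.
have b1 : 1 < b by lia.
pose T := (4 * Z + 1) ^ d.
have T1 : 0 < T by rewrite expn_gt0 addn1.
have dC : d <= C by lia.
have hrec x y v f a z p : x < Z -> y < Z -> v < b -> f < b -> a < b -> z < b -> p < b ->
  steps T [:: 0; d; v; push x (push s Ss); push y (push t Ts); push z Zs; push a As; push f Fs; push p Ps]
   [:: 1; d; sqpow w q Z d x y; push s Ss; push t Ts; push z Zs; push a As; push f Fs; push p Ps].
  move=> *; apply: (IH h.+1) => //; try (apply: push_lt => //; lia); [lia|].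
  by rewrite addSnnS.
have pair z a f v : z < Z -> a < q -> f < b -> v < b ->
   steps (T + 1 + T)
     [:: 0; d; v; push s (push s Ss); push z (push t Ts); push z Zs; push a As; push f Fs; push 0 Ps]
     [:: 1; d; sqpow w q Z d z t; push s Ss; push t Ts; push z Zs; push a As;
         push (sqpow w q Z d s z) Fs; push 1 Ps].
  move=> hz ha hf hvb; have e1 := sqpow_lt d s z hq.
  apply: (@steps_trans _ _ [:: 0; d; sqpow w q Z d s z; push z (push s Ss); push t (push t Ts);
    push z Zs; push a As; push (sqpow w q Z d s z) Fs; push 1 Ps]); last by apply: hrec; lia.
  apply: steps_trans; first by apply: hrec; lia.
  apply: steps1; first by rewrite /dfs /= (ltn_eqF hd) !top_push ?pop_push ?eqxx //; lia.
  by rewrite /= dC ?le_push2C ?le_pushC //; lia.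
(* [n] is the number of summation indices after [z], and [a] the partial sum over those before
   it. *)
have loop n z a f v : n = Z - z.+1 -> z < Z -> a < q -> f < b -> v < b ->
   steps (n.+1 * (T + 1 + T + 1))
     [:: 0; d; v; push s (push s Ss); push z (push t Ts); push z Zs; push a As; push f Fs; push 0 Ps]
     [:: 1; d.+1; (a + \sum_(z <= i < Z) sqpow w q Z d s i * sqpow w q Z d i t) %% q;
         Ss; Ts; Zs; As; Fs; Ps].
  elim: n z a f v => [|n IHn] z a f v hn hz ha hf hvb.
    have e1 := sqpow_lt d s z hq; have e2 := sqpow_lt d z t hq.
    rewrite mul1n; apply: steps_trans; first exact: pair.
    rewrite big_ltn // big_geq ?addn0; last by lia.
    apply: steps1.
      rewrite /dfs /= (ltn_eqF hd) !top_push ?pop_push //=; try lia.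
      by have -> : z.+1 < Z = false by lia.
    rewrite /=; have := ltn_pmod (a + sqpow w q Z d s z * sqpow w q Z d z t) hq.
    by set A := _ %% q => hA; lia.
  rewrite mulSn; have hz1 : z.+1 < Z by lia.
  have e1 := sqpow_lt d s z hq; have e2 := sqpow_lt d z t hq.
  set A := (a + sqpow w q Z d s z * sqpow w q Z d z t) %% q.
  have hA : A < q by rewrite /A ltn_pmod.
  have := IHn z.+1 A (sqpow w q Z d s z) (sqpow w q Z d z t).
  move=> /(_ ltac:(lia) hz1 hA ltac:(lia) ltac:(lia)) r.
  rewrite big_ltn // addnA -modnDml -/A; apply: steps_trans r.
  apply: steps_trans; first exact: pair.
  apply: steps1; first by rewrite /dfs /= (ltn_eqF hd) !top_push ?pop_push //= ?hz1 //; lia.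
  by rewrite /= dC ?le_push2C ?le_pushC //; lia.
have hT : 1 + Z * (T + 1 + T + 1) <= (4 * Z + 1) ^ d.+1 by rewrite expnS -/T; nia.
have [i hi <-] : steps (1 + Z * (T + 1 + T + 1)) [:: 0; d.+1; v0; push s Ss; push t Ts; Zs; As; Fs; Ps]
    [:: 1; d.+1; sqpow w q Z d.+1 s t; Ss; Ts; Zs; As; Fs; Ps]; last by exists i => //; apply: leq_trans hT.
have := loop Z.-1 0 0 0 v0 ltac:(lia) hZ hq b0 hv; rewrite prednK // add0n big_mkord.
apply: steps_trans; apply: steps1; first by rewrite /dfs /= !top_push //; lia.
by rewrite /= dC ?le_push2C ?le_pushC //; lia.
Qed.

(** The state returned at depth [l] is a fixed point, so running too long is harmless; [C ^ 3] steps
    are enough because [4 * Z + 1 <= b ^ 3]. *)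
Lemma dfs_run s t : 0 < q -> 0 < Z -> s < Z -> t < Z -> b ^ l.+1 <= C ->
  nth 0 (iter (C ^ 3) (capv C \o dfs)
              (capv C [:: 0; l; 0; push s 0; push t 0; 0; 0; 0; 0])) 2 = sqpow w q Z l s t.
Proof.
move=> hq hZ hs ht hC.
have b1 : 1 < b by lia.
have lC : l <= C.
  apply: leq_trans hC; apply: leq_trans (ltnW (ltn_expl l b1)) _.
  by rewrite leq_exp2l.
have bC : b <= C by apply: leq_trans hC; rewrite -[X in X <= _]expn1 leq_exp2l.
have [i hi hit] := @dfs_eval l 0 s t 0 0 0 0 0 0 0 hq hZ (leqnn _) hs ht ltac:(lia) hC lC isT isT isT isT isT isT.
have hsq := sqpow_lt l s t hq; set S := [:: 1; _; _; _; _; _; _; _; _] in hit.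
have fixS j : iter j (capv C \o dfs) S = S.
  elim: j => //= j ->; rewrite /dfs /= eqxx.
  rewrite /capv -[RHS]map_id; apply/eq_in_map => x hx; apply/minn_idPr; move: hx.
  by rewrite !inE; lia.
have hn : i <= C ^ 3.
  apply: leq_trans hi _; apply: (@leq_trans ((b ^ l.+1) ^ 3)); last by rewrite leq_exp2r.
  rewrite -expnM (mulnC l.+1) expnM; apply: (@leq_trans ((b ^ 3) ^ l)).
    case: l => // l'; rewrite leq_exp2r // !expnS expn0; nia.
  by rewrite leq_exp2l // -[1](exp1n 3) ltn_exp2r.
have -> : capv C [:: 0; l; 0; push s 0; push t 0; 0; 0; 0; 0] =
          [:: 0; l; 0; push s 0; push t 0; 0; 0; 0; 0].
  rewrite /capv -[RHS]map_id; apply/eq_in_map => x hx; apply/minn_idPr; move: hx.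
  by rewrite /push !inE; lia.
by rewrite -(subnK hn) iterD hit fixS.
Qed.
End Dfs.

Lemma LSv_if k w p F G : LSb k p -> LSv k w F -> LSv k w G ->
  LSv k w (fun e => if p e then F e else G e).
Proof.
move=> hp hF hG; have sF := LSv_size hF; have sG := LSv_size hG.
apply: LSv_of => [e he|i hi]; first by case: (p e); [exact: sF|exact: sG].
by apply: LS_ext (LS_if hp (LS_nth i hF) (LS_nth i hG)) => e _; case: (p e).
Qed.

Lemma LS_push k b x X : LS k b -> LS k x -> LS k X -> LS k (fun e => x e + b e * X e).
Proof. by move=> hb hx hX; apply: LS_add hx (LS_mul hb hX). Qed.

Theorem LS_sqpow k (w : nat -> nat -> seq nat -> nat) (q Z l C s t : seq nat -> nat) :
  LS k.+2 (fun e => w (nth 0 e 0) (nth 0 e 1) (behead (behead e))) ->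
  LS k q -> LS k Z -> LS k l -> LS k C -> LS k s -> LS k t ->
  exists2 R, LS k R & forall e, size e = k -> 0 < q e -> 0 < Z e -> s e < Z e -> t e < Z e ->
    (Z e + q e + 2) ^ (l e).+1 <= C e ->
    R e = sqpow (fun x y => w x y e) (q e) (Z e) (l e) (s e) (t e).
Proof.
move=> hw hq hZ hl hC hs ht.
pose F (vs : seq nat) := let e := drop 9 vs in dfs (fun x y => w x y e) (q e) (Z e) (l e) (take 9 vs).
pose I (e : seq nat) := [:: 0; l e; 0; push (q e) (Z e) (s e) 0; push (q e) (Z e) (t e) 0; 0; 0; 0; 0].
have hI : LSv k 9 I.
  have hb := LS_add (LS_add hZ hq) (LS_const k 2); have h0 := LS_const k 0.
  by do 9 (apply: LSv_cons; first by [exact: LS_const|exact: hl|apply: LS_push]); exact: LSv_nil.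
have hF : LSv (9 + k) 9 F.
  have hq9 := LS_drop 9 hq; have hZ9 := LS_drop 9 hZ; have hl9 := LS_drop 9 hl.
  have hb := LS_add (LS_add hZ9 hq9) (LS_const (9 + k) 2).
  have v i : LS (9 + k) (fun e => nth 0 e i) := LS_var (9 + k) i.
  have htop i := LS_mod (v i) hb; have hpop i := LS_div (v i) hb.
  have hpush x X (hx : LS (9 + k) x) (hX : LS (9 + k) X) := LS_push hb hx hX.
  have h0 := LS_const (9 + k) 0; have h1 := LS_const (9 + k) 1.
  have hww : LS (9 + k) (fun e => w (nth 0 e 3 %% (Z (drop 9 e) + q (drop 9 e) + 2))
     (nth 0 e 4 %% (Z (drop 9 e) + q (drop 9 e) + 2)) (drop 9 e) %% q (drop 9 e)).
    apply: LS_mod => //.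
    apply: LS_ext (LS_comp hw (LSv_cons (htop 3) (LSv_cons (htop 4) (LS_vars (9 + k) k 9)))) => e he /=.
    congr (w _ _ _); apply: (@eq_from_nth _ 0); rewrite size_map size_iota ?size_drop ?he; first by lia.
    by move=> i hi; rewrite (nth_map 0) ?size_iota // nth_iota // nth_drop.
  have ha' := LS_mod (LS_add (htop 6) (LS_mul (htop 7) (v 2))) hq9.
  have c1 := LS_eqn (v 0) h0; have c2 := LS_eqn (v 1) h0; have c3 := LS_eqn (v 1) hl9.
  have c4 := LS_eqn (htop 8) h0; have c5 := LS_ltn (LS_S (htop 5)) hZ9.
  have d1 := LSv_cons h1 (LSv_cons (v 1) (LSv_cons hww (LSv_cons (hpop 3) (LSv_cons (hpop 4)
    (LSv_cons (v 5) (LSv_cons (v 6) (LSv_cons (v 7) (LSv_cons (v 8) (LSv_nil _))))))))).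
  have d2 := LSv_cons h0 (LSv_cons (LS_pred (v 1)) (LSv_cons (v 2) (LSv_cons (hpush _ _ (htop 3) (v 3))
    (LSv_cons (hpush _ _ h0 (v 4)) (LSv_cons (hpush _ _ h0 (v 5)) (LSv_cons (hpush _ _ h0 (v 6))
    (LSv_cons (hpush _ _ h0 (v 7)) (LSv_cons (hpush _ _ h0 (v 8)) (LSv_nil _))))))))).
  have d3 := LSv_cons h0 (LSv_cons (v 1) (LSv_cons (v 2) (LSv_cons (hpush _ _ (htop 5) (v 3))
    (LSv_cons (hpush _ _ (htop 4) (v 4)) (LSv_cons (v 5) (LSv_cons (v 6)
    (LSv_cons (hpush _ _ (v 2) (hpop 7)) (LSv_cons (LS_S (v 8)) (LSv_nil _))))))))).
  have d4 := LSv_cons h0 (LSv_cons (v 1) (LSv_cons (v 2) (LSv_cons (hpush _ _ (htop 3) (v 3))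
    (LSv_cons (hpush _ _ (LS_S (htop 5)) (v 4)) (LSv_cons (LS_S (v 5)) (LSv_cons (hpush _ _ ha' (hpop 6))
    (LSv_cons (v 7) (LSv_cons (LS_pred (v 8)) (LSv_nil _))))))))).
  have d5 := LSv_cons h1 (LSv_cons (LS_S (v 1)) (LSv_cons ha' (LSv_cons (hpop 3) (LSv_cons (hpop 4)
    (LSv_cons (hpop 5) (LSv_cons (hpop 6) (LSv_cons (hpop 7) (LSv_cons (hpop 8) (LSv_nil _))))))))).
  apply: LSv_ext (LSv_if c1 (LSv_if c2 d1 d2) (LSv_if c3 (LS_vars (9 + k) 9 0) (LSv_if c4 d3 (LSv_if c5 d4 d5)))).
  by move=> [|x0 [|x1 [|x2 [|x3 [|x4 [|x5 [|x6 [|x7 [|x8 e]]]]]]]]] // he; rewrite /F /dfs /= drop0 take0.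
exists (fun e => nth 0 (iter (C e ^ 3) (fun vs => capv (C e) (F (vs ++ e))) (capv (C e) (I e))) 2).
  exact: (LS_nth 2 (LSv_itercap (LS_exp 3 hC) hC hI hF)).
move=> e he hq0 hZ0 hs0 ht0 hC0; rewrite -(@dfs_run _ (q e) (Z e) (l e) (C e)) //; congr nth.
set S0 := capv _ _; have : size S0 = 9 by [].
elim: (C e ^ 3) S0 => // n IH S0 hS; rewrite !iterSr /= /F take_size_cat // drop_size_cat //.
by apply: IH; rewrite size_map /dfs; do 5 (case: ifP => // _).
Qed.

(** * Simulation of Turing machines *)

Lemma sum_digits_lt b n (d : nat -> nat) : (forall i, i < n -> d i < b) ->
  \sum_(i < n) d i * b ^ i < b ^ n.
Proof.
elim: n => [|n IH] hd; first by rewrite big_ord0.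
rewrite big_ord_recr /= expnS; have := IH (fun i hi => hd i (ltnW hi)).
have := hd n (ltnSn n); set X := \sum_(i < n) _; move: (d n) (b ^ n) X => z p X; nia.
Qed.

Lemma sum_digits_shr b n m (d : nat -> nat) : (forall i, i < n + m -> d i < b) ->
  shr b (\sum_(i < n + m) d i * b ^ i) n = \sum_(i < m) d (n + i) * b ^ i.
Proof.
move=> hd; rewrite /shr big_split_ord /=.
have hb : \sum_(i < n) d i * b ^ i < b ^ n.
  by apply: sum_digits_lt => i hi; apply: hd; lia.
have b0 : 0 < b ^ n by apply: leq_trans hb.
have -> : \sum_(i < m) d (n + i) * b ^ (n + i) = (\sum_(i < m) d (n + i) * b ^ i) * b ^ n.
  by rewrite big_distrl /=; apply: eq_bigr => i _; rewrite expnD; lia.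
by rewrite addnC divnMDl // divn_small // addn0.
Qed.

Lemma dig_sum b n (d : nat -> nat) i : (forall j, j < n -> d j < b) -> i < n ->
  dig b (\sum_(j < n) d j * b ^ j) i = d i.
Proof.
move=> hd hi; have en : n = i + (n - i) by lia.
rewrite /dig en sum_digits_shr; last by rewrite -en.
case: (n - i) en => [|m] en; first by lia.
rewrite big_ord_recl addn0 expn0 muln1.
have -> : \sum_(j < m) d (i + bump 0 j) * b ^ bump 0 j = (\sum_(j < m) d (i + bump 0 j) * b ^ j) * b.
  by rewrite big_distrl /=; apply: eq_bigr => j _; rewrite /bump /= add1n expnS; lia.
by rewrite addnC modnMDl modn_small // hd.
Qed.

Section Simulation.
Variable (M : TM).

(** The blank comes first and so has code 0: blank stretches of tape contribute nothing to the tape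
    number. *)
Definition syms : seq (tm_sym M) := None :: map Some (enum {: bool + tm_work M}).
Definition sc (s : tm_sym M) := index s syms.
Definition qc (q : tm_state M) := index q (enum (tm_state M)).
Notation b := (size syms).

Lemma mem_syms s : s \in syms.
Proof.
by case: s => [s|]; rewrite inE //= mem_map ?mem_enum // => x y [].
Qed.

Lemma sc_lt s : sc s < b. Proof. by rewrite index_mem mem_syms. Qed.
Lemma nth_sc s : nth None syms (sc s) = s. Proof. by rewrite nth_index ?mem_syms. Qed.
Lemma sc_inj : injective sc.
Proof. by move=> s s' h; rewrite -(nth_sc s) h nth_sc. Qed.

(** A halting configuration stays put, so that a number of steps fixed in advance can be run. *)
Definition trans (q : tm_state M) (s : tm_sym M) : tm_state M * tm_sym M * move :=
  if tm_trans q s is Some r then r else (q, s, Stay).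

Definition tq (key : nat) :=
  qc (trans (nth (tm_start M) (enum (tm_state M)) (key %/ b)) (nth None syms (key %% b))).1.1.
Definition ts (key : nat) :=
  sc (trans (nth (tm_start M) (enum (tm_state M)) (key %/ b)) (nth None syms (key %% b))).1.2.
Definition tl (key : nat) : nat :=
  if (trans (nth (tm_start M) (enum (tm_state M)) (key %/ b)) (nth None syms (key %% b))).2 is MoveL
  then 1 else 0.
Definition tr (key : nat) : nat :=
  if (trans (nth (tm_start M) (enum (tm_state M)) (key %/ b)) (nth None syms (key %% b))).2 is MoveR
  then 1 else 0.

Notation NK := (#|tm_state M| * b).

Lemma qc_lt q : qc q < #|tm_state M|. Proof. by rewrite cardE index_mem mem_enum. Qed.

Lemma key_lt q s : qc q * b + sc s < NK.
Proof. by have := qc_lt q; have := sc_lt s; nia. Qed.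

Lemma key_q q s : nth (tm_start M) (enum (tm_state M)) ((qc q * b + sc s) %/ b) = q.
Proof.
by rewrite divnMDl ?(leq_ltn_trans _ (sc_lt s)) // divn_small ?sc_lt // addn0 nth_index ?mem_enum.
Qed.
Lemma key_s q s : nth None syms ((qc q * b + sc s) %% b) = s.
Proof. by rewrite modnMDl modn_small ?sc_lt // nth_sc. Qed.

(** The vector is state, tape number and head, followed by the two input registers and the budget.
    The budget, at index 5, makes the weight [b ^ h] of the scanned digit available as a capped
    power. *)
Definition simF (v : seq nat) : seq nat :=
  let: q := nth 0 v 0 in let: X := nth 0 v 1 in let: h := nth 0 v 2 in let: Sb := nth 0 v 5 in
  let: s := dig b X h in let: key := q * b + s in let: p := powcap Sb b h in
  [:: tab tq NK key; (X - s * p) + tab ts NK key * p; h + tab tr NK key - tab tl NK key].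

Lemma LS_simF : LSv 6 3 simF.
Proof.
have v i : LS 6 (fun e => nth 0 e i) := LS_var 6 i.
have hs := LS_dig (LS_const 6 b) (v 1) (v 2).
have hkey := LS_add (LS_mul (v 0) (LS_const 6 b)) hs.
have hp : LS 6 (fun e => powcap (nth 0 e 5) b (nth 0 e 2)).
  exact: (LS_powcap (v 5) (LS_const 6 (size (map Some (enum {: bool + tm_work M})))) (v 2)).
apply: LSv_cons; first exact: LS_tab.
apply: LSv_cons.
  by apply: LS_add (LS_sub (v 1) (LS_mul hs hp)) (LS_mul (LS_tab _ _ hkey) hp).
apply: LSv_cons; last exact: LSv_nil.
by apply: LS_sub (LS_add (v 2) (LS_tab _ _ hkey)) (LS_tab _ _ hkey).
Qed.

Variables (O W : nat).

(* Cell j of the tape is digit j + O in base b. *)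
Definition tnum (tape : int -> tm_sym M) :=
  \sum_(i < W) sc (tape (i%:Z - O%:Z)%R) * b ^ i.

Definition simrep (c : config M) : seq nat :=
  [:: qc (cf_state c); tnum (cf_tape c); absz (cf_head c + O%:Z)%R].

Lemma tnum_lt tape : tnum tape < b ^ W.
Proof. by apply: (@sum_digits_lt b W (fun i => sc (tape (i%:Z - O%:Z)%R))) => i _; apply: sc_lt. Qed.

Lemma tnum_upd tape (h : nat) s : h < W ->
  tnum (fun j => if j == (h%:Z - O%:Z)%R then s else tape j) + sc (tape (h%:Z - O%:Z)%R) * b ^ h
  = tnum tape + sc s * b ^ h.
Proof.
move=> hW; rewrite /tnum (bigD1 (Ordinal hW)) //= eqxx [in RHS](bigD1 (Ordinal hW)) //=.
rewrite (eq_bigr (fun i : 'I_W => sc (tape (i%:Z - O%:Z)%R) * b ^ i)).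
  by rewrite [X in X + _ = _]addnC addnAC [X in X + _ = _]addnC.
move=> i hi; case: eqP => // h2; case/eqP: hi; apply: val_inj => /=; lia.
Qed.

Lemma step_trans (c : config M) :
  tm_step c = let: r := trans (cf_state c) (cf_tape c (cf_head c)) in
    Config r.1.1 (match r.2 with MoveL => cf_head c - 1 | MoveR => cf_head c + 1
                  | Stay => cf_head c end)%R
      (fun j => if j == cf_head c then r.1.2 else cf_tape c j).
Proof.
rewrite /tm_step /trans; case: (tm_trans _ _) => [[[q s] mv]|] //=.
case: c => q h tp /=; congr Config; apply: functional_extensionality => j.
by case: eqP => [->|].
Qed.

(** The strict lower bound leaves room for a move to the left, and [b ^ W <= S] makes the capped
    power exact. *)
Lemma sim_step (c : config M) r0 r1 S : (0 < cf_head c + O%:Z)%R -> (cf_head c + O%:Z < W%:Z)%R ->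
  b ^ W <= S -> simF (simrep c ++ [:: r0; r1; S]) = simrep (tm_step c).
Proof.
move=> h1 h2 hS; set h := absz (cf_head c + O%:Z)%R.
have eh : cf_head c = (h%:Z - O%:Z)%R by rewrite /h; lia.
have hW : h < W by rewrite /h; lia.
have h0 : 0 < h by rewrite /h; lia.
have b1 : 1 < b by rewrite /syms /= size_map -cardE card_sum card_bool; lia.
have hp : powcap S b h = b ^ h.
  by apply/minn_idPr; apply: leq_trans hS; rewrite leq_exp2l // ltnW.
set s := cf_tape c (cf_head c).
have hd : dig b (tnum (cf_tape c)) h = sc s.
  rewrite /tnum (@dig_sum b W (fun i => sc (cf_tape c (i%:Z - O%:Z)%R))) // -?eh //.
  by move=> j _; apply: sc_lt.
rewrite step_trans /simrep /simF /= -/h hd hp -/s /tab key_lt /tq /ts /tl /tr key_q key_s.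
have hu := @tnum_upd (cf_tape c) h (trans (cf_state c) s).1.2 hW.
rewrite -eh -/s in hu.
have hge : sc s * b ^ h <= tnum (cf_tape c).
  by rewrite /tnum (bigD1 (Ordinal hW)) //= -eh -/s leq_addr.
congr [:: _; _; _]; first lia.
by rewrite eh; case: (trans _ _).2 => /=; lia.
Qed.

End Simulation.

(** Register 0 alone would lose the zeros at the end of the input, which are its most significant
    bits; register 1 is there to recover the length. *)
Lemma bitlen_input x : bitlen (inregs x 1) = size x.
Proof. by rewrite /inregs /=; apply: bitlen_bounds; have := expn_gt0 2 (size x); lia. Qed.

Lemma dig_input x i : dig 2 (inregs x 0) i = nth false x i.
Proof.
rewrite /inregs /=; elim: x i => [|c x IH] i /=; first by rewrite /dig /shr div0n mod0n nth_nil.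
case: i => [|i] /=; first by rewrite /dig /shr expn0 divn1 -muln2 addnC modnMDl modn_small; case: c.
rewrite -IH /dig /shr expnS divnMA -[X in (_ + X) %/ _]muln2 addnC divnMDl // [c %/ 2]divn_small ?addn0 //.
by case: c.
Qed.

Lemma head_bounds M x t : let c := tm_run M x t in
  (- t%:Z <= cf_head c)%R /\ (cf_head c <= t%:Z)%R.
Proof.
elim: t => [|t [h1 h2]] //=; rewrite -/(tm_run M x t) step_trans /=.
by case: (trans _ _).2 => /=; lia.
Qed.

Lemma halted_run M x t t' : halted (tm_run M x t) -> t <= t' -> tm_run M x t' = tm_run M x t.
Proof.
move=> h /subnK <-; elim: (t' - t) => // d IH; rewrite addSn /tm_run iterS.
rewrite -/(tm_run M x (d + t)) IH /tm_step; move: h; rewrite /halted.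
by case: (tm_trans _ _).
Qed.

Lemma read_bitsP M tape p fuel i : i < size (@read_bits M tape p fuel) ->
  tape (Posz (p + i)) = Some (inl (nth false (@read_bits M tape p fuel) i)).
Proof.
elim: fuel p i => // fuel IH p i /=.
case E: (tape p) => [[c|]|] //=; case: i => [|i] /=; first by rewrite addn0.
by rewrite ltnS => h; rewrite -addSnnS; apply: IH.
Qed.

Lemma size_read_bits M tape p fuel : size (@read_bits M tape p fuel) <= fuel.
Proof. by elim: fuel p => //= fuel IH p; case: (tape p) => [[c|]|] //=; apply: IH. Qed.

(** Halting within [T] steps keeps the head within distance [T] of cell 0, so shifting the tape by
    [T + 1] digits makes all positions natural. The bound [size (f x) <= y] serves the later
    parsing, which scans the digits at positions below [y]. *)
Theorem simulate f : polytime_computable f -> exists b c0 c1 B k Out,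
  [/\ 1 < b, c0 <> c1, LS 3 Out & forall x S, let T := size x ^ k + k in
     B ^ (T + 1 + (T + size x + 2)) <= S ->
     let y := Out [:: inregs x 0; inregs x 1; S] in
     [/\ forall i, i < size (f x) -> dig b y i = if nth false (f x) i then c1 else c0,
         size (f x) <= T + size x + 1, size (f x) <= y & y <= S]].
Proof.
move=> [M [k hM]]; set b := size (syms M).
pose c0 := sc (Some (inl false) : tm_sym M); pose c1 := sc (Some (inl true) : tm_sym M).
have b1 : 1 < b by rewrite /b /syms /= size_map -cardE card_sum card_bool; lia.
(* [B] also exceeds the number of states, so that the cap does not disturb the state component. *)
pose B := b + #|tm_state M|.
pose len e := bitlen (nth 0 e 1); pose Of e := len e ^ k + k + 1.
pose I e := [:: qc (tm_start M); \sum_(i < len e) (if dig 2 (nth 0 e 0) i == 1 then c1 else c0)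
     * powcap (nth 0 e 2) b (Of e + i); Of e].
pose final e := iter (Of e) (fun vs => capv (nth 0 e 2) (@simF M (vs ++ e))) (capv (nth 0 e 2) (I e)).
pose Out e := shr b (nth 0 (final e) 1) (Of e).
have hlen : LS 3 len := LS_bitlen (LS_var 3 1).
have hO : LS 3 Of := LS_add (LS_add (LS_exp k hlen) (LS_const 3 k)) (LS_const 3 1).
have hI : LSv 3 3 I.
  apply: LSv_cons; first exact: LS_const.
  apply: LSv_cons; last by apply: LSv_cons; [exact: hO|exact: LSv_nil].
  apply: (@LS_sum 3 len (fun i e => (if dig 2 (nth 0 e 0) i == 1 then c1 else c0)
     * powcap (nth 0 e 2) b (Of e + i))) => //.
  apply: LS_mul.
    apply: LS_if (LS_const _ _) (LS_const _ _).
    by apply: LS_eqn (LS_const _ _); apply: LS_dig (LS_const _ 2) (LS_behead (LS_var _ 0)) (LS_var _ _).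
  exact: (LS_powcap (LS_behead (LS_var 3 2)) (LS_const 4 (b.-1)) (LS_add (LS_behead hO) (LS_var 4 0))).
exists b, c0, c1, B, k, Out; split=> //.
- by move/sc_inj.
- have hf := LSv_itercap hO (LS_var 3 2) hI (LS_simF M).
  exact: (LS_shr (LS_const 3 b) (LS_nth 1 hf) hO).
move=> x S T hS; set e := [:: _; _; _]; set y := Out e => /=.
have lenE : len e = size x by rewrite /len /= bitlen_input.
have OE : Of e = T + 1 by rewrite /Of lenE.
set O := T + 1 in OE *; set W := O + (T + size x + 2).
have W0 : 0 < W by rewrite /W /O; lia.
have hbW : b ^ W <= S by apply: leq_trans hS; rewrite leq_exp2r ?leq_addr.
have hQS : #|tm_state M| <= S.
  apply: leq_trans hS; apply: (@leq_trans (B ^ 1)); first by rewrite expn1 leq_addl.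
  by rewrite leq_exp2l // /B; lia.
have hWS : W <= S by apply: leq_trans hbW; apply: ltnW; apply: ltn_expl.
have capE (c : config M) : (0 <= cf_head c + O%:Z)%R -> (cf_head c + O%:Z < W%:Z)%R ->
    capv S (simrep O W c) = simrep O W c.
  move=> h1 h2; rewrite /capv /=; congr [:: _; _; _]; apply/minn_idPr.
  - exact: (ltnW (leq_trans (qc_lt (cf_state c)) hQS)).
  - by apply: ltnW; exact: leq_trans (tnum_lt _ _ _) hbW.
  - lia.
have init : capv S (I e) = simrep O W (init_config M x).
  rewrite -capE /=; try by rewrite /W /O; lia.
  rewrite /I OE lenE /simrep /=; congr [:: minn _ _; minn _ _; minn _ _].
  rewrite /tnum /W big_split_ord /= [X in _ = X + _]big1 ?add0n; last first.
    move=> i _; have := ltn_ord i; case E: (i%:Z - O%:Z)%R => [n|n] // hi; lia.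
  have -> : T + size x + 2 = size x + (T + 2) by lia.
  rewrite big_split_ord /= [X in _ = _ + X]big1 ?addn0; last first.
    move=> i _; have -> : ((O + (size x + i))%:Z - O%:Z = (size x + i)%N%:Z)%R by lia.
    by rewrite ltnNge leq_addr.
  apply: eq_bigr => i _; have -> : ((O + i)%:Z - O%:Z = i%:Z)%R by lia.
  rewrite ltn_ord dig_input /c0 /c1; congr (_ * _); first by case: (nth _ _ _).
  by apply/minn_idPr; apply: leq_trans hbW; rewrite leq_exp2l // /W; have := ltn_ord i; lia.
have eO : O = T + 1 by [].
have run t : t <= O -> iter t (fun vs => capv S (@simF M (vs ++ e))) (capv S (I e))
    = simrep O W (tm_run M x t).
  elim: t => [|t IH] ht; first by rewrite init.
  have [h1 h2] := head_bounds M x t; have [h3 h4] := head_bounds M x t.+1.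
  rewrite iterS IH ?(ltnW ht) // /e sim_step //; try by rewrite /W; lia.
  rewrite -/(tm_step _) -/(tm_run M x t.+1) capE // /W.
    by move: h3 h4 => /=; lia.
  by move: h3 h4 => /=; lia.
have [t [ht [hh ho]]] := hM x.
set tape := cf_tape (tm_run M x t) in ho.
have yE : y = \sum_(i < T + size x + 2) sc (tape i) * b ^ i.
  rewrite /y /Out OE /final OE -[nth 0 e 2]/S run // -[nth _ _ _]/(tnum O W _).
  rewrite (halted_run hh); last by rewrite /O; lia.
  rewrite /tnum /W (@sum_digits_shr b O _ (fun i => sc (tape (i%:Z - O%:Z)%R))); last by move=> *; apply: sc_lt.
  by apply: eq_bigr => i _; congr (sc (tape _) * _); lia.
have szf : size (f x) <= T + size x + 1.
  by rewrite -ho; apply: leq_trans (size_read_bits _ _ _) _; rewrite addnAC addn1 ltnS leq_add2r.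
have hdig i : i < size (f x) -> sc (tape i) = if nth false (f x) i then c1 else c0.
  rewrite -ho => hi; have := read_bitsP hi; rewrite add0n -/tape => ->.
  by case: (nth _ _ _).
have hyS : y <= S.
  rewrite yE; apply: leq_trans hbW; apply: leq_trans (ltnW _) _.
    by apply: (@sum_digits_lt b _ (fun i => sc (tape i))) => i _; apply: sc_lt.
  by rewrite leq_exp2l // /W leq_addl.
split=> //.
- move=> i hi; rewrite yE (@dig_sum b _ (fun i => sc (tape i))) ?hdig //; last by lia.
  by move=> j _; apply: sc_lt.
(* The codes [c0] and [c1] are positive, so the last output digit alone makes [y] at least
   [b ^ L]. *)
- case E: (size (f x)) szf hdig => [|L] // szf hdig.
  have hL : L < T + size x + 2 by lia.
  rewrite yE (bigD1 (Ordinal hL)) //= hdig //; apply: leq_trans (leq_addr _ _).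
  apply: (@leq_trans (b ^ L)); first by apply: ltn_expl.
  by rewrite leq_pmull //; case: ifP.
Qed.

(** * Parsing circuit descriptions *)

Section Tokens.
Variables b c0 c1 : nat.

(* The length of the j-th run of c1 digits of y, counting from 0, where every
   digit c0 closes a run. *)
Definition tok y j := \sum_(i < y) nat_of_bool (dig b y i == c1) *
  nat_of_bool (\sum_(i' < i) nat_of_bool (dig b y i' == c0) == j).

Lemma LS_tok : LSf2 tok.
Proof.
apply: LSf2I.
apply: (@LS_sum 2 (nth 0 ^~ 0) (fun i e => nat_of_bool (dig b (nth 0 e 0) i == c1) *
  nat_of_bool (\sum_(i' < i) nat_of_bool (dig b (nth 0 e 0) i' == c0) == nth 0 e 1)) (LS_var _ _)).
apply: LS_mul.
  by apply: LS_eqn (LS_const _ _); apply: LS_dig (LS_const _ _) (LS_behead (LS_var _ 0)) (LS_var _ _).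
apply: LS_eqn (LS_behead (LS_var _ 1)).
apply: (@LS_sum 3 (nth 0 ^~ 0) (fun i e => nat_of_bool (dig b (nth 0 (behead e) 0) i == c0)) (LS_var _ _)).
apply: LS_eqn (LS_const _ _).
by apply: LS_dig (LS_const _ _) (LS_behead (LS_behead (LS_var _ 0))) (LS_var _ _).
Qed.

Fixpoint ftok (s : seq bool) j :=
  match s with
  | [::] => 0
  | true :: s' => (j == 0) + ftok s' j
  | false :: s' => if j is j'.+1 then ftok s' j' else 0
  end.

Lemma ftok_enc l j : j < size l -> ftok (flatten (map enc_nat l)) j = nth 0 l j.
Proof.
elim: l j => // a l IH j /=; rewrite /enc_nat cat_rcons; elim: a j => [|a IHa] [|j] //= hj.
- exact: IH.
- by rewrite IHa.
- exact: (IHa j.+1).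
Qed.

Lemma ftok_sum s j : ftok s j = \sum_(i < size s) nat_of_bool (nth false s i) *
  nat_of_bool (count negb (take i s) == j).
Proof.
elim: s j => [|[] s IH] j; rewrite /= ?big_ord0 // big_ord_recl /= ?mul1n ?mul0n ?add0n.
  by rewrite IH eq_sym.
case: j => [|j]; last by rewrite IH.
by rewrite big1 // => i _; rewrite muln0.
Qed.

Hypothesis c01 : c0 <> c1.

Lemma tok_spec y s l j : s = flatten (map enc_nat l) -> j < size l -> size s <= y ->
  (forall i, i < size s -> dig b y i = if nth false s i then c1 else c0) ->
  tok y j = nth 0 l j.
Proof.
move=> es hj hs hd; rewrite -ftok_enc // -es ftok_sum /tok.
have e1 i : i < size s -> (dig b y i == c1) = nth false s i.
  by move=> hi; rewrite hd //; case: (nth _ _ _); rewrite ?eqxx //; apply/eqP.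
have e0 i : i < size s -> (dig b y i == c0) = ~~ nth false s i.
  move=> hi; rewrite hd //; case: (nth _ _ _); rewrite ?eqxx //; apply/eqP => h; exact: c01.
have cnt i : i <= size s -> \sum_(i' < i) nat_of_bool (dig b y i' == c0) = count negb (take i s).
  elim: i => [|i IH] hi; first by rewrite big_ord0 take0.
  by rewrite big_ord_recr /= IH ?(ltnW hi) // (take_nth false hi) -cats1 count_cat /= addn0 e0.
have nfalse : count negb s = size l.
  rewrite es; elim: (l) => //= a l' IH; rewrite count_cat IH -[(size l').+1]add1n; congr (_ + _).
  by rewrite /enc_nat -cats1 count_cat count_nseq /= mul0n.
pose G i := nat_of_bool (dig b y i == c1) *
  nat_of_bool (\sum_(i' < i) nat_of_bool (dig b y i' == c0) == j).
transitivity (\sum_(i < size s + (y - size s)) G i); first by rewrite subnKC.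
(* Digits beyond the encoding are arbitrary, but they add nothing: all [size l] separators precede
   them, so the count of separators exceeds [j]. *)
rewrite big_split_ord /= [X in _ + X]big1 ?addn0; last first.
  move=> i _; rewrite /G; set z := \sum_(_ < _) _; have hz : size l <= z.
    have := cnt (size s) (leqnn _); rewrite take_size -nfalse => <-.
    by rewrite /z big_split_ord /= leq_addr.
  by rewrite (gtn_eqF (leq_trans hj hz)) muln0.
by apply: eq_bigr => i _; rewrite /G e1 // cnt // ltnW.
Qed.

(** Token 3 opens the first gate, after [m], [n] and the number of gates. A gate is its index, its
    number of targets and the targets, so the next one begins that number plus 2 tokens later. The
    cap [y] is for [LS_itercap]. *)
Definition gpos y t := iter t (fun p => minn y (p + 2 + tok y p.+1)) (minn y 3).
Definition gidx y t := tok y (gpos y t).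
Definition gqubit y t j := tok y (gpos y t + 2 + j).

Lemma LS_gpos : LSf2 gpos.
Proof.
apply: LSf2I.
apply: (@LS_itercap 2 (nth 0 ^~ 1) (fun=> 3) (nth 0 ^~ 0) (fun p e => p + 2 + tok (nth 0 e 0) p.+1)
  (LS_var _ _) (LS_var _ _) (LS_const _ _)).
apply: LS_add; first by apply: LS_add (LS_var _ _) (LS_const _ _).
by apply: LS_tok (LS_behead (LS_var _ 0)) (LS_S (LS_var _ _)).
Qed.

Lemma LS_gidx : LSf2 gidx.
Proof. by move=> k y t hy ht; apply: (LS_tok hy (LS_gpos hy ht)). Qed.

Lemma LS_gqubit : LSf3 gqubit.
Proof.
move=> k y t j hy ht hj.
exact: (LS_tok hy (LS_add (LS_add (LS_gpos hy ht) (LS_const k 2)) hj)).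
Qed.

Definition flat_gates (gs : seq (nat * seq nat)) := flatten [seq g.1 :: size g.2 :: g.2 | g <- gs].
Definition flat (d : desc) := let: (m, n, gs) := d in m :: n :: size gs :: flat_gates gs.

Lemma enc_desc_flat d : enc_desc d = flatten (map enc_nat (flat d)).
Proof.
case: d => [[m n] gs] /=; do 3 congr (_ ++ _); rewrite /flat_gates.
elim: gs => //= g gs ->; rewrite /enc_list map_cat flatten_cat.
by rewrite -!catA.
Qed.

Lemma desc_tokens d y : let s := enc_desc d in size s <= y ->
  (forall i, i < size s -> dig b y i = if nth false s i then c1 else c0) ->
  [/\ tok y 0 = d.1.1, tok y 1 = d.1.2, tok y 2 = size d.2 &
   forall t, t < size d.2 -> let g := nth (0, [::]) d.2 t in
     gidx y t = g.1 /\ forall j, j < size g.2 -> gqubit y t j = nth 0 g.2 j].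
Proof.
move=> s hs hd; have es : s = flatten (map enc_nat (flat d)) by apply: enc_desc_flat.
have htok j : j < size (flat d) -> tok y j = nth 0 (flat d) j.
  by move=> hj; apply: tok_spec es hj hs hd.
have hsz : size (flat d) <= y.
  apply: leq_trans hs; rewrite es; elim: (flat d) => //= a l IH.
  by rewrite size_cat size_rcons addSn ltnS (leq_trans IH) // leq_addl.
case: d @s es hs hd htok hsz => [[m n] gs] s es hs hd htok hsz.
split; [exact: htok|exact: htok|exact: htok|].
pose pos t := size (flat_gates (take t gs)) + 3.
have flatE t : t < size gs -> flat (m, n, gs) =
   [:: m, n, size gs & flat_gates (take t gs)] ++ let g := nth (0, [::]) gs t in
     g.1 :: size g.2 :: g.2 ++ flat_gates (drop t.+1 gs).
  move=> ht; rewrite /flat /= -{2}(cat_take_drop t gs) (drop_nth (0, [::]) ht).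
  by rewrite /flat_gates map_cat flatten_cat.
have nthE t j : t < size gs -> nth 0 (flat (m, n, gs)) (pos t + j) =
   nth 0 (let g := nth (0, [::]) gs t in g.1 :: size g.2 :: g.2 ++ flat_gates (drop t.+1 gs)) j.
  move=> ht; rewrite (flatE t ht) nth_cat /= /pos ltnNge; set z := size _.
  have -> /= : z.+2 < z + 3 + j by lia.
  by congr nth; lia.
have posS t : t < size gs -> pos t.+1 = pos t + 2 + size (nth (0, [::]) gs t).2.
  move=> ht; rewrite /pos (take_nth (0, [::]) ht) -cats1 /flat_gates map_cat flatten_cat size_cat /= cats0.
  lia.
have poslt t j : t < size gs -> j < 2 + size (nth (0, [::]) gs t).2 -> pos t + j < size (flat (m, n, gs)).
  move=> ht hj; rewrite (flatE t ht) size_cat /= size_cat /pos; lia.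
have gposE t : t <= size gs -> gpos y t = pos t.
  elim: t => [|t IH] ht; first by rewrite /gpos /pos /= take0 add0n; apply/minn_idPr; apply: leq_trans hsz.
  rewrite /gpos iterS -/(gpos y t) IH ?(ltnW ht) // -[(pos t).+1]addn1 htok; last by apply: poslt => //; lia.
  rewrite nthE //= -posS //; apply/minn_idPr; apply: leq_trans hsz.
  rewrite (flatE t ht) size_cat /= size_cat posS // /pos; lia.
move=> t ht g; rewrite /gidx /gqubit gposE; last exact: ltnW.
split; first by rewrite -[pos t]addn0 htok ?nthE //; apply: poslt.
move=> j hj; rewrite -addnA htok; last by apply: poslt => //; lia.
by rewrite nthE //= nth_cat hj.
Qed.
End Tokens.

(** * The determinant as a signed count of walks *)

Import Order.TTheory GRing.Theory Num.Theory.

Local Open Scope ring_scope.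

(** Schur complement without division: multiplication on the right by a block triangular matrix of
    determinant [\det P] clears the column [u], and the extra factor cancels in a domain. *)
Lemma det_border (R : idomainType) k (P : 'M[R]_k) (u : 'cV_k) (r : 'rV_k) (s : 'M_1) :
  \det P != 0 -> \det (block_mx P u r s) = s 0 0 * \det P - (r *m \adj P *m u) 0 0.
Proof.
move=> hP; apply: (mulIf hP).
have -> : \det (block_mx P u r s) * \det P =
   \det (block_mx P u r s *m block_mx 1%:M (- (\adj P *m u)) 0 (\det P)%:M).
  rewrite det_mulmx det_ublock det1 mul1r.
  by rewrite [X in _ = _ * X]det_mx11 mxE eqxx mulr1n.
rewrite mulmx_block !mulmx1 !mulmx0 !addr0 !mulmxN !mulmxA mul_mx_adj mul_scalar_mx.
rewrite !mul_mx_scalar addNr det_lblock det_mx11 mulrC; congr (_ * _).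
by rewrite !mxE addrC (mulrC (\det P)).
Qed.

Lemma det_mul_adj (R : comNzRingType) k (P : 'M[R]_k) (c : 'I_k -> R) j :
  \det P * c j = \sum_(v < k) \adj P j v * \sum_(i < k) P v i * c i.
Proof.
have e : \adj P *m (P *m \col_i c i) = \det P *: \col_i c i.
  by rewrite mulmxA mul_adj_mx mul_scalar_mx.
have := congr1 (fun M : 'cV_k => M j 0) e; rewrite ![in RHS]mxE => <-.
rewrite [LHS]mxE; apply: eq_bigr => v _; congr (_ * _); rewrite [LHS]mxE.
by apply: eq_bigr => i _; rewrite mxE.
Qed.

Section Trunc.
Variables (R : comNzRingType) (N : nat).

(** Equality modulo the power [N.+1] of the variable: the recursions for [g] and [w] are available
    only up to length [N]. *)
Definition eqm (p q : {poly R}) := forall i, (i <= N)%N -> p`_i = q`_i.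

Lemma eqm_refl p : eqm p p. Proof. by []. Qed.
Lemma eqm_trans q p r : eqm p q -> eqm q r -> eqm p r.
Proof. by move=> h1 h2 i hi; rewrite h1 // h2. Qed.
Lemma eqm_add p q p' q' : eqm p p' -> eqm q q' -> eqm (p + q) (p' + q').
Proof. by move=> h1 h2 i hi; rewrite !coefD h1 // h2. Qed.
Lemma eqm_mull r p q : eqm p q -> eqm (r * p) (r * q).
Proof. by move=> h i hi; rewrite !coefM; apply: eq_bigr => j _; rewrite h //; lia. Qed.
Lemma eqm_sum I (s : seq I) (F G : I -> {poly R}) :
  (forall i, eqm (F i) (G i)) -> eqm (\sum_(i <- s) F i) (\sum_(i <- s) G i).
Proof. by move=> h i hi; rewrite !coef_sum; apply: eq_bigr => j _; rewrite h. Qed.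
End Trunc.

(** * Generating functions of clow sequences *)

Section Clow.
Variables (R : idomainType) (a : nat -> nat -> R) (N : nat).
Variables (g : nat -> nat -> R) (w : nat -> nat -> nat -> R).
Hypothesis gN : forall l, g N l = (l == 0)%:R.
Hypothesis g0 : forall k, (k < N)%N -> g k 0%N = g k.+1 0%N.
Hypothesis gS : forall k l, (k < N)%N -> (l < N)%N ->
  g k l.+1 = g k.+1 l.+1 - a k k * g k.+1 l - \sum_(j < k) a k j * w k j l.
Hypothesis w0 : forall k v, (k < N)%N -> (v < k)%N -> w k v 0%N = 0.
Hypothesis wS : forall k v l, (k < N)%N -> (v < k)%N -> (l < N)%N ->
  w k v l.+1 = a v k * g k.+1 l + \sum_(j < k) a v j * w k j l.

(* [g k l] and [w k v l] are the coefficients of x^l in the generating functions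
   of signed sequences of closed walks with increasing heads, starting with no
   head below k, resp. inside a walk with head k at vertex v. With
   Delta_k = det (1 - x A_k), A_k the leading k x k block of [a], expanding
   Delta_k.+1 along its border gives Delta_k g_k = Delta_k.+1 g_k.+1. *)
Definition lead_mx k : 'M[{poly R}]_k :=
  \matrix_(i < k, j < k) ((i == j :> nat)%:R - 'X * (a i j)%:P).

Lemma lead_mx_det_neq0 k : \det (lead_mx k) != 0.
Proof.
apply/eqP => /(congr1 (horner_eval 0)); rewrite -det_map_mx rmorph0.
have -> : map_mx (horner_eval 0) (lead_mx k) = 1%:M.
  apply/matrixP => i j; rewrite !mxE /= /horner_eval -val_eqE !hornerE.
  by case: (_ == _); rewrite /= ?hornerE ?mul0r ?subr0 ?oppr0.
by rewrite det1 => /eqP; rewrite oner_eq0.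
Qed.

Lemma lead_mxS k : \det (lead_mx k.+1) =
  (1 - 'X * (a k k)%:P) * \det (lead_mx k)
  - \sum_(j < k) 'X * (a k j)%:P * \sum_(v < k) \adj (lead_mx k) j v * ('X * (a v k)%:P).
Proof.
pose u : 'cV_k := \col_v (- ('X * (a v k)%:P)).
pose r : 'rV_k := \row_j (- ('X * (a k j)%:P)).
pose s : 'M_1 := (1 - 'X * (a k k)%:P)%:M.
have -> : \det (lead_mx k.+1) = \det (block_mx (lead_mx k) u r s).
  rewrite -[k.+1]addn1; congr (\det _); apply/matrixP => i j.
  rewrite !mxE; case: splitP => i' hi; rewrite !mxE; case: splitP => j' hj; rewrite !mxE hi hj //.
  - by rewrite (ord1 j') addn0 ltn_eqF // sub0r.
  - by rewrite (ord1 i') addn0 gtn_eqF // sub0r.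
  - by rewrite (ord1 i') (ord1 j') addn0 eqxx mulr1n.
rewrite det_border ?lead_mx_det_neq0 //; congr (_ * _ - _); first by rewrite mxE eqxx mulr1n.
rewrite -mulmxA !mxE; apply: eq_bigr => j _; rewrite !mxE !mulNr -mulrN -sumrN; congr (_ * _).
by apply: eq_bigr => v _; rewrite !mxE mulrN opprK.
Qed.

Let G k : {poly R} := \poly_(l < N.+1) g k l.
Let W k v : {poly R} := \poly_(l < N.+1) w k v l.

Lemma coefG k l : (l <= N)%N -> (G k)`_l = g k l.
Proof. by move=> h; rewrite coef_poly ltnS h. Qed.
Lemma coefW k v l : (l <= N)%N -> (W k v)`_l = w k v l.
Proof. by move=> h; rewrite coef_poly ltnS h. Qed.

Lemma G_rec k : (k < N)%N ->
  eqm N (G k) (G k.+1 - 'X * ((a k k)%:P * G k.+1 + \sum_(j < k) (a k j)%:P * W k j)).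
Proof.
move=> hk [|l] hl; rewrite coefG // coefB coefG // coefXM.
  by rewrite eqxx subr0 g0.
rewrite -[l.+1 == 0]/false -[l.+1.-1]/l gS // coefD coefCM coefG ?(ltnW hl) // opprD addrA coef_sum; congr (_ - _).
by apply: eq_bigr => j _; rewrite coefCM coefW // ltnW.
Qed.

Lemma W_rec k v : (k < N)%N -> (v < k)%N ->
  eqm N (W k v) ('X * ((a v k)%:P * G k.+1 + \sum_(j < k) (a v j)%:P * W k j)).
Proof.
move=> hk hv [|l] hl; rewrite coefW // coefXM.
  by rewrite eqxx w0.
rewrite -[l.+1 == 0]/false -[l.+1.-1]/l wS // coefD coefCM coefG ?(ltnW hl) // coef_sum; congr (_ + _).
by apply: eq_bigr => j _; rewrite coefCM coefW // ltnW.
Qed.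

(** [W_rec] says that [lead_mx k] maps the column of all [W k v] to ['X] times the border column
    times [G k.+1]. Applying the adjugate solves this system up to the factor [\det (lead_mx k)]. *)
Lemma W_solve k j : (k < N)%N ->
  eqm N (\det (lead_mx k) * W k (j : 'I_k))
        ((\sum_(v < k) \adj (lead_mx k) j v * ('X * (a v k)%:P)) * G k.+1).
Proof.
move=> hk.
have -> : \det (lead_mx k) * W k j =
   \sum_(v < k) \adj (lead_mx k) j v * \sum_(i < k) lead_mx k v i * W k i.
  exact: det_mul_adj.
rewrite mulr_suml; apply: eqm_sum => v; rewrite -mulrA; apply: eqm_mull.
have -> : \sum_(i < k) lead_mx k v i * W k i = W k v - 'X * \sum_(i < k) (a v i)%:P * W k i.
  rewrite mulr_sumr; under eq_bigr do rewrite mxE mulrBl -mulrA.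
  rewrite sumrB; congr (_ - _); rewrite (bigD1 v) //= eqxx mul1r big1 ?addr0 // => i hi.
  by rewrite (_ : (v == i :> nat) = false) ?mul0r //; apply/negbTE; rewrite eq_sym.
have h := eqm_add (W_rec hk (ltn_ord v)) (eqm_refl (N:=N) (- ('X * \sum_(i < k) (a v i)%:P * W k i))).
by apply: eqm_trans h _; rewrite mulrDr addrK mulrA.
Qed.

(** Substituting the solved walks into [G_rec] reproduces the border expansion [lead_mxS]. *)
Lemma lead_step k : (k < N)%N ->
  eqm N (\det (lead_mx k) * G k) (\det (lead_mx k.+1) * G k.+1).
Proof.
move=> hk; set D := \det (lead_mx k).
apply: (eqm_trans (eqm_mull _ (G_rec hk))).
have -> : D * (G k.+1 - 'X * ((a k k)%:P * G k.+1 + \sum_(j < k) (a k j)%:P * W k j)) =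
  (1 - 'X * (a k k)%:P) * D * G k.+1 + \sum_(j < k) (- ('X * (a k j)%:P)) * (D * W k j).
  rewrite [X in _ = _ + X](eq_bigr (fun j : 'I_k => - D * 'X * ((a k j)%:P * W k j))); last first.
    by move=> j _; move: ((a k j)%:P) (W k j) 'X => x y z; ring.
  rewrite -mulr_sumr; move: (\sum_(i < k) _) ((a k k)%:P) 'X (G k.+1) => x y z t; ring.
rewrite lead_mxS -/D [X in eqm _ _ X]mulrBl [X in eqm _ _ (_ - X)]mulr_suml -sumrN; apply: eqm_add; first exact: eqm_refl.
apply: eqm_sum => j; rewrite -[X in eqm _ _ (- X)]mulrA -[X in eqm _ _ X]mulNr.
by apply: eqm_mull; apply: W_solve.
Qed.

Lemma coef_prod_linear (r : seq 'I_N) (p : 'I_N -> {poly R}) :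
  (forall i, (size (p i) <= 2)%N) ->
  (size (\prod_(i <- r) p i)%R <= (size r).+1)%N /\
  (\prod_(i <- r) p i)`_(size r) = \prod_(i <- r) (p i)`_1.
Proof.
move=> hp; elim: r => [|i r [IH1 IH2]]; first by rewrite !big_nil size_poly1 coef1.
rewrite !big_cons /=; set Q := \prod_(_ <- r) _ in IH1 IH2 *.
have e : p i = ((p i)`_0)%:P + ((p i)`_1)%:P * 'X.
  apply/polyP => -[|[|l]]; rewrite coefD coefC coefMX !coefC /= ?addr0 ?add0r //.
  by rewrite nth_default //; apply: leq_trans (hp i) _.
split.
  apply: leq_trans (size_polyMleq _ _) _; have := hp i; lia.
rewrite {1}e mulrDl coefD coefCM -mulrA coefCM coefXM /= IH2.
by rewrite (nth_default _ IH1) mulr0 add0r.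
Qed.

(** All entries have degree at most 1, so the coefficient of degree [N] of a Leibniz term is the
    product of the linear coefficients. *)
Lemma lead_coef_det : (\det (lead_mx N))`_N = \det (\matrix_(i < N, j < N) - a i j).
Proof.
rewrite /determinant coef_sum; apply: eq_bigr => s _.
have hp i : (size (lead_mx N i (s i)) <= 2)%N.
  rewrite mxE; apply: leq_trans (size_polyD _ _) _; rewrite geq_max size_polyN.
  apply/andP; split; first by case: (_ == _); rewrite ?size_poly0 ?size_poly1.
  rewrite mulrC; apply: leq_trans (size_polyMleq _ _) _; rewrite size_polyX -[2%R]/2%N.
  by move: (size_polyC_leq1 (a i (s i))); move: (size _) => z; case: z => [|[|z]].
have [_] := coef_prod_linear (index_enum 'I_N) hp.
have -> : size (index_enum 'I_N) = N by rewrite -[RHS]card_ord cardT enumT.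
rewrite -signr_odd; case: (odd_perm s); rewrite ?expr1 ?expr0 ?mulN1r ?mul1r ?coefN => ->;
  [congr (- _)|]; apply: eq_bigr => i _; rewrite !mxE coefB coefXM coefC /=;
  by case: (_ == _); rewrite ?coef1 ?coef0 /= sub0r.
Qed.

(** The products [\det (lead_mx k) * G k] agree for all [k]; the determinant is 1 at [k = 0], and
    the series is 1 at [k = N]. *)
Theorem clow_det : g 0%N N = \det (\matrix_(i < N, j < N) - a i j).
Proof.
have h k : (k <= N)%N -> eqm N (G 0%N) (\det (lead_mx k) * G k).
  elim: k => [|k IH] hk; first by rewrite det_mx00 mul1r; apply: eqm_refl.
  exact: (eqm_trans (IH (ltnW hk)) (lead_step hk)).
have GN : eqm N (G N) 1 by move=> l hl; rewrite coefG // gN coef1.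
have := eqm_trans (h N (leqnn _)) (eqm_mull _ GN); move/(_ N (leqnn _)).
by rewrite mulr1 lead_coef_det coefG.
Qed.
End Clow.

Lemma sum_mul (V : nmodType) m n (H : nat -> V) :
  \sum_(i < m * n) H i = \sum_(i < m) \sum_(j < n) H (i * n + j)%N.
Proof.
elim: m => [|m IH]; first by rewrite mul0n !big_ord0.
by rewrite mulSnr big_split_ord /= IH big_ord_recr.
Qed.

(** * Powers of integer matrices and their residues *)

Section MatPow.
Variables (M : nat -> nat -> int) (Z : nat).

Lemma eq_sum_modz (q : int) n (F G : 'I_n -> int) :
  (forall i, (F i = G i %[mod q])%Z) -> (\sum_i F i = \sum_i G i %[mod q])%Z.
Proof.
move=> h; apply/eqP; rewrite eqz_mod_dvd -sumrB; apply: rpred_sum => i _.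
by rewrite -[_ \in _]eqz_mod_dvd; apply/eqP.
Qed.

Fixpoint matpow (T : nat) (s t : nat) : int :=
  if T is T'.+1 then \sum_(z < Z) M s z * matpow T' z t else (s == t)%:R.

Lemma sum_delta (V : nmodType) n c (F : nat -> V) : \sum_(i < n) F i *+ (i == c :> nat) = F c *+ (c < n)%N.
Proof.
case: ltnP => hc.
  rewrite (bigD1 (Ordinal hc)) //= eqxx mulr1n big1 ?addr0 // => i hi.
  by rewrite (_ : (i == c :> nat) = false) //; apply/negbTE; move: hi; rewrite -val_eqE.
by rewrite big1 // => i _; rewrite ltn_eqF // (leq_trans (ltn_ord i) hc).
Qed.

Lemma matpow_add T1 T2 s t : (s < Z)%N ->
  matpow (T1 + T2) s t = \sum_(z < Z) matpow T1 s z * matpow T2 z t.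
Proof.
elim: T1 s => [|T1 IH] s hs /=.
  rewrite add0n (eq_bigr (fun z : 'I_Z => (fun z => matpow T2 z t) z *+ (z == s :> nat))); last first.
    by move=> z _; rewrite eq_sym; case: (_ == _); rewrite ?mul1r ?mul0r.
  by rewrite (sum_delta _ _ (fun z => matpow T2 z t)) hs.
rewrite (eq_bigr (fun z : 'I_Z => \sum_(y < Z) M s z * matpow T1 z y * matpow T2 y t)); last first.
  by move=> z _; rewrite IH // mulr_sumr; apply: eq_bigr => y _; rewrite mulrA.
by rewrite exchange_big; apply: eq_bigr => y _; rewrite mulr_suml.
Qed.

Lemma matpow_1 s t : (t < Z)%N -> matpow 1 s t = M s t.
Proof.
move=> ht; rewrite /= (eq_bigr (fun z : 'I_Z => M s z *+ (z == t :> nat))); last first.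
  by move=> z _; case: (_ == _); rewrite ?mulr1 ?mulr0.
by rewrite sum_delta ht.
Qed.

Lemma sqpow_matpow w (q : nat) d s t : (s < Z)%N -> (t < Z)%N ->
  (forall x y, (x < Z)%N -> (y < Z)%N -> ((w x y)%:Z = M x y %[mod q])%Z) ->
  ((sqpow w q Z d s t)%:Z = matpow (2 ^ d) s t %[mod q])%Z.
Proof.
move=> hs ht hw; elim: d s t hs ht => [|d IH] s t hs ht.
  by rewrite expn0 matpow_1 // [sqpow _ _ _ _ _ _]/= -modz_nat modz_mod hw.
rewrite expnS mul2n -addnn matpow_add // [sqpow _ _ _ _ _ _]/= -modz_nat modz_mod.
rewrite (big_morph Posz PoszD (erefl _)); apply: eq_sum_modz => z.
by rewrite PoszM -modzMm !IH // modzMm.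
Qed.
End MatPow.

(** * Clow sequences as paths in a graph *)

Section ClowPath.
Variables (a : nat -> nat -> int) (N : nat).
Notation Z := (N.+1 * (N.+1 * N.+1))%N.

Definition enc (k v l : nat) : nat := ((k * N.+1 + v) * N.+1 + l)%N.
Definition st_k s := (s %/ N.+1 %/ N.+1)%N.
Definition st_v s := (s %/ N.+1 %% N.+1)%N.
Definition st_l s := (s %% N.+1)%N.

(* State (k, v, l): the current head is k, the walk is at vertex v (v = N
   when it has not left the head), and l edges remain to be used. *)
Definition clow_edge (k v l k' v' l' : nat) : int :=
  if (k < N)%N then
    let c := if v == N then k else v in
    let sg : int := if v == N then -1 else 1 in
    [&& k' == k.+1, v' == N, l' == l & v == N]%:R
    + sg * a c k *+ [&& k' == k.+1, v' == N & l == l'.+1]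
    + sg * a c v' *+ [&& k' == k, v' < k & l == l'.+1]%N
  else ((k' == k) && (v' == v) && (l' == l))%:R.

Definition clow_mx s s' := clow_edge (st_k s) (st_v s) (st_l s) (st_k s') (st_v s') (st_l s').

Lemma encK k v l : (v <= N)%N -> (l <= N)%N ->
  [/\ st_k (enc k v l) = k, st_v (enc k v l) = v & st_l (enc k v l) = l].
Proof.
move=> hv hl; rewrite /st_k /st_v /st_l /enc.
by rewrite !divnMDl // !modnMDl (divn_small (m := l)) // addn0 divnMDl // modnMDl !modn_small // divn_small // addn0.
Qed.

Lemma enc_lt k v l : (k <= N)%N -> (v <= N)%N -> (l <= N)%N -> (enc k v l < Z)%N.
Proof. by rewrite /enc; nia. Qed.

Lemma sum_enc (F : nat -> int) :
  \sum_(s < Z) F s = \sum_(k < N.+1) \sum_(v < N.+1) \sum_(l < N.+1) F (enc k v l).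
Proof.
rewrite mulnA (sum_mul _ _ F) (sum_mul _ _ (fun i => \sum_(j < N.+1) F (i * N.+1 + j)%N)); apply: eq_bigr => k _; apply: eq_bigr => v _.
by [].
Qed.

Definition pv T k v l := matpow clow_mx Z T (enc k v l) (enc N N 0).

Lemma sum3_delta (F : nat -> nat -> nat -> int) k v l :
  \sum_(k' < N.+1) \sum_(v' < N.+1) \sum_(l' < N.+1)
     F k' v' l' *+ [&& k' == k :> nat, v' == v :> nat & l' == l :> nat] =
  F k v l *+ [&& k <= N, v <= N & l <= N]%N.
Proof.
transitivity (\sum_(k' < N.+1) (F k' v l *+ [&& v <= N & l <= N]%N) *+ (k' == k :> nat)).
  apply: eq_bigr => k' _.
  transitivity (\sum_(v' < N.+1) ((F k' v' l *+ (l <= N)%N) *+ (k' == k :> nat)) *+ (v' == v :> nat)).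
    apply: eq_bigr => v' _.
    transitivity (\sum_(l' < N.+1) ((F k' v' l' *+ (k' == k :> nat)) *+ (v' == v :> nat)) *+ (l' == l :> nat)).
      by apply: eq_bigr => l' _; do 3 case: (_ == _ :> nat).
    rewrite (sum_delta _ _ (fun l' => (F k' v' l' *+ (k' == k :> nat)) *+ (v' == v :> nat))) ltnS.
    by case: (l <= N)%N; do 2 case: (_ == _ :> nat).
  rewrite (sum_delta _ _ (fun v' => (F k' v' l *+ (l <= N)%N) *+ (k' == k :> nat))) ltnS.
  by case: (l <= N)%N; case: (v <= N)%N; case: (_ == _ :> nat).
rewrite (sum_delta _ _ (fun k' => F k' v l *+ [&& v <= N & l <= N]%N)) ltnS.
by do 3 case: (_ <= N)%N.
Qed.

(** The terms are the three kinds of edges: passing to the next head without a walk, closing the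
    walk, and extending it to a vertex below the head. The sign of a walk is charged to the edge
    that leaves the head. *)
Lemma pvS T k v l : (k < N)%N -> (v <= N)%N -> (l <= N)%N ->
  let c := if v == N then k else v in
  let sg : int := if v == N then -1 else 1 in
  pv T.+1 k v l = pv T k.+1 N l *+ (v == N)
    + (sg * a c k * pv T k.+1 N l.-1 + \sum_(j < k) sg * a c j * pv T k j l.-1) *+ (0 < l)%N.
Proof.
move=> hk hv hl c sg.
pose H z := clow_mx (enc k v l) z * matpow clow_mx Z T z (enc N N 0).
have -> : pv T.+1 k v l = \sum_(z < Z) H z by [].
rewrite sum_enc.
have [e1 e2 e3] := encK k hv hl.
pose F1 k' v' l' : int := pv T k' v' l' *+ (v == N).
pose F2 k' v' l' : int := sg * a c k * pv T k' v' l' *+ (0 < l)%N.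
rewrite (eq_bigr (fun k' : 'I_N.+1 => \sum_(v' < N.+1) \sum_(l' < N.+1)
   (F1 k' v' l' *+ [&& k' == k.+1 :> nat, v' == N :> nat & l' == l :> nat]
    + F2 k' v' l' *+ [&& k' == k.+1 :> nat, v' == N :> nat & l' == l.-1 :> nat]
    + \sum_(j < k) (sg * a c j * pv T k' j l' *+ (0 < l)%N) *+
         [&& k' == k :> nat, v' == j :> nat & l' == l.-1 :> nat]))); last first.
  move=> k' _; apply: eq_bigr => v' _; apply: eq_bigr => l' _.
  have [d1 d2 d3] := @encK k' v' l' (ltn_ord v') (ltn_ord l').
  rewrite /H -/(pv T k' v' l') /clow_mx e1 e2 e3 d1 d2 d3 /clow_edge hk -/c -/sg !mulrDl.
  rewrite /F1 /F2; clear H F1 F2; clearbody c sg.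
  congr (_ + _ + _).
  - by do 4 case: (_ == _ :> nat); rewrite ?mul0r ?mul1r.
  - case: l {e3 hl e1 e2} => [|l] /=; first by rewrite !andbF !mulr0n mul0r mul0rn.
    by rewrite eqSS (eq_sym l); do 3 case: (_ == _ :> nat); rewrite ?mul0r ?mulr0n ?mulr1n.
  - rewrite (eq_bigr (fun j : 'I_k => (fun j => sg * a c j * pv T k' j l' *+ (0 < l)%N *+
        ((k' == k :> nat) && (l' == l.-1 :> nat))) j *+ (j == v' :> nat))); last first.
      by move=> j _; rewrite (eq_sym (v' : nat)); do 3 case: (_ == _ :> nat).
    rewrite (sum_delta k v' (fun j => sg * a c j * pv T k' j l' *+ (0 < l)%N *+
        ((k' == k :> nat) && (l' == l.-1 :> nat)))).
    case: l {e3 hl e1 e2} => [|l] /=; first by rewrite !andbF !mulr0n mul0r !mul0rn.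
    by rewrite eqSS (eq_sym l); case: (v' < k)%N; do 2 case: (_ == _ :> nat);
      rewrite ?andbF ?mulr0n ?mulr1n ?mul0r ?mul0rn.
under eq_bigr do under eq_bigr do rewrite !big_split /=.
under eq_bigr do rewrite !big_split /=.
rewrite !big_split /= !sum3_delta.
have hl1 : (l.-1 <= N)%N by lia.
rewrite hk leqnn hl hl1 /= !mulr1n /F1 /F2 -addrA; congr (_ + _); rewrite mulrnDl; congr (_ + _).
transitivity (\sum_(j < k) \sum_(k' < N.+1) \sum_(v' < N.+1) \sum_(l' < N.+1)
   (sg * a c j * pv T k' j l' *+ (0 < l)%N) *+
         [&& k' == k :> nat, v' == j :> nat & l' == l.-1 :> nat]).
  rewrite [RHS]exchange_big /=; apply: eq_bigr => k' _.
  rewrite [RHS]exchange_big /=; apply: eq_bigr => v' _.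
  by rewrite [RHS]exchange_big.
rewrite -sumrMnl; apply: eq_bigr => j _.
rewrite (sum3_delta (fun k' _ l' => sg * a c j * pv T k' j l' *+ (0 < l)%N)).
by rewrite (ltnW hk) hl1 (leq_trans (ltnW (ltn_ord j)) (ltnW hk)).
Qed.

Lemma pvN T v l : (v <= N)%N -> (l <= N)%N -> pv T N v l = ((v == N) && (l == 0%N))%:R.
Proof.
move=> hv hl; have [e1 e2 e3] := encK N hv hl; elim: T => [|T IH].
  rewrite /pv /=; congr (_%:R); apply: congr1.
  have [d1 d2 d3] := @encK N N 0 (leqnn _) (leq0n _).
  apply/eqP/andP => [h|[/eqP -> /eqP -> //]].
  by move: e2 e3; rewrite h d2 d3 => <- <-; rewrite !eqxx.
pose H z := clow_mx (enc N v l) z * matpow clow_mx Z T z (enc N N 0).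
have -> : pv T.+1 N v l = \sum_(z < Z) H z by [].
rewrite sum_enc -IH.
transitivity (\sum_(k' < N.+1) \sum_(v' < N.+1) \sum_(l' < N.+1)
     pv T k' v' l' *+ [&& k' == N :> nat, v' == v :> nat & l' == l :> nat]).
  apply: eq_bigr => k' _; apply: eq_bigr => v' _; apply: eq_bigr => l' _.
  have [d1 d2 d3] := @encK k' v' l' (ltn_ord v') (ltn_ord l').
  rewrite /H -/(pv T k' v' l') /clow_mx e1 e2 e3 d1 d2 d3 /clow_edge ltnn -andbA.
  by case: [&& _, _ & _]; rewrite ?mul1r ?mul0r.
by rewrite (sum3_delta (pv T)) leqnn hv hl.
Qed.

(** Every edge lowers [N - k + l] until the absorbing states [k = N] are reached. Hence any exponent
    from [2 * N] on gives the same entry, and a power of 2 can be used. *)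
Lemma pv_stable T k v l : (k <= N)%N -> (v <= N)%N -> (l <= N)%N -> (N - k + l <= T)%N ->
  pv T.+1 k v l = pv T k v l.
Proof.
elim: T k v l => [|T IH] k v l hk hv hl hm; (case: (ltnP k N) => hkN; last by
  have -> : k = N by [lia]; rewrite !pvN).
- lia.
- rewrite [LHS]pvS // [RHS]pvS // IH //; last by lia.
  congr (_ + _); case: l hl hm => [|l] hl hm //=; congr (_ * _ + _).
    by apply: IH; lia.
  by apply: eq_bigr => j _; rewrite IH //; have := ltn_ord j; lia.
Qed.

Theorem clow_path T : (2 * N <= T)%N ->
  matpow clow_mx Z T (enc 0 N N) (enc N N 0) = \det (\matrix_(i < N, j < N) - a i j).
Proof.
move=> hT; rewrite -/(pv T 0 N N).
rewrite -(@clow_det _ a N (fun k l => if (l <= N)%N then pv T k N l else 0) (fun k v l => pv T k v l)).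
- by rewrite leqnn.
- by move=> l; case: leqP => hl; [rewrite pvN // eqxx|case: l hl].
- move=> k hk /=; rewrite -pv_stable ?(ltnW hk) // ?pvS //; last by lia.
  by rewrite eqxx mulr1n mulr0n addr0.
- move=> k l hk hl; rewrite hl (ltnW hl) -pv_stable ?(ltnW hk) // ?pvS //; last by lia.
  rewrite eqxx !mulr1n /= mulN1r mulNr -!addrA; congr (_ + (_ + _)).
  by rewrite -sumrN; apply: eq_bigr => j _; rewrite mulN1r mulNr.
- move=> k v hk hv; rewrite -pv_stable ?(ltnW hk) // ?pvS //; try lia.
- move=> k v l hk hv hl; rewrite (ltnW hl) -pv_stable ?(ltnW hk) // ?pvS //; try lia.
  rewrite ltn_eqF ?mulr0n ?mulr1n ?add0r ?mul1r //=; last by lia.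
  by congr (_ + _); apply: eq_bigr => j _; rewrite mul1r.
Qed.
End ClowPath.

Local Close Scope ring_scope.

(** * Deciding whether a determinant vanishes *)

(* The reciprocals of k * 'C(n, k) form Leibniz's harmonic triangle. *)
Lemma dvdn_leibniz L n k : (forall i, 0 < i <= n -> i %| L) -> 0 < k <= n ->
  k * 'C(n, k) %| L.
Proof.
elim: k n => // k IH [|n] hL; first by rewrite ltn0 andbF.
case: (posnP k) => [->|k0] hk; first by rewrite bin1 mul1n; apply: hL; lia.
have /dvdnP[x hx] : k * 'C(n, k) %| L.
  by apply: IH => [i hi|]; [apply: hL|]; lia.
have /dvdnP[y hy] : k * 'C(n.+1, k) %| L by apply: IH => [i hi|]; [apply: hL|]; lia.
have e1 := mul_bin_diag n.+1 k; have e2 := mul_bin_down n.+1 k.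
rewrite /= in e1 e2; rewrite -e1; apply/dvdnP; exists (x - y).
have hle : (n.+1 - k) * L + k * L = n.+1 * L by rewrite -mulnDl subnK //; lia.
apply/eqP; rewrite -(eqn_pmul2l k0); apply/eqP.
have ex : k * (x * (n.+1 * 'C(n, k))) = n.+1 * L by rewrite hx; ring.
have ey : k * (y * (n.+1 * 'C(n, k))) = (n.+1 - k) * L by rewrite e2 hy; ring.
by rewrite mulnBl mulnBr ex ey; lia.
Qed.

Lemma bin_central m : 2 ^ m <= 'C(m.*2, m).
Proof.
elim: m => // m IH; rewrite doubleS binS expnS.
have : 'C(m.*2, m) <= 'C(m.*2.+1, m.+1) by rewrite binS leq_addl.
have : 'C(m.*2, m) <= 'C(m.*2.+1, m) by case: m {IH} => // m; rewrite binS leq_addr.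
lia.
Qed.

(** [D] is a multiple of [m * 'C(m.*2, m)], which is at least [2 ^ m]. *)
Lemma int_dvd_all_eq0 (D : int) m : (absz D < 2 ^ m) -> 0 < m ->
  (forall q, 0 < q <= m.*2 -> (q%:Z %| D)%Z) -> D = 0.
Proof.
move=> hD hm h; have hd : m * 'C(m.*2, m) %| absz D.
  by apply: dvdn_leibniz => [i hi|]; [exact: h|lia].
apply/eqP; rewrite -absz_eq0 -leqn0 leqNgt; apply/negP => /dvdn_leq /(_ hd).
by have := bin_central m; nia.
Qed.

(** The Leibniz formula gives at most [(n * K) ^ n], and [n * K < 2 ^ (n * K)]. The exponent is
    crude, but only its number of bits counts for the space. *)
Lemma det_bound n (A : 'M[int]_n) K : 0 < K -> (forall i j, absz (A i j) <= K) ->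
  absz (\det A)%R < 2 ^ (n * (n * K) + 1).
Proof.
move=> hK hA; have h : (`|\det A| <= ((n * K) ^ n)%N%:Z)%R.
  apply: le_trans (ler_norm_sum _ _ _) _.
  apply: (@le_trans _ _ (\sum_(s : 'S_n) (K ^ n)%N%:Z)%R).
    apply: ler_sum => s _; rewrite normrM normrX normrN1 expr1n mul1r normr_prod.
    have -> : ((K ^ n)%N%:Z = \prod_(i < n) K%:Z)%R.
      by rewrite prodr_const card_ord -[Posz (K ^ n)]natz natrX natz.
    by apply: ler_prod => i _; rewrite normr_ge0 /=; have := hA i (s i); lia.
  rewrite sumr_const card_Sn expnMn -mulr_natr natz -PoszM lez_nat mulnC leq_mul2r.
  apply/orP; right; elim: (n) => // m IH.
  rewrite factS expnS leq_mul2l /=; apply: leq_trans IH _; by case: m => // m; rewrite leq_exp2r.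
have h2 : absz (\det A)%R <= (n * K) ^ n by lia.
apply: leq_ltn_trans h2 _; rewrite addn1 expnS.
have : (n * K) ^ n <= (2 ^ (n * K)) ^ n.
  by case: n {A hA h} => // n; rewrite leq_exp2r //; apply: ltnW; apply: ltn_expl.
rewrite -expnM [n * K * n]mulnC; have := expn_gt0 2 (n * (n * K)).
set X := 2 ^ _; set Y := (n * K) ^ _; lia.
Qed.

(** * The clow graph with natural weights modulo [q] *)

Section ClowNat.
Variables (N q : nat) (x : nat -> nat -> nat).

(** A natural representative of [-m] modulo [q], since the machine has no negative numbers; for
    positive [q] it lies between 1 and [q]. *)
Definition neg (m : nat) := q - m %% q.

Definition clow_nat (k v l k' v' l' : nat) : nat :=
  if k < N then
    let c := if v == N then k else v in
    nat_of_bool [&& k' == k.+1, v' == N, l' == l & v == N]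
    + (if v == N then neg (x c k) else x c k) * nat_of_bool [&& k' == k.+1, v' == N & l == l'.+1]
    + (if v == N then neg (x c v') else x c v') * nat_of_bool [&& k' == k, v' < k & l == l'.+1]
  else nat_of_bool ((k' == k) && (v' == v) && (l' == l)).

Definition clow_natmx s s' :=
  clow_nat (st_k N s) (st_v N s) (st_l N s) (st_k N s') (st_v N s') (st_l N s').

Lemma negP_mod m (a : int) : 0 < q -> (m%:Z = a %[mod q])%Z -> ((neg m)%:Z = - a %[mod q])%Z.
Proof.
move=> hq h; rewrite /neg -subzn ?(ltnW (ltn_pmod _ _)) //; apply/eqP; rewrite eqz_mod_dvd opprK.
rewrite -addrA rpredDl; last first.
  by rewrite -[_ \in _]/((q%:Z %| q%:Z)%Z) dvdzz.
have : (a == m %[mod q])%Z by apply/eqP.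
rewrite eqz_mod_dvd => h1; rewrite -modz_nat addrC.
rewrite -[_ \in _]eqz_mod_dvd modz_mod; exact/eqP.
Qed.

Lemma clow_natP (a : nat -> nat -> int) : 0 < q ->
  (forall i j, i < N -> j < N -> ((x i j)%:Z = a i j %[mod q])%Z) ->
  forall s s', ((clow_natmx s s')%:Z = clow_mx a N s s' %[mod q])%Z.
Proof.
move=> hq h s s'; rewrite /clow_natmx /clow_mx /clow_nat /clow_edge.
have hv : st_v N s <= N by rewrite -ltnS ltn_pmod.
have hv' : st_v N s' <= N by rewrite -ltnS ltn_pmod.
move: (st_k N s) (st_v N s) (st_l N s) (st_k N s') (st_v N s') (st_l N s') hv hv'.
move=> k v l k' v' l' hv hv'; case: ltnP => hk; last by rewrite natz.
have addm (u1 u2 : nat) (b1 b2 : int) : (u1%:Z = b1 %[mod q])%Z -> (u2%:Z = b2 %[mod q])%Z ->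
    ((u1 + u2)%:Z = (b1 + b2)%R %[mod q])%Z.
  by move=> h1 h2; rewrite PoszD -modzDm h1 h2 modzDm.
have mulb (u : nat) (b : int) (t : bool) : (t -> (u%:Z = b %[mod q])%Z) ->
    ((u * nat_of_bool t)%:Z = b *+ t %[mod q])%Z.
  by case: t => h1; rewrite ?muln1 ?muln0 ?h1.
have hc : (if v == N then k else v) < N by case: eqP => // hne; lia.
have sgn i j : i < N -> j < N ->
    ((if v == N then neg (x i j) else x i j)%:Z = ((if v == N then -1 else 1) * a i j)%R %[mod q])%Z.
  by move=> hi hj; case: ifP => _; rewrite ?mulN1r ?mul1r; [apply: negP_mod => //|]; apply: h.
apply: (addm); last by apply: (mulb) => /and3P[_ hlt _]; apply: (sgn) => //; lia.
apply: (addm); last by apply: (mulb) => _; exact: (sgn).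
by rewrite natz.
Qed.
End ClowNat.

Lemma bitlen_gt x : 0 < x -> x < 2 ^ bitlen x.
Proof.
move=> hx; have /andP[h1 h2] := trunc_log_bounds (ltnSn 1) hx.
by rewrite (bitlen_bounds h2) //; rewrite expnS; lia.
Qed.

Lemma bitlen_le x n : x < 2 ^ n -> bitlen x <= n.
Proof.
case: (posnP x) => [-> _|hx h]; first by rewrite /bitlen big_ord0.
have /andP[h1 h2] := trunc_log_bounds (ltnSn 1) hx.
rewrite (bitlen_bounds h2); last by rewrite expnS; lia.
by rewrite -(ltn_exp2l _ _ (ltnSn 1)); apply: leq_ltn_trans h.
Qed.

Lemma LS_clow_natmx k (N q : seq nat -> nat) (x : nat -> nat -> seq nat -> nat) s t :
  LS k N -> LS k q -> LS k s -> LS k t ->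
  (forall i j, LS k i -> LS k j -> LS k (fun e => x (i e) (j e) e)) ->
  LS k (fun e => clow_natmx (N e) (q e) (fun i j => x i j e) (s e) (t e)).
Proof.
move=> hN hq hs ht hx.
have hk := LS_div (LS_div hs (LS_S hN)) (LS_S hN); have hk' := LS_div (LS_div ht (LS_S hN)) (LS_S hN).
have hv := LS_mod (LS_div hs (LS_S hN)) (LS_S hN); have hv' := LS_mod (LS_div ht (LS_S hN)) (LS_S hN).
have hl := LS_mod hs (LS_S hN); have hl' := LS_mod ht (LS_S hN).
have bv := LS_eqn hv hN; have hc := LS_if bv hk hv.
have hneg y : LS k y -> LS k (fun e => neg (q e) (y e)) by move=> hy; apply: LS_sub hq (LS_mod hy hq).
have h1 := hx _ _ hc hk; have h2 := hx _ _ hc hv'.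
have b1 := LS_eqn hk' (LS_S hk); have b2 := LS_eqn hv' hN; have b3 := LS_eqn hl (LS_S hl').
have hbody := LS_add (LS_add (LS_and b1 (LS_and b2 (LS_and (LS_eqn hl' hl) bv)))
   (LS_mul (LS_if bv (hneg _ h1) h1) (LS_and b1 (LS_and b2 b3))))
   (LS_mul (LS_if bv (hneg _ h2) h2) (LS_and (LS_eqn hk' hk) (LS_and (LS_ltn hv' hk) b3))).
apply: LS_ext (LS_if (LS_ltn hk hN) hbody
  (LS_and (LS_and (LS_eqn hk' hk) (LS_eqn hv' hv)) (LS_eqn hl' hl))) => e _.
by [].
Qed.

(** All moduli up to twice the exponent of [det_bound] are tried, prime or not, and the
    representative of an entry may depend on the modulus. The bound on [C] is that of [LS_sqpow] for
    [(N + 1) ^ 3] states and [bitlen N + 1] squarings. *)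
Theorem LS_singular k (a : nat -> nat -> nat -> seq nat -> nat) (N C : seq nat -> nat) (K : nat) :
  LS k.+3 (fun e => a (nth 0 e 0) (nth 0 e 1) (nth 0 e 2) (drop 3 e)) ->
  LS k N -> LS k C ->
  exists2 P, LSb k P & forall e (A : nat -> nat -> int), size e = k ->
    (forall q i j, 0 < q -> i < N e -> j < N e -> ((a q i j e)%:Z = A i j %[mod q])%Z) ->
    0 < K -> (forall i j, absz (A i j) <= K) -> 0 < N e ->
    ((N e).+1 ^ 3 + 2 * (N e * (N e * K) + 1) + 2) ^ (bitlen (N e) + 2) <= C e ->
    P e = ((\det (\matrix_(i < N e, j < N e) A i j))%R == 0%R).
Proof.
move=> ha hN hC.
pose Q e := 2 * (N e * (N e * K) + 1).
have hQ : LS k Q.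
  by apply: LS_mul (LS_const _ 2) (LS_add (LS_mul hN (LS_mul hN (LS_const _ K))) (LS_const _ 1)).
have hNb := LS_behead hN.
pose w (s t : nat) (e : seq nat) := clow_natmx (N (behead e)) (nth 0 e 0).+1
   (fun i j => a (nth 0 e 0).+1 i j (behead e)) s t.
have hw : LS k.+3 (fun e => w (nth 0 e 0) (nth 0 e 1) (behead (behead e))).
  apply: (@LS_clow_natmx k.+3 (fun e => N (behead (behead (behead e)))) _
     (fun i j e => a (nth 0 (behead (behead e)) 0).+1 i j (behead (behead (behead e))))).
  - exact: (LS_behead (LS_behead (LS_behead hN))).
  - exact: (LS_behead (LS_behead (LS_S (LS_var _ 0)))).
  - exact: LS_var.
  - exact: LS_var.
  move=> i j hi hj; have hq : LS k.+3 (fun e => (nth 0 (behead (behead e)) 0).+1).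
    exact: (LS_behead (LS_behead (LS_S (LS_var _ 0)))).
  apply: LS_ext (LS_comp ha (LSv_cons hq (LSv_cons hi (LSv_cons hj (LS_vars k.+3 k 3))))) => e he /=.
  rewrite drop0; congr (a _ _ _ _); apply: (@eq_from_nth _ 0).
    by rewrite size_map size_iota !size_behead he.
  by rewrite size_map size_iota => m hm; rewrite (nth_map 0) ?size_iota // nth_iota // !nth_behead.
have hS := LS_S hN.
have hZ := LS_mul hS (LS_mul hS hS).
have hl := LS_add (LS_bitlen hN) (LS_const k 1).
have hs := LS_add (LS_mul hN hS) hN.
have ht := LS_add (LS_mul (LS_add (LS_mul hN hS) hN) hS) (LS_const k 0).
have [R hR Rok] := @LS_sqpow k.+1 w (fun e => (nth 0 e 0).+1) _ _ _ _ _ hw (LS_S (LS_var _ _))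
   (LS_behead hZ) (LS_behead hl) (LS_behead hC) (LS_behead hs) (LS_behead ht).
exists (fun e => [forall i : 'I_(Q e), R (val i :: e) == 0]).
  apply: (LS_all (p := fun i e => R (i :: e) == 0) hQ).
  by apply: LS_ext (LS_eqn hR (LS_const _ 0)) => -[|x e].
move=> e A he haA hK hA hN0 hCb; set n := N e in haA hN0 hCb *.
set M := (\matrix_(i, j) A i j)%R.
(* The clow count yields the determinant of the opposite matrix; the sign has no effect on
   divisibility. *)
have detN : (\det (\matrix_(i < n, j < n) - A i j) = (-1) ^+ n * \det M)%R.
  by rewrite -detZ; congr (\det _)%R; apply/matrixP => i j; rewrite !mxE mulN1r.
have hdvd (i : 'I_(Q e)) : (R (val i :: e) == 0) = ((val i).+1%:Z %| (\det M)%R)%Z.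
  set q := (val i).+1; have hq : q <= Q e by exact: ltn_ord.
  have h1 : enc n 0 n n < n.+1 * (n.+1 * n.+1) by apply: enc_lt.
  have h2 : enc n n n 0 < n.+1 * (n.+1 * n.+1) by apply: enc_lt.
  rewrite Rok /= ?he //=; last first.
  - apply: leq_trans hCb; rewrite -/n -addnS leq_exp2r ?addn2 //.
    by rewrite !expnS expn0 muln1 !ltnS leq_add2l; exact: hq.
  (* The exponent is at least [2 * n], because [n < 2 ^ bitlen n]. *)
  have hmp := clow_path A (N := n) (T := 2 ^ (bitlen n + 1)).
  have hsq := @sqpow_matpow (clow_mx A n) (n.+1 * (n.+1 * n.+1)) (fun s t => w s t (val i :: e)) q
     (bitlen n + 1) _ _ h1 h2.
  rewrite hmp in hsq; last by rewrite addn1 expnS leq_mul2l /= ltnW // bitlen_gt.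
  have {}hsq := hsq (fun x y _ _ => clow_natP (ltn0Sn _) (fun i' j' hi hj => haA q i' j' isT hi hj) x y).
  rewrite detN in hsq; rewrite -/n.
  set sq := sqpow _ _ _ _ _ _ in hsq *; rewrite -/sq.
  have hlt : sq < q by apply: sqpow_lt.
  have -> : (sq == 0) = (q%:Z %| sq%:Z)%Z by rewrite dvdzE /= /dvdn modn_small.
  have -> : (q%:Z %| sq%:Z)%Z = (q%:Z %| ((-1) ^+ n * \det M)%R)%Z.
    by apply/dvdz_mod0P/dvdz_mod0P; rewrite hsq.
  by rewrite !dvdzE abszM abszX exp1n mul1n.
rewrite /=; apply/forallP/eqP => [h|h0 i]; last by rewrite hdvd h0 dvdz0.
have hb : absz (\det M)%R < 2 ^ (n * (n * K) + 1).
  by apply: det_bound hK _ => i j; rewrite mxE.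
apply: (int_dvd_all_eq0 hb); first by rewrite addn1.
move=> q /andP[hq0 hq]; have hq' : q.-1 < Q e by rewrite /Q -/n; lia.
by have := h (Ordinal hq'); rewrite hdvd /= prednK.
Qed.

(** * Rational matrices in place of algebraic numbers *)

Local Open Scope ring_scope.

Section RationalRep.
Variable C : numFieldType.

(* [c] is a common eigenvector of rational matrices [rho a] with eigenvalues [a]. *)
Definition rat_rep (al : seq C) (I : finType) (c : I -> C) (rho : C -> I -> I -> rat) : Prop :=
  (exists i, c i != 0) /\
  forall a, a \in al -> forall i, \sum_j ratr (rho a i j) * c j = a * c i.

(** Each number [a] in turn contributes the companion matrix of a polynomial annihilating it, with
    eigenvector the powers of [a]. The new eigenvector is a tensor product: this matrix acts on one
    factor and the earlier ones on the other. *)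
Lemma rat_rep_exists (al : seq C) :
  (forall a, a \in al -> exists p : {poly rat}, p != 0 /\ root (map_poly (@ratr C) p) a) ->
  exists I c rho, @rat_rep al I c rho.
Proof.
elim: al => [|a al IH] h.
  exists unit, (fun=> 1), (fun _ _ _ => 0); split=> //; exists tt; exact: oner_neq0.
have [|I [c [rho [[i0 hi0] hrho]]]] := IH.
  by move=> x hx; apply: h; rewrite inE hx orbT.
have [p [p0 pa]] := h a (mem_head _ _).
have [e he] : exists e, size p = e.+2.
  case E: (size p) => [|[|e]]; [| |by exists e].
    by move/eqP: E; rewrite size_poly_eq0 (negbTE p0).
  have /size_poly1P[k k0 ek] : size p == 1%N by rewrite E.
  by move: pa; rewrite ek map_polyC /= rootC fmorph_eq0 (negbTE k0).
pose comp (j j' : nat) : rat := if (j < e)%N then (j' == j.+1)%:R else - (p`_j' / p`_e.+1).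
have lead0 : p`_e.+1 != 0 by rewrite -[e.+1]/(e.+2.-1) -he -lead_coefE lead_coef_eq0.
have hcomp j : (j <= e)%N -> \sum_(j' < e.+1) ratr (comp j j') * a ^+ j' = a ^+ j.+1.
  rewrite /comp; case: ltnP => hj hje.
    rewrite (bigD1 (Ordinal (hj : (j.+1 < e.+1)%N))) //= eqxx rmorph1 mul1r big1 ?addr0 // => i hi.
    rewrite (_ : (i == j.+1 :> nat) = false) ?rmorph0 ?mul0r //.
    by apply/negbTE; move: hi; rewrite -val_eqE.
  have -> : j = e by lia.
  have := rootP pa; rewrite horner_coef size_map_poly he big_ord_recr /= => hroot.
  have lead0C : ratr p`_e.+1 != 0 :> C by rewrite fmorph_eq0.
  apply: (mulfI lead0C); move/eqP: hroot; rewrite addrC addr_eq0 coef_map /= => /eqP ->.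
  rewrite mulr_sumr -sumrN; apply: eq_bigr => i _.
  rewrite coef_map /= rmorphN fmorph_div /=; field.
  exact: lead0C.
exists ('I_e.+1 * I)%type, (fun ji : 'I_e.+1 * I => a ^+ ji.1 * c ji.2),
  (fun x (ji ji' : 'I_e.+1 * I) => if x == a then comp ji.1 ji'.1 *+ (ji.2 == ji'.2)
                   else rho x ji.2 ji'.2 *+ (ji.1 == ji'.1)).
split; first by exists (ord0, i0); rewrite /= expr0 mul1r.
move=> x hx [j i] /=.
pose F (j' : 'I_e.+1) (i' : I) : C := ratr (if x == a then comp j j' *+ (i == i')
      else rho x i i' *+ (j == j')) * (a ^+ j' * c i').
transitivity (\sum_j' \sum_i' F j' i'); first by rewrite pair_big.
rewrite /F {F}.
move: hx; rewrite inE; case: eqP => [-> _|_ /= hx].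
  rewrite mulrA -exprS -hcomp ?mulr_suml -1?ltnS //; apply: eq_bigr => j' _.
  rewrite (bigD1 i) //= eqxx mulr1n big1 ?addr0 ?mulrA // => i' hi'.
  by rewrite eq_sym (negbTE hi') mulr0n rmorph0 mul0r.
rewrite (bigD1 j) //= [X in _ + X]big1 ?addr0 => [|j' hj'].
  rewrite mulrCA -hrho // mulr_sumr; apply: eq_bigr => i' _.
  by rewrite eqxx mulr1n mulrCA.
by rewrite big1 // => i' _; rewrite eq_sym (negbTE hj') mulr0n rmorph0 mul0r.
Qed.

Definition rat_indep n (c : 'I_n -> C) : Prop :=
  forall u : 'I_n -> rat, \sum_j ratr (u j) * c j = 0 -> forall j, u j = 0.

Lemma rat_rep_ord al I c rho : @rat_rep al I c rho ->
  exists c' rho', @rat_rep al 'I_#|I| c' rho'.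
Proof.
move=> [[i hi] h]; exists (fun i => c (enum_val i)), (fun a i j => rho a (enum_val i) (enum_val j)).
split; first by exists (enum_rank i); rewrite enum_rankK.
move=> a ha j; rewrite -h // [RHS](@big_enum_val _ _ _ I (mem I)) /=; apply: eq_bigr => l _.
by [].
Qed.

(* A rational relation between the coordinates of [c] eliminates one of them. *)
Lemma rat_rep_indep al n c rho : @rat_rep al 'I_n c rho ->
  exists m c' rho', @rat_rep al 'I_m c' rho' /\ rat_indep c'.
Proof.
elim: n c rho => [|n IH] c rho [[i hi] hrho]; first by case: i hi.
case: (classic (rat_indep c)) => hind; first by exists n.+1, c, rho; split=> //; split=> //; exists i.
have [u [hu [i0 hi0]]] : exists u : 'I_n.+1 -> rat, \sum_j ratr (u j) * c j = 0 /\ exists i0, u i0 != 0.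
  apply: NNPP => h; apply: hind => u hu j; apply/eqP/negPn/negP => hj.
  by apply: h; exists u; split=> //; exists j.
pose t j := - (u j / u i0).
have u0C : ratr (u i0) != 0 :> C by rewrite fmorph_eq0.
have hc0 : c i0 = \sum_j ratr (t (lift i0 j)) * c (lift i0 j).
  apply: (mulfI u0C); move: hu; rewrite (bigD1_ord i0) //= => /eqP; rewrite addr_eq0 => /eqP ->.
  rewrite mulr_sumr -sumrN; apply: eq_bigr => j _.
  by rewrite /t rmorphN fmorph_div /=; field.
apply: (IH (fun j => c (lift i0 j)) (fun a j l => rho a (lift i0 j) (lift i0 l) + rho a (lift i0 j) i0 * t (lift i0 l))).
split.
  (* If all remaining coordinates vanished, so would [c i0], which is a combination of them. *)
  apply: NNPP => h; have hz j : c (lift i0 j) = 0 by apply/eqP/negPn/negP => hj; apply: h; exists j.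
  move: hi; case: (unliftP i0 i) => [j ->|->]; first by rewrite hz eqxx.
  by rewrite hc0 big1 ?eqxx // => j _; rewrite hz mulr0.
move=> a ha j; rewrite -hrho // [RHS](bigD1_ord i0) //= hc0 mulr_sumr addrC -big_split /=.
by apply: eq_bigr => l _; rewrite rmorphD rmorphM mulrDl mulrA.
Qed.

Lemma common_denominator (s : seq rat) : exists2 D : nat, (0 < D)%N &
  forall r, r \in s -> exists z : int, D%:R * r = z%:~R.
Proof.
elim: s => [|r s [D hD h]]; first by exists 1%N.
exists (D * absz (denq r))%N; first by rewrite muln_gt0 hD absz_gt0 denq_eq0.
have hd : (absz (denq r))%:R * r = (numq r)%:~R :> rat.
  rewrite -[X in _ * X]divq_num_den -[(absz _)%:R]/((absz (denq r))%:~R) absz_denq mulrCA mulfV ?mulr1 //.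
  by rewrite intr_eq0 denq_eq0.
move=> x; rewrite inE => /orP[/eqP ->|hx].
  by exists (D%:Z * numq r); rewrite natrM -mulrA hd intrM.
have [z hz] := h x hx; exists ((absz (denq r))%:Z * z).
by rewrite mulnC natrM -mulrA hz intrM.
Qed.

Theorem int_rep_exists (al : seq C) :
  (forall a, a \in al -> exists p : {poly rat}, p != 0 /\ root (map_poly (@ratr C) p) a) ->
  exists n (c : 'I_n -> C) (D : nat) (rho : C -> 'I_n -> 'I_n -> int),
  [/\ (0 < n)%N, (0 < D)%N, rat_indep c &
     forall a, a \in al -> forall i, \sum_j (rho a i j)%:~R * c j = D%:R * (a * c i)].
Proof.
move=> h; have [I [c0 [rho0 h0]]] := rat_rep_exists h.
have [c1 [rho1 h1]] := rat_rep_ord h0.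
have [n [c [rho [[[i0 hi0] hrho] hind]]]] := rat_rep_indep h1.
have [D hD hden] := common_denominator
  [seq rho p.1 p.2.1 p.2.2 | p <- [seq (a, ij) | a <- al, ij <- enum {: 'I_n * 'I_n}]].
exists n, c, D, (fun a i j => numq (D%:R * rho a i j)); split=> //.
  by apply: leq_ltn_trans (ltn_ord i0).
move=> a ha i; rewrite -hrho // mulr_sumr; apply: eq_bigr => j _; rewrite mulrA; congr (_ * _).
have [|z hz] := hden (rho a i j).
  apply/mapP; exists (a, (i, j)) => //; apply/allpairsP; exists (a, (i, j)); split=> //.
  by rewrite mem_enum.
by rewrite hz numq_int -(ratr_int C z) -hz rmorphM rmorph_nat.
Qed.
End RationalRep.

Local Close Scope ring_scope.

(** * Fixed vectors of products and block-cyclic matrices *)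

Local Open Scope ring_scope.

Section Cyclic.
Variables (C : numFieldType) (L n d D : nat).
Variables (c : nat -> C) (X : nat -> nat -> nat -> C) (r : nat -> nat -> nat -> nat -> nat -> int).
Hypotheses (L0 : (0 < L)%N) (n0 : (0 < n)%N) (d0 : (0 < d)%N) (D0 : (0 < D)%N).
Hypothesis rP : forall t y x s, (t < L)%N -> (y < n)%N -> (x < n)%N -> (s < d)%N ->
  \sum_(s' < d) (r t y x s s')%:~R * c s' = D%:R * (X t y x * c s).
Hypothesis c_indep : forall u : nat -> rat, \sum_(s < d) ratr (u s) * c s = 0 ->
  forall s, (s < d)%N -> u s = 0.

Notation N := (L * n * d)%N.
Definition idx t y s := ((t * n + y) * d + s)%N.
Definition ix_t i := (i %/ d %/ n)%N.
Definition ix_y i := (i %/ d %% n)%N.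
Definition ix_s i := (i %% d)%N.

(* A vector indexed by (t, y, s) is killed iff its block t.+1 (cyclically) is
   the image of its block t under the matrix X t. *)
Definition cyc_mx (i j : nat) : int :=
  D%:Z *+ (i == j) - r (ix_t j) (ix_y i) (ix_y j) (ix_s i) (ix_s j) *+ (ix_t i == (ix_t j).+1 %% L)%N.

Lemma cyc_entry (F : numFieldType) i j : (cyc_mx i j)%:~R =
  D%:R *+ (i == j) - (r (ix_t j) (ix_y i) (ix_y j) (ix_s i) (ix_s j))%:~R
    *+ (ix_t i == (ix_t j).+1 %% L)%N :> F.
Proof. by rewrite /cyc_mx rmorphB /=; do 2 case: (_ == _). Qed.

Lemma idxK t y s : (y < n)%N -> (s < d)%N ->
  [/\ ix_t (idx t y s) = t, ix_y (idx t y s) = y & ix_s (idx t y s) = s].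
Proof.
move=> hy hs; rewrite /ix_t /ix_y /ix_s /idx divnMDl // (divn_small hs) addn0.
by rewrite divnMDl // (divn_small hy) addn0 !modnMDl !modn_small.
Qed.

Lemma ix_lt i : (i < N)%N -> [/\ (ix_t i < L)%N, (ix_y i < n)%N & (ix_s i < d)%N].
Proof.
by move=> hi; rewrite /ix_t /ix_y /ix_s !ltn_pmod //; split=> //; rewrite !ltn_divLR.
Qed.

Lemma idx_lt t y s : (t < L)%N -> (y < n)%N -> (s < d)%N -> (idx t y s < N)%N.
Proof.
move=> ht hy hs; rewrite /idx.
have h1 : (t.+1 * n <= L * n)%N by rewrite leq_mul2r ht orbT.
have h2 : ((t * n + y).+1 * d <= L * n * d)%N.
  by rewrite leq_mul2r; apply/orP; right; apply: leq_trans h1; rewrite mulSn; lia.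
by apply: leq_trans h2; rewrite mulSn; lia.
Qed.

Lemma idxE i : idx (ix_t i) (ix_y i) (ix_s i) = i.
Proof. by rewrite /idx /ix_t /ix_y /ix_s -!divn_eq. Qed.

Lemma sum_idx (V : nmodType) (F : nat -> V) :
  \sum_(i < N) F i = \sum_(t < L) \sum_(y < n) \sum_(s < d) F (idx t y s).
Proof.
rewrite (sum_mul _ _ F) (sum_mul _ _ (fun i => \sum_(j < d) F (i * d + j)%N)).
by [].
Qed.

Definition prv t := ((t + L.-1) %% L)%N.

Lemma prvP t t' : (t < L)%N -> (t' < L)%N -> (t' == t.+1 %% L)%N = (t == prv t').
Proof.
move=> ht ht'; rewrite /prv; apply/eqP/eqP => ->.
  case: (ltnP t.+1 L) => h; first by rewrite (modn_small h) (_ : t.+1 + L.-1 = t + L)%N ?modnDr ?modn_small //; lia.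
  have -> : t.+1 = L by lia.
  by rewrite modnn add0n modn_small; lia.
case: t' ht' => [|t'] ht'; first by rewrite add0n (modn_small (m := L.-1)) ?prednK ?modnn //; lia.
have -> : (t'.+1 + L.-1 = t' + L)%N by lia.
by rewrite modnDr (modn_small (m := t')) ?modn_small //; lia.
Qed.

(** Singularity of an integer matrix does not depend on the field, so null vectors can be taken over
    the complex numbers in one direction and over the rationals in the other. *)
Lemma det_int_eq0 (F : numFieldType) m (A : 'M[int]_m) :
  (\det A == 0) = (\det (map_mx intr A : 'M[F]_m) == 0).
Proof. by rewrite det_map_mx intr_eq0. Qed.

Definition Acyc : 'M[int]_N := \matrix_(i, j) cyc_mx i j.

(** As [c] is a right eigenvector of the integer blocks, the products [psi t y * c s] form a right
    null vector. *)
Lemma cyc_det_of_fix (psi : nat -> nat -> C) :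
  (forall t y, (t < L)%N -> (y < n)%N -> \sum_(x < n) X t y x * psi t x = psi (t.+1 %% L)%N y) ->
  (exists2 x, (x < n)%N & psi 0%N x != 0) -> \det Acyc = 0.
Proof.
move=> hpsi [x0 hx0 hne]; apply/eqP; rewrite (det_int_eq0 C) -det_tr; apply/det0P.
have [s0 hs0 hc] : exists2 s, (s < d)%N & c s != 0.
  exists 0%N => //; apply/eqP => hc; have := c_indep (u := fun s => (s == 0%N)%:R) _ d0.
  rewrite eqxx => H; have : (1 : rat) = 0; last by move/eqP; rewrite oner_eq0.
  apply: H; rewrite big1 // => s _; case: eqP => [->|_]; last by rewrite rmorph0 mul0r.
  by rewrite hc mulr0.
pose v j := psi (ix_t j) (ix_y j) * c (ix_s j).
exists (\row_(j < N) v j).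
  apply/eqP => /rowP/(_ (Ordinal (idx_lt L0 hx0 hs0))); rewrite !mxE /v /=.
  have [-> -> ->] := idxK 0 hx0 hs0.
  by move/eqP; rewrite mulf_eq0 (negbTE hne) (negbTE hc).
apply/rowP => i; rewrite !mxE; have [hti hyi hsi] := ix_lt (ltn_ord i).
rewrite (eq_bigr (fun j : 'I_N => (fun j => v j * (cyc_mx i j)%:~R) (val j))); last first.
  by move=> j _; rewrite !mxE.
rewrite (eq_bigr (fun j : 'I_N => (fun j => (D%:R * v j)) j *+ (j == i :> nat) +
   - ((fun j => v j * (r (ix_t j) (ix_y i) (ix_y j) (ix_s i) (ix_s j))%:~R *+
       (ix_t i == (ix_t j).+1 %% L)%N) (val j)))); last first.
  move=> j _ /=; rewrite cyc_entry mulrBr -!mulrnAr; congr (_ - _).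
  by rewrite eq_sym; case: (_ == _); rewrite ?mulr0n ?mulr1n ?mulr0 // mulrC.
rewrite big_split /= sumrN (sum_delta N i (fun j => D%:R * v j)) ltn_ord mulr1n.
rewrite (sum_idx (fun j => v j * (r (ix_t j) (ix_y i) (ix_y j) (ix_s i) (ix_s j))%:~R *+
       (ix_t i == (ix_t j).+1 %% L)%N)).
apply/eqP; rewrite subr_eq0; apply/eqP; symmetry.
transitivity (\sum_(t < L) (D%:R * (psi (t.+1 %% L)%N (ix_y i) * c (ix_s i))) *+ (t == prv (ix_t i) :> nat)).
  apply: eq_bigr => t _; rewrite -prvP //.
  transitivity (\sum_(x < n) (psi t x * (D%:R * (X t (ix_y i) x * c (ix_s i)))) *+ (ix_t i == t.+1 %% L)%N).
    apply: eq_bigr => x _; rewrite -rP // mulr_sumr -sumrMnl; apply: eq_bigr => s _.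
    by have [-> -> ->] := idxK t (ltn_ord x) (ltn_ord s); rewrite /v; have [-> -> ->] := idxK t (ltn_ord x) (ltn_ord s); congr (_ *+ _); ring.
  rewrite sumrMnl; congr (_ *+ _); rewrite -hpsi // mulr_suml mulr_sumr.
  by apply: eq_bigr => x _; ring.
rewrite (sum_delta L _ (fun t => D%:R * (psi (t.+1 %% L)%N (ix_y i) * c (ix_s i)))).
have hp : (prv (ix_t i) < L)%N by rewrite /prv ltn_pmod.
by rewrite hp mulr1n /v; congr (_ * (psi _ _ * _)); apply/esym/eqP; rewrite prvP.
Qed.

(** A rational left null vector is contracted with [c] on the right, where the blocks turn into the
    numbers [X t y x]; a right null vector would meet the blocks on the wrong side. This is why the
    cycle obtained consists of row vectors. *)
Lemma cyc_fix_of_det : \det Acyc = 0 -> exists phi : nat -> nat -> C,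
  (forall t x, (t < L)%N -> (x < n)%N -> \sum_(y < n) phi (t.+1 %% L)%N y * X t y x = phi t x) /\
  exists t x, [/\ (t < L)%N, (x < n)%N & phi t x != 0].
Proof.
move=> h; have : \det Acyc == 0 by rewrite h.
rewrite (det_int_eq0 rat) => /det0P[u u0 hu].
pose un i : rat := if insub i is Some i' then u 0 i' else 0.
have unE (i : 'I_N) : un i = u 0 i by rewrite /un valK.
pose phi t x : C := \sum_(s < d) ratr (un (idx t x s)) * c s.
exists phi; split.
- move=> t x ht hx.
  have DC : D%:R != 0 :> C by rewrite pnatr_eq0 -lt0n.
  apply: (mulfI DC).
  have hcol (s : 'I_d) : D%:R * un (idx t x s) =
      \sum_(y < n) \sum_(s' < d) un (idx (t.+1 %% L)%N y s') * (r t y x s' s)%:~R.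
    have hj := idx_lt ht hx (ltn_ord s).
    have := congr1 (fun w : 'rV_N => w 0 (Ordinal hj)) hu; rewrite !mxE.
    rewrite (eq_bigr (fun i : 'I_N => (fun i => (D%:R * un i)) i *+ (i == idx t x s :> nat) +
      - ((fun i => un i * (r t (ix_y i) x (ix_s i) s)%:~R *+ (ix_t i == t.+1 %% L)%N) (val i)))); last first.
      move=> i _ /=; rewrite !mxE -unE /= cyc_entry; have [-> -> ->] := idxK t hx (ltn_ord s).
      rewrite mulrBr -!mulrnAr; congr (_ - _).
      by case: (_ == _); rewrite ?mulr0n ?mulr1n ?mulr0 // mulrC.
    rewrite big_split /= sumrN (sum_delta N _ (fun i => D%:R * un i)) hj mulr1n => /eqP.
    rewrite subr_eq0 => /eqP ->.
    rewrite (sum_idx (fun i => un i * (r t (ix_y i) x (ix_s i) s)%:~R *+ (ix_t i == t.+1 %% L)%N)).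
    transitivity (\sum_(t' < L) (\sum_(y < n) \sum_(s' < d) un (idx t' y s') * (r t y x s' s)%:~R) *+ (t' == (t.+1 %% L)%N :> nat)).
      apply: eq_bigr => t' _; rewrite -sumrMnl; apply: eq_bigr => y _; rewrite -sumrMnl; apply: eq_bigr => s' _.
      by have [-> -> ->] := idxK t' (ltn_ord y) (ltn_ord s').
    rewrite (sum_delta L _ (fun t' => \sum_(y < n) \sum_(s' < d) un (idx t' y s') * (r t y x s' s)%:~R)).
    by rewrite ltn_pmod // mulr1n.
  rewrite [in RHS]/phi [in RHS]mulr_sumr.
  transitivity (\sum_(s < d) ratr (D%:R * un (idx t x s)) * c s); last first.
    by apply: eq_bigr => s _; rewrite rmorphM /= ratr_nat -!mulrA.
  transitivity (\sum_(y < n) \sum_(s' < d) ratr (un (idx (t.+1 %% L)%N y s')) * (D%:R * (X t y x * c s'))).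
    rewrite mulr_sumr; apply: eq_bigr => y _; rewrite /phi mulr_suml mulr_sumr.
    by apply: eq_bigr => s' _; ring.
  transitivity (\sum_(y < n) \sum_(s' < d) \sum_(s < d) ratr (un (idx (t.+1 %% L)%N y s') * (r t y x s' s)%:~R) * c s).
    apply: eq_bigr => y _; apply: eq_bigr => s' _; rewrite -rP // mulr_sumr; apply: eq_bigr => s _.
    by rewrite rmorphM /= ratr_int -!mulrA.
  symmetry; under eq_bigr => s _ do rewrite hcol rmorph_sum mulr_suml.
  rewrite exchange_big; apply: eq_bigr => y _ /=.
  under eq_bigr => s _ do rewrite rmorph_sum mulr_suml.
  by rewrite exchange_big.
- have [i hi] : exists i : 'I_N, u 0 i != 0.
    apply/existsP; apply: contraNT u0 => /existsPn h0; apply/eqP/rowP => i; rewrite mxE.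
    by apply/eqP; have := h0 i; rewrite negbK.
  have [ht hy hs] := ix_lt (ltn_ord i).
  (* Independence of [c]: a vanishing contraction would make the whole rational block vanish. *)
  exists (ix_t i), (ix_y i); split=> //; apply: contraNneq hi => hphi.
  have := c_indep (u := fun s => un (idx (ix_t i) (ix_y i) s)) hphi hs.
  by rewrite idxE unE => ->.
Qed.
End Cyclic.

Local Close Scope ring_scope.

(** * Circuits as products of matrices *)

From mathcomp Require Import complex reals.

Local Open Scope ring_scope.

Section Bits.
Definition dec n (z : nat) : basis n := [ffun k : 'I_n => odd (shr 2 z k)].

Lemma bits_sum n z : (z < 2 ^ n)%N -> z = (\sum_(k < n) odd (shr 2 z k) * 2 ^ k)%N.
Proof.
elim: n z => [|n IH] z hz; first by rewrite big_ord0; move: hz; rewrite expn0; case: z.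
rewrite big_ord_recl /= /shr expn0 divn1 muln1.
have hz2 : (z %/ 2 < 2 ^ n)%N by rewrite ltn_divLR // -expnSr.
rewrite (eq_bigr (fun k : 'I_n => 2 * (odd (shr 2 (z %/ 2) k) * 2 ^ k))%N); last first.
  by move=> k _; rewrite /shr /bump /= add1n expnS divnMA; lia.
by rewrite -big_distrr /= -IH // {1}(divn_eq z 2) modn2; lia.
Qed.

Lemma basis_dec_inj n : injective (fun z : 'I_(2 ^ n) => dec n z).
Proof.
move=> z z' /ffunP h; apply: val_inj; rewrite /= (bits_sum (ltn_ord z)) (bits_sum (ltn_ord z')).
by apply: eq_bigr => k _; have := h k; rewrite !ffunE => ->.
Qed.

Lemma dec_bij n : bijective (fun z : 'I_(2 ^ n) => dec n z).
Proof. by apply: inj_card_bij (@basis_dec_inj n) _; rewrite card_ffun card_bool !card_ord. Qed.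

Lemma sum_dec (V : nmodType) n (F : basis n -> V) :
  \sum_x F x = \sum_(z < 2 ^ n) F (dec n z).
Proof. by rewrite (reindex _ (onW_bij _ (dec_bij n))). Qed.
End Bits.

(** * Adjoints, norms and diagonal projections *)

Section Adjoint.
Variable C : numClosedFieldType.

Definition adjm m n (M : 'M[C]_(m, n)) : 'M[C]_(n, m) := \matrix_(i, j) (M j i)^*.

Definition norm2 m (v : 'cV[C]_m) : C := \sum_i `|v i 0| ^+ 2.

Lemma adjm_mul m n p (A : 'M[C]_(m, n)) (B : 'M[C]_(n, p)) : adjm (A *m B) = adjm B *m adjm A.
Proof.
apply/matrixP => i j; rewrite !mxE rmorph_sum; apply: eq_bigr => k _.
by rewrite !mxE rmorphM mulrC.
Qed.

Lemma adjmK m n (A : 'M[C]_(m, n)) : adjm (adjm A) = A.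
Proof. by apply/matrixP => i j; rewrite !mxE conjCK. Qed.

Lemma norm2E m (v : 'cV[C]_m) : norm2 v = (adjm v *m v) 0 0.
Proof. by rewrite mxE; apply: eq_bigr => i _; rewrite mxE normCK mulrC. Qed.

Lemma norm2_isom m (U : 'M[C]_m) v : adjm U *m U = 1%:M -> norm2 (U *m v) = norm2 v.
Proof. by move=> hU; rewrite !norm2E adjm_mul mulmxA -(mulmxA (adjm v)) hU mulmx1. Qed.

Lemma norm2_ge0 m (v : 'cV[C]_m) : 0 <= norm2 v.
Proof. by apply: sumr_ge0 => i _; rewrite exprn_ge0. Qed.

Lemma norm2_eq0 m (v : 'cV[C]_m) : norm2 v = 0 -> v = 0.
Proof.
move=> h; apply/matrixP => i j; rewrite (ord1 j) mxE; apply/eqP.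
have := psumr_eq0P (fun i _ => exprn_ge0 2 (normr_ge0 (v i 0))) h (i := i) isT.
by move/eqP; rewrite expf_eq0 /= normr_eq0.
Qed.

Definition diagm m (p : pred 'I_m) : 'M[C]_m := \matrix_(i, j) ((i == j) && p i)%:R.

Lemma diagmE m (p : pred 'I_m) v i : (diagm p *m v) i 0 = (v : 'cV_m) i 0 *+ p i.
Proof.
rewrite mxE (bigD1 i) //= big1 ?addr0 => [|j hj]; rewrite mxE ?eqxx /=; first by case: (p i); rewrite ?mul1r ?mul0r.
by rewrite eq_sym (negbTE hj) mul0r.
Qed.

Lemma norm2_diagm m (p : pred 'I_m) v : norm2 (diagm p *m v) = \sum_(i | p i) `|(v : 'cV_m) i 0| ^+ 2.
Proof.
rewrite [RHS]big_mkcond; apply: eq_bigr => i _; rewrite diagmE.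
by case: (p i); rewrite ?mulr1n // mulr0n normr0 expr0n.
Qed.

Lemma norm2_diag_le m (p : pred 'I_m) v : norm2 (diagm p *m v) <= norm2 v.
Proof.
rewrite norm2_diagm /norm2 [X in _ <= X](bigID p) /= lerDl; apply: sumr_ge0 => i _; exact: exprn_ge0.
Qed.

Lemma norm2_diag_eq m (p : pred 'I_m) v : norm2 (diagm p *m v) = norm2 v -> diagm p *m v = v.
Proof.
rewrite norm2_diagm /norm2 [RHS](bigID p) /= -{1}[X in X = _]addr0 => /addrI/esym h.
apply/colP => i; rewrite diagmE; case hp: (p i); rewrite ?mulr1n // mulr0n.
have := psumr_eq0P (fun i _ => exprn_ge0 2 (normr_ge0 (v i 0))) h (i := i); rewrite hp => /(_ isT).
by move/eqP; rewrite expf_eq0 /= normr_eq0 => /eqP ->.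
Qed.
End Adjoint.

(** * Gates as unitary matrices on all qubits *)

Section Gates.
Variable R : realType.
Notation C := R[i].

Definition gate_entry n (G : gate R) (ts : seq nat) (y x : basis n) : C :=
  if [forall i : 'I_n, (nat_of_ord i \notin ts) ==> (y i == x i)]
     then gmat (g := G) [ffun j : 'I_(garity G) => bit y (nth 0%N ts j)]
                 [ffun j : 'I_(garity G) => bit x (nth 0%N ts j)]
     else 0.

Definition gate_mx n (G : gate R) (ts : seq nat) : 'M[C]_(2 ^ n) :=
  \matrix_(y, x) gate_entry G ts (dec n y) (dec n x).

Definition vec n (psi : qstate R n) : 'cV[C]_(2 ^ n) := \col_z psi (dec n z).

Lemma vec_apply n (G : gate R) ts (psi : qstate R n) :
  vec (apply_gate G ts psi) = gate_mx n G ts *m vec psi.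
Proof.
apply/colP => y; rewrite !mxE /apply_gate sum_dec; apply: eq_bigr => x _.
by rewrite !mxE.
Qed.

Lemma bitE n (z : basis n) (i : 'I_n) : bit z i = z i.
Proof. by rewrite /bit valK. Qed.

(** The states that agree with [i] off the targets are parametrised by their local pattern through
    [ext], with inverse [re]; the sum becomes the unitarity relation of the gate. If [i] and [j]
    differ off the targets, every term vanishes. *)
Lemma gate_entry_unitary n (G : gate R) ts (i j : basis n) : unitary_gate G ->
  size ts = garity G -> uniq ts -> all (fun q => (q < n)%N) ts ->
  \sum_k (gate_entry G ts k i)^* * gate_entry G ts k j = (i == j)%:R.
Proof.
move=> hG hs hu ha.
pose out (y x : basis n) := [forall i : 'I_n, (nat_of_ord i \notin ts) ==> (y i == x i)].
pose re (y : basis n) : {ffun 'I_(garity G) -> bool} := 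
    [ffun j : 'I_(garity G) => bit y (nth 0%N ts j)].
pose ext (k : {ffun 'I_(garity G) -> bool}) : basis n :=
  [ffun q => if insub (index (val q) ts) is Some l then k l else i q].
have outE (y x : basis n) : reflect (forall q : 'I_n, nat_of_ord q \notin ts -> y q = x q) (out y x).
  by apply: (iffP forallP) => h q; [move=> hq; apply/eqP; apply: (implyP (h q))|apply/implyP => /h ->].
have ext_in k (l : 'I_(garity G)) : bit (ext k) (nth 0%N ts l) = k l.
  have hl : (l < size ts)%N by rewrite hs.
  have hq : (nth 0 ts l < n)%N by apply: (allP ha); apply: mem_nth.
  by rewrite (bitE _ (Ordinal hq)) ffunE /= index_uniq // valK.
have ext_out k : out (ext k) i.
  apply/outE => q hq; rewrite ffunE insubF //; apply/negbTE; rewrite -leqNgt -hs.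
  by rewrite leqNgt index_mem.
have re_ext k : re (ext k) = k by apply/ffunP => l; rewrite ffunE ext_in.
have ext_re y : out y i -> ext (re y) = y.
  move/outE => h; apply/ffunP => q; rewrite ffunE; case: insubP => [l hl el|].
    rewrite ffunE -[RHS]bitE el nth_index //.
    by rewrite -index_mem hs.
  by rewrite -hs index_mem => /h.
have -> : \sum_k (gate_entry G ts k i)^* * gate_entry G ts k j =
  \sum_(k | out k i) (gmat (g := G) (re k) (re i))^* * gate_entry G ts k j.
  rewrite [RHS]big_mkcond; apply: eq_bigr => k _; rewrite {1}/gate_entry -/(out k i).
  by case: (out k i); rewrite // rmorph0 mul0r.
rewrite (reindex_onto ext re) => [|k hk]; last exact: ext_re.
rewrite (eq_bigl xpredT) => [|k]; last by rewrite ext_out re_ext eqxx.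
case hij : (out i j); last first.
  rewrite big1 => [|k _].
    by case: eqP hij => // ->; have -> : out j j by apply/outE.
  rewrite /gate_entry -/(out _ j) (_ : out (ext k) j = false) ?mulr0 //.
  apply/negbTE; apply: contraFN hij => /outE h; apply/outE => q hq.
  by rewrite -(h q hq); have /outE -> := ext_out k.
rewrite (eq_bigr (fun k => (gmat (g := G) k (re i))^* * gmat (g := G) k (re j))) => [|k _].
  rewrite hG; suff -> : (re i == re j) = (i == j) by [].
  apply/eqP/eqP => [h|-> //].
  rewrite -(ext_re i); last by apply/outE.
  rewrite h; apply/ffunP => q; rewrite ffunE; case: insubP => [l hl el|].
    rewrite ffunE -[RHS]bitE el nth_index //.
    by rewrite -index_mem hs.
  by rewrite -hs index_mem => hq; move/outE: hij => ->.
rewrite re_ext /gate_entry -/(out _ j) -/(re _) re_ext -/(re j) (_ : out (ext k) j = true) //.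
apply/outE => q hq; have /outE -> // := ext_out k; by move/outE: hij => ->.
Qed.

Lemma gate_mx_unitary n (G : gate R) ts : unitary_gate G ->
  size ts = garity G -> uniq ts -> all (fun q => (q < n)%N) ts ->
  adjm (gate_mx n G ts) *m gate_mx n G ts = 1%:M.
Proof.
move=> hG hs hu ha; apply/matrixP => i j; rewrite !mxE.
rewrite (eq_bigr (fun k : 'I_(2 ^ n) => (gate_entry G ts (dec n k) (dec n i))^* * gate_entry G ts (dec n k) (dec n j))); last first.
  by move=> k _; rewrite !mxE.
rewrite -(sum_dec (fun k => (gate_entry G ts k (dec n i))^* * gate_entry G ts k (dec n j))).
by rewrite gate_entry_unitary // (inj_eq (@basis_dec_inj n)).
Qed.
End Gates.

(** * Acceptance with certainty as a fixed vector *)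

Section Circuit.
Variables (R : realType) (gs : seq (gate R)).
Notation C := R[i].
Hypothesis gsU : forall k, (k < size gs)%N -> unitary_gate (nth (id_gate R) gs k).

Variable d : desc.
Hypothesis dV : valid_desc gs d.
Notation m := d.1.1.
Notation n := d.1.2.
Notation cs := d.2.
Notation T := (size cs).

Definition cgate t := nth (id_gate R) gs (nth (0%N, [::]) cs t).1.
Definition ctargets t := (nth (0%N, [::]) cs t).2.
Definition ancilla0 (y : basis n) := [forall i : 'I_n, (m <= i)%N ==> ~~ y i].

(* Factor t of P_W U^* Pi U, counted from the right: Pi projects on outcome 1
   of qubit 0 and P_W on the states whose ancillas are 0. *)
Definition factor_entry t (y x : basis n) : C :=
  if (t < T)%N then gate_entry (cgate t) (ctargets t) y x
  else if t == T then ((y == x) && bit y 0)%:R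
  else if (t <= T + T)%N then (gate_entry (cgate (T + T - t)) (ctargets (T + T - t)) x y)^*
  else ((y == x) && ancilla0 y)%:R.

Definition factor t : 'M[C]_(2 ^ n) := \matrix_(y, x) factor_entry t (dec n y) (dec n x).

Fixpoint prodf t : 'M[C]_(2 ^ n) :=
  if t is t'.+1 then factor t' *m prodf t' else 1%:M.

Lemma desc_gate t : (t < T)%N -> [/\ ((nth (0%N, [::]) cs t).1 < size gs)%N,
  size (ctargets t) = garity (cgate t), uniq (ctargets t) & all (fun q => (q < n)%N) (ctargets t)].
Proof.
move=> ht; move: dV; rewrite /ctargets /cgate /valid_desc; case: d ht => [[m' n'] cs'] /= ht /and3P[_ _].
by move/(all_nthP (0%N, [::]))/(_ t ht) => /and4P[h1 /eqP h2 h3 h4].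
Qed.

Lemma factor_gate t : (t < T)%N -> factor t = gate_mx n (cgate t) (ctargets t).
Proof. by move=> ht; apply/matrixP => y x; rewrite !mxE /factor_entry ht. Qed.

Lemma factor_gate_unitary t : (t < T)%N -> adjm (factor t) *m factor t = 1%:M.
Proof.
move=> ht; rewrite factor_gate //; have [h1 h2 h3 h4] := desc_gate ht.
by apply: gate_mx_unitary => //; apply: gsU.
Qed.

Lemma factor_adj t : (t < T)%N -> factor (T + T - t)%N = adjm (factor t).
Proof.
move=> ht; rewrite (factor_gate ht); apply/matrixP => y x; rewrite !mxE /factor_entry.
have -> : (T + T - t < T)%N = false by lia.
have -> : (T + T - t == T)%N = false by lia.
by rewrite leq_subr; have -> : (T + T - (T + T - t))%N = t by lia.
Qed.

Lemma prodf_unitary t : (t <= T)%N -> adjm (prodf t) *m prodf t = 1%:M.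
Proof.
elim: t => [|t IH] ht /=.
  by apply/matrixP => i j; rewrite mulmx1 !mxE eq_sym; case: (_ == _); rewrite ?conjC1 ?conjC0.
by rewrite adjm_mul -mulmxA (mulmxA (adjm (factor t))) factor_gate_unitary // mul1mx IH // ltnW.
Qed.

(** Partial products of the adjoint circuit: after [t] steps the last [t] gates are undone. *)
Fixpoint back t : 'M[C]_(2 ^ n) :=
  if t is t'.+1 then factor (T + t'.+1)%N *m back t' else 1%:M.

Lemma back_prodf t : (t <= T)%N -> back t *m prodf T = prodf (T - t).
Proof.
elim: t => [|t IH] ht /=; first by rewrite mul1mx subn0.
have e : (T - t)%N = (T - t.+1).+1 by lia.
rewrite -mulmxA IH ?(ltnW ht) // e /= mulmxA.
have -> : (T + t.+1)%N = (T + T - (T - t.+1))%N by lia.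
by rewrite factor_adj ?factor_gate_unitary ?mul1mx //; lia.
Qed.

Lemma back_norm t v : (t <= T)%N -> norm2 (back t *m v) = norm2 v.
Proof.
elim: t => [|t IH] ht /=; first by rewrite mul1mx.
rewrite -mulmxA norm2_isom ?IH ?(ltnW ht) //.
have -> : (T + t.+1)%N = (T + T - (T - t.+1))%N by lia.
have hlt : (T - t.+1 < T)%N by lia.
by rewrite factor_adj // adjmK; apply: mulmx1C; apply: factor_gate_unitary.
Qed.

Definition Pi : 'M[C]_(2 ^ n) := diagm C (fun z => bit (dec n z) 0).
Definition PW : 'M[C]_(2 ^ n) := diagm C (fun z => ancilla0 (dec n z)).

Lemma factor_Pi : factor T = Pi.
Proof.
by apply/matrixP => y x; rewrite !mxE /factor_entry ltnn eqxx (inj_eq (@basis_dec_inj n)).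
Qed.

Lemma factor_PW : factor (T + T).+1 = PW.
Proof.
apply/matrixP => y x; rewrite !mxE /factor_entry ltnn (inj_eq (@basis_dec_inj n)).
have -> : ((T + T).+1 < T)%N = false by lia.
by have -> : ((T + T).+1 == T)%N = false by lia.
Qed.

Lemma prodf_total : prodf (T + T).+2 = PW *m (back T *m (Pi *m prodf T)).
Proof.
have h t : prodf (T + t).+1 = back t *m (Pi *m prodf T).
  elim: t => [|t IH]; first by rewrite addn0 mul1mx /= factor_Pi.
  by rewrite addnS [LHS]/= -/(prodf (T + t).+1) IH /= mulmxA addnS.
by rewrite [LHS]/= -/(prodf (T + T).+1) h factor_PW.
Qed.

Lemma run_vec (psi : qstate R n) : vec (run_circuit gs cs psi) = prodf T *m vec psi.
Proof.
have h t : (t <= T)%N -> vec (run_circuit gs (take t cs) psi) = prodf t *m vec psi.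
  elim: t => [|t IH] ht; first by rewrite take0 mul1mx.
  rewrite (take_nth (0%N, [::]) ht) /run_circuit foldl_rcons -/(run_circuit _ _ _).
  by rewrite vec_apply IH ?(ltnW ht) // [prodf t.+1]/= factor_gate // mulmxA.
by rewrite -h // take_size.
Qed.

Lemma norm2_vec (psi : qstate R n) : norm2 (vec psi) = \sum_z `|psi z| ^+ 2.
Proof. by rewrite sum_dec; apply: eq_bigr => z _; rewrite mxE. Qed.

Lemma accept_prob_vec (psi : qstate R n) :
  accept_prob gs psi = norm2 (Pi *m (prodf T *m vec psi)).
Proof.
rewrite /accept_prob norm2_diagm big_mkcond sum_dec [RHS]big_mkcond; apply: eq_bigr => z _ /=.
by rewrite -run_vec mxE.
Qed.

Lemma witness_fixed (psi : qstate R n) :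
  (forall z : basis n, [exists i : 'I_n, (m <= i)%N && z i] -> psi z = 0) ->
  PW *m vec psi = vec psi.
Proof.
move=> h; apply/colP => z; rewrite diagmE mxE.
case E: (ancilla0 (dec n z)); rewrite ?mulr1n // mulr0n h //.
move/negbT: E; rewrite negb_forall => /existsP[i hi]; apply/existsP; exists i.
by move: hi; rewrite negb_imply negbK.
Qed.

(** Probability 1 forces [Pi] to leave the final state intact, so the adjoint circuit returns it to
    [psi], which [PW] fixes. *)
Lemma fixed_of_accept (psi : qstate R n) : witness m psi -> accept_prob gs psi = 1 ->
  exists2 v : 'cV[C]_(2 ^ n), v != 0 & prodf (T + T).+2 *m v = v.
Proof.
move=> [hanc hnorm]; rewrite accept_prob_vec => hacc; exists (vec psi).
  apply/eqP => h0; move: hnorm; rewrite -norm2_vec h0 /norm2 big1 => [/esym/eqP|i _].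
    by rewrite oner_eq0.
  by rewrite mxE normr0 expr0n.
have hPi : Pi *m (prodf T *m vec psi) = prodf T *m vec psi.
  apply: norm2_diag_eq; rewrite -/Pi hacc norm2_isom ?norm2_vec ?hnorm //.
  exact: prodf_unitary.
rewrite prodf_total -!mulmxA hPi (mulmxA (back T)) back_prodf // subnn mul1mx.
exact: witness_fixed.
Qed.

(** The norm cannot increase from [v] through the factors back to [v], so it is constant, in
    particular after [Pi]. Being in the image of [PW], [v] has zero ancillas; it only remains to
    normalise it. *)
Lemma accept_of_fixed (v : 'cV[C]_(2 ^ n)) : v != 0 -> prodf (T + T).+2 *m v = v ->
  exists2 psi : qstate R n, witness m psi & accept_prob gs psi = 1.
Proof.
move=> hv; rewrite prodf_total -!mulmxA => hfix.
pose w := Pi *m (prodf T *m v).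
have e1 : norm2 (prodf T *m v) = norm2 v by apply: norm2_isom; apply: prodf_unitary.
have e2 : norm2 w = norm2 v.
  apply/le_anti/andP; split; first by rewrite -e1; apply: norm2_diag_le.
  by rewrite -{1}hfix; apply: le_trans (norm2_diag_le _ _) _; rewrite back_norm.
have nv0 : norm2 v != 0 by apply: contraNneq hv => /norm2_eq0 ->.
have nv_pos : 0 < norm2 v by rewrite lt_neqAle eq_sym nv0 norm2_ge0.
pose a := (sqrtC (norm2 v))^-1.
have a2 : `|a| ^+ 2 * norm2 v = 1.
  by rewrite -normrX exprVn sqrtCK normfV ger0_norm ?norm2_ge0 // mulVf.
have scal (u : 'cV[C]_(2 ^ n)) : norm2 (a *: u) = `|a| ^+ 2 * norm2 u.
  by rewrite /norm2 mulr_sumr; apply: eq_bigr => i _; rewrite mxE normrM exprMn.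
have [inv _ invK] := dec_bij n.
pose psi : qstate R n := fun z => (a *: v) (inv z) 0.
have vecpsi : vec psi = a *: v.
  apply/colP => z; rewrite mxE /psi; congr (_ _ _); apply: (@basis_dec_inj n).
  exact: invK.
exists psi; last by rewrite accept_prob_vec vecpsi -!scalemxAr scal e2.
split; last by rewrite -norm2_vec vecpsi scal.
move=> z /existsP[i /andP[hi hzi]]; rewrite /psi mxE -hfix diagmE.
rewrite (_ : ancilla0 _ = false) ?mulr0n ?mulr0 //.
apply/negbTE/forallPn; exists i; rewrite hi /=.
by have /= -> := invK z; rewrite hzi.
Qed.
End Circuit.

Local Close Scope ring_scope.

(** * The matrix entries as linear-space functions *)

Section Entry.
Variables (R : realType) (gs : seq (gate R)).
Local Notation C := (R[i])%R.
Variables (dd D : nat) (rho : C -> 'I_dd -> 'I_dd -> int).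
Variables b c0 c1 : nat.

Definition arity_max := \max_(g <- gs) garity g.
Local Notation A := arity_max.
Local Notation G := (size gs).
Local Notation Q := (2 ^ A).
Local Notation tok := (tok b c0 c1).
Local Notation gidx := (gidx b c0 c1).
Local Notation gqubit := (gqubit b c0 c1).

Definition entry (f g yc xc : nat) : C :=
  let u := nth (id_gate R) gs g in
  if f == 0 then gmat (g := u) (dec _ yc) (dec _ xc)
  else ((gmat (g := u) (dec _ xc) (dec _ yc))^*)%R.

Definition rho_nat (a : C) (s s' : nat) : int :=
  if insub s is Some i then if insub s' is Some j then rho a i j else 0%R else 0%R.

(** Mixed-radix packing of everything a block entry depends on. For a fixed gate set there are
    finitely many keys, so one table holds all entries; the common radix [Q] comes from the largest
    arity. *)
Definition key f g yc xc s s' := (((((f * G + g) * Q + yc) * Q + xc) * dd + s) * dd + s').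
Definition nkeys := (2 * G * Q * Q * dd * dd).

Definition rho_key (k : nat) : int :=
  (let k1 := k %/ dd in let k2 := k1 %/ dd in let k3 := k2 %/ Q in let k4 := k3 %/ Q in
  rho_nat (entry (k4 %/ G) (k4 %% G) (k3 %% Q) (k2 %% Q)) (k1 %% dd) (k %% dd))%N.

(** Machine values are natural numbers, so integers are kept as a positive and a negative part. *)
Definition posp (z : int) : nat := if z is Posz k then k else 0.
Definition negp (z : int) : nat := if z is Negz k then k.+1 else 0.

Lemma posp_negp z : ((posp z)%:Z - (negp z)%:Z = z)%R.
Proof. by case: z => k; rewrite /= ?subr0 ?sub0r ?NegzE. Qed.

Lemma keyK f g yc xc s s' : g < G -> yc < Q -> xc < Q -> s < dd -> s' < dd ->
  rho_key (key f g yc xc s s') = rho_nat (entry f g yc xc) s s'.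
Proof.
move=> hg hy hx hs hs'; rewrite /rho_key /key.
have d0 : 0 < dd by apply: leq_ltn_trans hs.
have q0 : 0 < Q by apply: leq_ltn_trans hy.
have g0 : 0 < G by apply: leq_ltn_trans hg.
have E a x k : x < k -> (a * k + x) %/ k = a.
  by move=> h; rewrite divnMDl ?(leq_ltn_trans _ h) // divn_small // addn0.
have E' a x k : x < k -> (a * k + x) %% k = x by move=> h; rewrite modnMDl modn_small.
by rewrite !(E, E').
Qed.

Lemma key_bound f g yc xc s s' : f < 2 -> g < G -> yc < Q -> xc < Q -> s < dd -> s' < dd ->
  key f g yc xc s s' < nkeys.
Proof.
have E a x k n : a < n -> x < k -> a * k + x < n * k by nia.
by move=> *; rewrite /key /nkeys; do 5 (apply: (E) => //).
Qed.

Definition ar g := tab (fun g => garity (nth (id_gate R) gs g)) G g.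

Lemma LS_ar : LSf1 ar. Proof. exact: LS_tab. Qed.

Definition lbit z i := shr 2 z i %% 2.

Lemma LS_lbit : LSf2 lbit.
Proof. by move=> k z i hz hi; apply: LS_mod (LS_shr (LS_const _ 2) hz hi) (LS_const _ 2). Qed.

(** The local basis state that [z] induces on the targets of gate [t], as a number. The powers of 2
    come from a table, which is possible because arities are bounded. *)
Definition lcode Y t z := \sum_(j < ar (gidx Y t)) lbit z (gqubit Y t j) * tab (expn 2) A j.

Lemma LS_lcode : LSf3 lcode.
Proof.
apply: LSf3I.
apply: (@LS_sum 3 (fun e => ar (gidx (nth 0 e 0) (nth 0 e 1)))
  (fun j e => lbit (nth 0 e 2) (gqubit (nth 0 e 0) (nth 0 e 1) j) * tab (expn 2) A j)).
  by apply: LS_ar; apply: LS_gidx; apply: LS_var.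
have v i := LS_behead (LS_var 3 i).
by apply: LS_mul (LS_lbit (v 2) (LS_gqubit _ _ _ (v 0) (v 1) (LS_var _ 0))) (LS_tab _ _ (LS_var _ 0)).
Qed.

Definition touched Y t i := ~~ [forall j : 'I_(ar (gidx Y t)), gqubit Y t j != i].
Definition agree Y t y x :=
  [forall i : 'I_(tok Y 1), touched Y t i || (lbit y i == lbit x i)].

Lemma LS_touched k Y t i : LS k Y -> LS k t -> LS k i ->
  LSb k (fun e => touched (Y e) (t e) (i e)).
Proof.
move=> hY ht hi; suff h : LS 3 (fun e => nat_of_bool (touched (nth 0 e 0) (nth 0 e 1) (nth 0 e 2))).
  exact: (@LSf3I (fun Y t i => nat_of_bool (touched Y t i)) h).
apply: LS_not; apply: (LS_all (p := fun j e => gqubit (nth 0 e 0) (nth 0 e 1) j != nth 0 e 2)).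
  by apply: LS_ar; apply: LS_gidx; apply: LS_var.
have v i := LS_behead (LS_var 3 i).
by apply: LS_not; apply: LS_eqn (LS_gqubit _ _ _ (v 0) (v 1) (LS_var _ 0)) (v 2).
Qed.

Lemma LS_agree k Y t y x : LS k Y -> LS k t -> LS k y -> LS k x ->
  LSb k (fun e => agree (Y e) (t e) (y e) (x e)).
Proof.
move=> hY ht hy hx.
suff h : LS 4 (fun e => nat_of_bool (agree (nth 0 e 0) (nth 0 e 1) (nth 0 e 2) (nth 0 e 3))).
  exact: (@LSf4I (fun Y t y x => nat_of_bool (agree Y t y x)) h).
have v i := LS_behead (LS_var 4 i).
apply: (LS_all (p := fun i e => touched (nth 0 e 0) (nth 0 e 1) i || (lbit (nth 0 e 2) i == lbit (nth 0 e 3) i))).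
  exact: (LS_tok _ _ _ (LS_var 4 0) (LS_const 4 1)).
apply: LS_or; first exact: LS_touched (v 0) (v 1) (LS_var _ 0).
by apply: LS_eqn (LS_lbit (v 2) (LS_var _ 0)) (LS_lbit (v 3) (LS_var _ 0)).
Qed.

Definition lanc Y y := [forall i : 'I_(tok Y 1), (i < tok Y 0) || (lbit y i == 0)].

Lemma LS_lanc k Y y : LS k Y -> LS k y -> LSb k (fun e => lanc (Y e) (y e)).
Proof.
move=> hY hy; suff h : LS 2 (fun e => nat_of_bool (lanc (nth 0 e 0) (nth 0 e 1))).
  exact: (@LSf2I (fun Y y => nat_of_bool (lanc Y y)) h).
have v i := LS_behead (LS_var 2 i).
apply: (LS_all (p := fun i e => (i < tok (nth 0 e 0) 0) || (lbit (nth 0 e 1) i == 0))).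
  exact: (LS_tok _ _ _ (LS_var 2 0) (LS_const 2 1)).
apply: LS_or; first exact: LS_ltn (LS_var _ 0) (LS_tok _ _ _ (v 0) (LS_const _ 0)).
exact: LS_eqn (LS_lbit (v 1) (LS_var _ 0)) (LS_const _ 0).
Qed.

(* [F] and [dg] are the positive (resp. negative) parts of the entries of the
   matrices representing a gate entry and the scalar 1. *)
Definition rpart (F : int -> nat) (dg : nat) (Y t y x s s' : nat) : nat :=
  let T := tok Y 2 in
  let gate f t := if agree Y t y x
    then tab (fun k => F (rho_key k)) nkeys (key f (gidx Y t) (lcode Y t y) (lcode Y t x) s s') else 0 in
  if t < T then gate 0 t
  else if t == T then if [&& y == x, lbit y 0 == 1 & s == s'] then dg else 0
  else if t <= T + T then gate 1 (T + T - t)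
  else if [&& y == x, lanc Y y & s == s'] then dg else 0.

Lemma LS_rpart F dg : LSf6 (rpart F dg).
Proof.
apply: LSf6I; have v i := LS_var 6 i.
have hT := LS_tok b c0 c1 (v 0) (LS_const 6 2).
have gate f t : LS 6 t -> LS 6 (fun e => if agree (nth 0 e 0) (t e) (nth 0 e 2) (nth 0 e 3)
  then tab (fun k => F (rho_key k)) nkeys (key f (gidx (nth 0 e 0) (t e)) (lcode (nth 0 e 0) (t e) (nth 0 e 2))
     (lcode (nth 0 e 0) (t e) (nth 0 e 3)) (nth 0 e 4) (nth 0 e 5)) else 0).
  move=> ht; apply: LS_if (LS_agree (v 0) ht (v 2) (v 3)) _ (LS_const _ 0); apply: LS_tab.
  have hy := LS_lcode (v 0) ht (v 2); have hx := LS_lcode (v 0) ht (v 3).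
  have hg := LS_add (LS_const 6 (f * G)) (LS_gidx b c0 c1 (v 0) ht).
  have cQ := LS_const 6 Q; have cd := LS_const 6 dd.
  exact: (LS_add (LS_mul (LS_add (LS_mul (LS_add (LS_mul (LS_add (LS_mul hg cQ) hy) cQ) hx) cd) (v 4)) cd) (v 5)).
have hs := LS_eqn (v 4) (v 5); have hyx := LS_eqn (v 2) (v 3).
have cdg := LS_const 6 dg; have cz := LS_const 6 0.
apply: LS_if (LS_ltn (v 1) hT) (gate 0 _ (v 1)) _.
apply: LS_if (LS_eqn (v 1) hT) _ _.
  apply: LS_if (LS_and hyx (LS_and _ hs)) cdg cz.
  exact: LS_eqn (LS_lbit (v 2) (LS_const _ 0)) (LS_const _ 1).
apply: LS_if (LS_leq (v 1) (LS_add hT hT)) (gate 1 _ (LS_sub (LS_add hT hT) (v 1))) _.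
by apply: LS_if (LS_and hyx (LS_and (LS_lanc (v 0) (v 2)) hs)) cdg cz.
Qed.

(** The bound does not depend on the circuit, so the entries of the big matrix are bounded by a
    constant. *)
Lemma rpart_bound F dg Y t y x s s' :
  rpart F dg Y t y x s s' <= dg + \sum_(k < nkeys) F (rho_key k).
Proof.
have ht z : tab (fun k => F (rho_key k)) nkeys z <= \sum_(k < nkeys) F (rho_key k).
  rewrite /tab; case: ltnP => // hz; by rewrite (bigD1 (Ordinal hz)) //= leq_addr.
rewrite /rpart; do 4 (try case: ifP => _); rewrite ?leq_addr //; try (by apply: leq_trans (ht _) _; rewrite leq_addl).
Qed.
End Entry.

Local Open Scope ring_scope.

(** * Correctness of the computed entries *)

Section EntryCorrect.
Variables (R : realType) (gs : seq (gate R)).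
Local Notation C := (R[i]).
Variables (dd D : nat) (rho : C -> 'I_dd -> 'I_dd -> int) (c : 'I_dd -> C).
Variables b c0 c1 : nat.
Local Notation tok := (tok b c0 c1).
Local Notation gidx := (gidx b c0 c1).
Local Notation gqubit := (gqubit b c0 c1).

Hypothesis hrho : forall f g yc xc, (g < size gs)%N -> forall i,
  \sum_j (rho (entry gs f g yc xc) i j)%:~R * c j = D%:R * (entry gs f g yc xc * c i).

Variable (d : desc).
Hypothesis dV : valid_desc gs d.
Local Notation m := d.1.1.
Local Notation n := d.1.2.
Local Notation T := (size d.2).
Variable Y : nat.
Hypotheses (tok0 : tok Y 0 = m) (tok1 : tok Y 1 = n) (tok2 : tok Y 2 = T).
Hypothesis tokg : forall t, (t < T)%N -> let g := nth (0%N, [::]) d.2 t in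
     gidx Y t = g.1 /\ forall j, (j < size g.2)%N -> gqubit Y t j = nth 0%N g.2 j.

Lemma lbitE z i : lbit z i = odd (shr 2 z i).
Proof. by rewrite /lbit modn2. Qed.

Lemma bit_dec z q : (q < n)%N -> bit (dec n z) q = odd (shr 2 z q).
Proof. by move=> hq; rewrite (bitE _ (Ordinal hq)) ffunE. Qed.

Lemma ar_gate t : (t < T)%N -> ar gs (gidx Y t) = garity (cgate gs d t).
Proof.
move=> ht; have [-> _] := tokg ht; have [hg _ _ _] := desc_gate dV ht.
by rewrite /ar /tab hg.
Qed.

Lemma garity_max t : (t < T)%N -> (garity (cgate gs d t) <= arity_max gs)%N.
Proof.
move=> ht; have [hg _ _ _] := desc_gate dV ht.
by rewrite /arity_max (big_nth (id_gate R)) big_mkord (bigD1 (Ordinal hg)) //= leq_maxl.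
Qed.

Lemma target_lt t j : (t < T)%N -> (j < garity (cgate gs d t))%N -> (nth 0 (ctargets d t) j < n)%N.
Proof.
move=> ht hj; have [_ hs _ ha] := desc_gate dV ht.
by apply: (allP ha); apply: mem_nth; rewrite hs.
Qed.

Lemma gqubit_target t j : (t < T)%N -> (j < garity (cgate gs d t))%N ->
  gqubit Y t j = nth 0%N (ctargets d t) j.
Proof.
move=> ht hj; have [_ hs _ _] := desc_gate dV ht.
by have [_ ->] := tokg ht; rewrite // -/(ctargets d t) hs.
Qed.

Lemma lcode_sum t z : (t < T)%N -> lcode gs b c0 c1 Y t z =
  (\sum_(j < garity (cgate gs d t)) (odd (shr 2 z (nth 0 (ctargets d t) j)) : nat) * 2 ^ j)%N.
Proof.
move=> ht; rewrite /lcode ar_gate //; apply: eq_bigr => j _.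
rewrite gqubit_target // lbitE /tab (leq_trans (ltn_ord j)) //; exact: garity_max.
Qed.

Lemma lcode_lt t z : (t < T)%N -> (lcode gs b c0 c1 Y t z < 2 ^ arity_max gs)%N.
Proof.
move=> ht; rewrite lcode_sum //.
apply: (@leq_trans (2 ^ garity (cgate gs d t))); last by rewrite leq_exp2l // garity_max.
apply: (@sum_digits_lt 2 _ (fun j => odd (shr 2 z (nth 0%N (ctargets d t) j)))) => i _.
by case: odd.
Qed.

Lemma dec_lcode t z : (t < T)%N -> dec _ (lcode gs b c0 c1 Y t z) =
  [ffun j : 'I_(garity (cgate gs d t)) => bit (dec n z) (nth 0%N (ctargets d t) j)].
Proof.
move=> ht; apply/ffunP => j; rewrite !ffunE bit_dec ?target_lt //.
have := @dig_sum 2 _ (fun j => odd (shr 2 z (nth 0%N (ctargets d t) j)) : nat) j (fun i _ => _) (ltn_ord j).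
rewrite -lcode_sum // /dig modn2 => h.
have : (odd (shr 2 (lcode gs b c0 c1 Y t z) j) = odd (shr 2 z (nth 0%N (ctargets d t) j)) :> nat).
  by apply: h => i; case: odd.
by do 2 case: odd.
Qed.

Lemma touchedE t i : (t < T)%N -> touched gs b c0 c1 Y t i = (i \in ctargets d t).
Proof.
move=> ht; have [_ hs _ _] := desc_gate dV ht; rewrite /touched ar_gate // negb_forall.
apply/existsP/(nthP 0%N) => [[j]|[j hj hij]].
  by rewrite negbK gqubit_target // => /eqP <-; exists j => //; rewrite hs.
rewrite hs in hj; exists (Ordinal hj); by rewrite negbK /= gqubit_target // hij.
Qed.

Lemma agreeE t y x : (t < T)%N -> agree gs b c0 c1 Y t y x =
  [forall i : 'I_n, (nat_of_ord i \notin ctargets d t) ==> (dec n y i == dec n x i)].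
Proof.
move=> ht; rewrite /agree tok1; apply: eq_forallb => i.
rewrite touchedE // implybE negbK !ffunE !lbitE; congr orb.
by do 2 case: odd.
Qed.

Lemma lancE y : lanc b c0 c1 Y y = ancilla0 (d := d) (dec n y).
Proof.
rewrite /lanc /ancilla0 tok0 tok1; apply: eq_forallb => i.
by rewrite implybE -ltnNge ffunE lbitE; congr orb; case: odd.
Qed.

Definition cnat (s : nat) : C := if insub s is Some i then c i else 0.

Lemma sum_rho_nat a (i : 'I_dd) : \sum_(j < dd) (rho_nat rho a i j)%:~R * cnat j =
  \sum_j (rho a i j)%:~R * c j.
Proof. by apply: eq_bigr => j _; rewrite /rho_nat /cnat !valK. Qed.

Definition rint t y x s s' : int :=
  (rpart gs rho b c0 c1 posp D Y t y x s s')%:Z - (rpart gs rho b c0 c1 negp 0 Y t y x s s')%:Z.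

Lemma n_gt0 : (0 < n)%N.
Proof. by move: dV; rewrite /valid_desc; case: d => [[m' n'] cs] /and3P[]. Qed.

Lemma rintP t y x s : (t < T + T + 2)%N -> (y < 2 ^ n)%N -> (x < 2 ^ n)%N -> (s < dd)%N ->
  \sum_(s' < dd) (rint t y x s s')%:~R * cnat s' =
  D%:R * (factor_entry gs (d := d) t (dec n y) (dec n x) * cnat s).
Proof.
move=> ht hy hx hs.
pose i := Ordinal hs; have es : s = i by [].
have cs : cnat s = c i by rewrite es /cnat valK.
have eyx : (dec n y == dec n x) = (y == x).
  by rewrite -[y]/(val (Ordinal hy)) -[x]/(val (Ordinal hx)) (inj_eq (@basis_dec_inj n)).
have gateP f u : (f < 2)%N -> (u < T)%N ->
  \sum_(s' < dd) ((if agree gs b c0 c1 Y u y x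
    then tab (fun k => posp (rho_key gs rho k)) (nkeys gs dd)
       (key gs dd f (gidx Y u) (lcode gs b c0 c1 Y u y) (lcode gs b c0 c1 Y u x) s s') else 0)%N%:Z -
    (if agree gs b c0 c1 Y u y x
    then tab (fun k => negp (rho_key gs rho k)) (nkeys gs dd)
       (key gs dd f (gidx Y u) (lcode gs b c0 c1 Y u y) (lcode gs b c0 c1 Y u x) s s') else 0)%N%:Z)%:~R * cnat s'
  = D%:R * ((if agree gs b c0 c1 Y u y x then
      entry gs f (gidx Y u) (lcode gs b c0 c1 Y u y) (lcode gs b c0 c1 Y u x) else 0) * cnat s).
  move=> hf hu; have hy' := lcode_lt y hu; have hx' := lcode_lt x hu.
  have [hg _ _ _] := desc_gate dV hu; have [eg _] := tokg hu; rewrite -eg in hg.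
  case: ifP => _; last by rewrite big1 ?mul0r ?mulr0 // => j _; rewrite subrr mul0r.
  rewrite cs -hrho // -sum_rho_nat; apply: eq_bigr => s' _; congr (_%:~R * _).
  by rewrite /tab key_bound // keyK // posp_negp.
(* The entries 0 and 1 of the projections are represented by the scalar matrices 0 and [D]. *)
have diagP (p : bool) :
  \sum_(s' < dd) ((if [&& y == x, p & s == s'] then D else 0)%N%:Z -
     (if [&& y == x, p & s == s'] then 0 else 0)%N%:Z)%:~R * cnat s'
  = D%:R * (((y == x) && p)%:R * cnat s) :> C.
  rewrite (bigD1 i) //= big1 ?addr0 => [|j hj]; last first.
    have -> : (s == j) = false by apply/negbTE; move: hj; rewrite -val_eqE eq_sym.
    by rewrite !andbF subrr mul0r.
  rewrite eqxx andbT; case: (_ && _); rewrite ?subr0 ?mul1r ?mul0r ?mulr0 //.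
have gE u v w : (u < T)%N -> (if agree gs b c0 c1 Y u v w then
      entry gs 0 (gidx Y u) (lcode gs b c0 c1 Y u v) (lcode gs b c0 c1 Y u w) else 0) =
      gate_entry (cgate gs d u) (ctargets d u) (dec n v) (dec n w).
  move=> hu; rewrite agreeE // /gate_entry /entry /=; have [eg _] := tokg hu.
  by rewrite eg -/(cgate gs d u) !dec_lcode.
have gE1 u v w : (u < T)%N -> (if agree gs b c0 c1 Y u v w then
      entry gs 1 (gidx Y u) (lcode gs b c0 c1 Y u v) (lcode gs b c0 c1 Y u w) else 0) =
      (gate_entry (cgate gs d u) (ctargets d u) (dec n w) (dec n v))^*.
  move=> hu; rewrite -gE // !agreeE // /entry /=.
  under eq_forallb => q do rewrite eq_sym.
  by case: ifP => //; rewrite rmorph0.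
rewrite /rint /rpart tok2 /factor_entry; case: ltnP => h1; first by rewrite gateP // gE.
case: eqP => h2; first by rewrite eyx bit_dec ?n_gt0 // -[odd _]/(odd (shr 2 y 0)) diagP lbitE; case: odd.
case: leqP => h3; first by rewrite gateP ?gE1 //; lia.
by rewrite eyx -lancE diagP.
Qed.
End EntryCorrect.

(** * From fixed vectors to cycles and back *)

Section Bridge.
Variables (R : realType) (gs : seq (gate R)) (d : desc).
Local Notation C := (R[i]).
Local Notation n := d.1.2.
Local Notation L := (size d.2 + size d.2).+2.
Local Notation F := (@factor R gs d).
Local Notation X t y x := (@factor_entry R gs d t (dec n y) (dec n x)).

(** The partial products applied to [v] form the cycle, which closes because [v] is fixed. *)
Lemma fixed_cycle (v : 'cV[C]_(2 ^ n)) : v != 0 -> @prodf R gs d L *m v = v ->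
  exists2 psi : nat -> nat -> C,
    forall t y, (t < L)%N -> (y < 2 ^ n)%N ->
      \sum_(x < 2 ^ n) X t y x * psi t x = psi (t.+1 %% L)%N y
    & exists2 x, (x < 2 ^ n)%N & psi 0%N x != 0.
Proof.
move=> hv hfix.
pose psi t y : C := if insub y is Some i then (@prodf R gs d t *m v) i 0 else 0.
have psiE t (i : 'I_(2 ^ n)) : psi t i = (@prodf R gs d t *m v) i 0 by rewrite /psi valK.
exists psi.
  move=> t y ht hy; rewrite -[y]/(val (Ordinal hy)) psiE.
  rewrite (eq_bigr (fun x => F t (Ordinal hy) x * (@prodf R gs d t *m v) x 0)); last first.
    by move=> x _; rewrite psiE; congr (_ * _); rewrite mxE.
  have -> : \sum_x F t (Ordinal hy) x * (@prodf R gs d t *m v) x 0 = (@prodf R gs d t.+1 *m v) (Ordinal hy) 0.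
    by rewrite [prodf _ _ t.+1]/= -mulmxA mxE.
  case: (ltnP t.+1 L) => h; first by rewrite modn_small.
  have -> : t.+1 = L by lia.
  by rewrite modnn hfix mul1mx.
have [i hi] : exists i, v i 0 != 0.
  apply/existsP; apply: contraNT hv => /existsPn h; apply/eqP/colP => i; rewrite mxE.
  by apply/eqP; have := h i; rewrite negbK.
by exists i => //; rewrite psiE mul1mx.
Qed.

(** The rows of the cycle yield a left fixed vector of the product; the vanishing determinant of the
    product minus 1 then yields a right one. *)
Lemma cycle_fixed (phi : nat -> nat -> C) :
  (forall t x, (t < L)%N -> (x < 2 ^ n)%N ->
     \sum_(y < 2 ^ n) phi (t.+1 %% L)%N y * X t y x = phi t x) ->
  (exists t x, [/\ (t < L)%N, (x < 2 ^ n)%N & phi t x != 0]) ->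
  exists2 v : 'cV[C]_(2 ^ n), v != 0 & @prodf R gs d L *m v = v.
Proof.
move=> hphi [t0 [x0 [ht0 hx0 hne]]].
pose Phi t : 'rV[C]_(2 ^ n) := \row_y phi t y.
have hP t : (t < L)%N -> Phi (t.+1 %% L)%N *m F t = Phi t.
  move=> ht; apply/rowP => x; rewrite !mxE -hphi //; apply: eq_bigr => y _; by rewrite !mxE.
have hprod t : (t < L)%N -> Phi t *m @prodf R gs d t = Phi 0%N.
  elim: t => [|t IH] ht; first by rewrite mulmx1.
  by rewrite [prodf _ _ _]/= mulmxA -{1}(modn_small ht) hP ?IH // ltnW.
have hlast : Phi 0%N *m @prodf R gs d L = Phi 0%N.
  have := hP L.-1 (ltnSn _); rewrite prednK // modnn => h1.
  by rewrite [prodf _ _ _]/= mulmxA h1 hprod.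
(* If the row at time 0 vanished, going backwards around the cycle would make every row vanish. *)
have hP0 : Phi 0%N != 0.
  apply: contraNneq hne => h0.
  have hz k : (k < L)%N -> Phi (L.-1 - k)%N = 0.
    elim: k => [|k IH] hk.
      rewrite subn0 -hP //; have -> : (L.-1.+1 %% L = 0)%N by rewrite prednK // modnn.
      by rewrite h0 mul0mx.
    rewrite -hP; last by lia.
    have -> : ((L.-1 - k.+1).+1 %% L = L.-1 - k)%N by rewrite modn_small; lia.
    by rewrite IH ?mul0mx // ltnW.
  have := hz (L.-1 - t0)%N ltac:(lia); have -> : (L.-1 - (L.-1 - t0) = t0)%N by lia.
  by move/rowP/(_ (Ordinal hx0)); rewrite !mxE => /= ->.
have hdet : \det (@prodf R gs d L - 1%:M) = 0.
  apply/eqP/det0P; exists (Phi 0%N) => //.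
  by rewrite mulmxBr hlast mulmx1 subrr.
move: hdet; rewrite -det_tr => /eqP/det0P[u hu hu0]; exists u^T.
  by apply: contraNneq hu => h; rewrite -[u]trmxK h trmx0.
apply/eqP; rewrite -subr_eq0 -{2}[u^T]mul1mx -mulmxBl.
by rewrite -[_ - _]trmxK -trmx_mul hu0 trmx0.
Qed.
End Bridge.

(** * A common integer representation of the gate entries *)

Section Decide.
Variables (R : realType) (gs : seq (gate R)).
Local Notation C := (R[i]).
Hypothesis gsU : forall k, (k < size gs)%N ->
     unitary_gate (nth (id_gate R) gs k) /\ algebraic_gate (nth (id_gate R) gs k).

Lemma algebraic_conj (x : C) : algebraic x -> algebraic x^*.
Proof.
move=> [p [p0 hp]]; exists p; split=> //; apply/rootP.
have e : map_poly (@ratr C) p = map_poly Num.conj (map_poly (@ratr C) p).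
  by rewrite -map_poly_comp; apply: eq_map_poly => y /=; rewrite fmorph_rat.
by rewrite e horner_map (rootP hp) rmorph0.
Qed.

Lemma gate_rep : exists dd (c : 'I_dd -> C) (D : nat) (rho : C -> 'I_dd -> 'I_dd -> int),
  [/\ (0 < dd)%N, (0 < D)%N, rat_indep c &
     forall f g yc xc, (g < size gs)%N -> forall i,
       \sum_j (rho (entry gs f g yc xc) i j)%:~R * c j = D%:R * (entry gs f g yc xc * c i)].
Proof.
pose B (u : gate R) := {: {ffun 'I_(garity u) -> bool} * {ffun 'I_(garity u) -> bool}}.
pose ents (u : gate R) : seq C := [seq gmat (g := u) p.1 p.2 | p <- enum (B u)].
(* Conjugates are included for the adjoint gates. *)
pose al := flatten [seq ents (nth (id_gate R) gs g) ++ map Num.conj (ents (nth (id_gate R) gs g))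
                   | g <- iota 0 (size gs)].
have hal a : a \in al -> algebraic a.
  move=> /flattenP[s /mapP[g]]; rewrite mem_iota add0n => /gsU[_ halg] ->.
  rewrite mem_cat => /orP[/mapP[p _ ->]|/mapP[z /mapP[p _ ->] ->]]; first exact: halg.
  exact/algebraic_conj/halg.
have [dd [c [D [rho [h1 h2 h3 h4]]]]] := int_rep_exists hal.
exists dd, c, D, rho; split=> // f g yc xc hg i; apply: h4.
apply/flattenP; exists (ents (nth (id_gate R) gs g) ++ map Num.conj (ents (nth (id_gate R) gs g))).
  by apply/mapP; exists g => //; rewrite mem_iota.
rewrite mem_cat /entry; case: ifP => _; apply/orP; [left|right; apply: map_f].
  by apply/mapP; exists (dec _ yc, dec _ xc) => //; rewrite mem_enum.
by apply/mapP; exists (dec _ xc, dec _ yc) => //; rewrite mem_enum.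
Qed.
End Decide.

Local Close Scope ring_scope.

(** * The decision procedure *)

Section Decide.
Variables (R : realType) (gs : seq (gate R)).
Hypothesis gsU : forall k, (k < size gs)%N ->
     unitary_gate (nth (id_gate R) gs k) /\ algebraic_gate (nth (id_gate R) gs k).

Definition hist_dim (dd n T : nat) := (T + T).+2 * 2 ^ n * dd.
Definition space_need (dd K n T : nat) :=
  ((hist_dim dd n T).+1 ^ 3 + 2 * (hist_dim dd n T * (hist_dim dd n T * K) + 1) + 2)
    ^ (bitlen (hist_dim dd n T) + 2).

Theorem LS_decide b c0 c1 : c0 <> c1 -> exists P dd K, LSb 2 P /\
  forall Y S d, valid_desc gs d -> let s := enc_desc d in size s <= Y ->
    (forall i, i < size s -> dig b Y i = if nth false s i then c1 else c0) ->
    2 ^ d.1.2 <= S -> space_need dd K d.1.2 (size d.2) <= S ->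
    P [:: Y; S] <-> exists2 psi : qstate R d.1.2, witness d.1.1 psi & accept_prob gs psi = 1%R.
Proof.
move=> c01; have [dd [c [D [rho [d0 D0 hind hrho]]]]] := gate_rep gsU.
pose rp := rpart gs rho b c0 c1 posp D; pose rn := rpart gs rho b c0 c1 negp 0.
pose Lf e := (tok b c0 c1 (nth 0 e 0) 2 + tok b c0 c1 (nth 0 e 0) 2).+2.
pose nf e := powcap (nth 0 e 1) 2 (tok b c0 c1 (nth 0 e 0) 1).
pose Nf e := Lf e * nf e * dd.
(* A natural representative of [cyc_mx] modulo [q]: the negated block entry [rn - rp] is written as
   [rn] plus [q.-1] times [rp]. *)
pose a q i j e :=
  let: t := ix_t (nf e) dd j in let: y := ix_y (nf e) dd i in let: x := ix_y (nf e) dd j in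
  let: s := ix_s dd i in let: s' := ix_s dd j in
  D * nat_of_bool (i == j) + nat_of_bool (ix_t (nf e) dd i == t.+1 %% Lf e) *
    (rn (nth 0 e 0) t y x s s' + q.-1 * rp (nth 0 e 0) t y x s s').
have hT : LS 2 (fun e => tok b c0 c1 (nth 0 e 0) 2) by exact: (LS_tok _ _ _ (LS_var 2 0) (LS_const 2 2)).
have hL : LS 2 Lf by exact: (LS_S (LS_S (LS_add hT hT))).
have hn : LS 2 nf.
  exact: (LS_powcap (LS_var 2 1) (LS_const 2 1) (LS_tok b c0 c1 (LS_var 2 0) (LS_const 2 1))).
have hN : LS 2 Nf := LS_mul (LS_mul hL hn) (LS_const 2 dd).
have ha : LS 5 (fun e => a (nth 0 e 0) (nth 0 e 1) (nth 0 e 2) (drop 3 e)).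
  have v i := LS_var 5 i; have hn3 := LS_drop 3 hn; have hL3 := LS_drop 3 hL.
  have cd := LS_const 5 dd; have hY := LS_drop 3 (LS_var 2 0).
  have ht i := LS_div (LS_div (v i) cd) hn3; have hy i := LS_mod (LS_div (v i) cd) hn3.
  have hs i := LS_mod (v i) cd.
  have hr F dg := @LS_rpart R gs dd rho b c0 c1 F dg _ _ _ _ _ _ _ hY (ht 2) (hy 1) (hy 2) (hs 1) (hs 2).
  exact: (LS_add (LS_mul (LS_const 5 D) (LS_eqn (v 1) (v 2)))
    (LS_mul (LS_eqn (ht 1) (LS_mod (LS_S (ht 2)) hL3)) (LS_add (hr negp 0) (LS_mul (LS_pred (v 0)) (hr posp D))))).
pose K := D + ((D + \sum_(k < nkeys gs dd) posp (rho_key gs rho k)) +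
               (0 + \sum_(k < nkeys gs dd) negp (rho_key gs rho k))).
have [P hP Pok] := @LS_singular 2 a Nf (nth 0 ^~ 1) K ha hN (LS_var 2 1).
exists P, dd, K; split=> // Y S d dV s hsY hdig h2n hspace.
have [tok0 tok1 tok2 tokg] := desc_tokens c01 hsY hdig.
set e := [:: Y; S]; set n := d.1.2 in tok1 h2n hspace *; set T := size d.2 in tok2 hspace *.
have eL : Lf e = (T + T).+2 by rewrite /Lf /= tok2.
have en : nf e = 2 ^ n by rewrite /nf /= tok1; apply/minn_idPr.
have eN : Nf e = hist_dim dd n T by rewrite /Nf eL en.
pose r := rint gs D rho b c0 c1 Y.
have n0 : 0 < 2 ^ n by rewrite expn_gt0.
have L0 : 0 < (T + T).+2 by [].
pose cn := cnat c.
have rP t y x q : t < (T + T).+2 -> y < 2 ^ n -> x < 2 ^ n -> q < dd ->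
   (\sum_(q' < dd) (r t y x q q')%:~R * cn q' =
    D%:R * (@factor_entry R gs d t (dec n y) (dec n x) * cn q))%R.
  by move=> ht *; apply: rintP => //; rewrite addn2.
have cind (u : nat -> rat) : (\sum_(q < dd) ratr (u q) * cn q = 0)%R -> forall q, q < dd -> u q = 0%R.
  move=> hu q hq; apply: (hind (fun i => u i) _ (Ordinal hq)).
  by rewrite -[RHS]hu; apply: eq_bigr => i _; rewrite /cn /cnat valK.
have detP : P e <-> (\det (Acyc (T + T).+2 (2 ^ n) dd D r) = 0)%R.
  rewrite (Pok e (cyc_mx (T + T).+2 (2 ^ n) dd D r)) //.
  - by rewrite eN; split=> [/eqP|->].
  - move=> q i j hq _ _; apply/eqP; rewrite eqz_mod_dvd /a /cyc_mx eL en /r /rint -/rp -/rn /=.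
    move: (rp _ _ _ _ _ _) (rn _ _ _ _ _ _) => x1 x2.
    case: (i == j); case: (_ == _); apply/dvdzP;
      [exists (Posz x1)|exists 0%R|exists (Posz x1)|exists 0%R];
      case: q hq => // q _ /=; rewrite ?mulr0n ?mulr1n; lia.
  - by rewrite /K; lia.
  - move=> i j; rewrite /cyc_mx /r /rint.
    have h1 := @rpart_bound R gs dd rho b c0 c1 posp D Y (ix_t (2 ^ n) dd j) (ix_y (2 ^ n) dd i) (ix_y (2 ^ n) dd j) (ix_s dd i) (ix_s dd j).
    have h2 := @rpart_bound R gs dd rho b c0 c1 negp 0 Y (ix_t (2 ^ n) dd j) (ix_y (2 ^ n) dd i) (ix_y (2 ^ n) dd j) (ix_s dd i) (ix_s dd j).
    by rewrite /K; move: h1 h2; case: (i == j); case: (_ == _); lia.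
  - by rewrite eN /hist_dim !muln_gt0 n0 d0.
  - by rewrite eN.
rewrite detP; split.
- move=> hdet; have [phi [h1 h2]] := cyc_fix_of_det L0 n0 d0 D0 rP cind hdet.
  have [v hv hfix] := cycle_fixed h1 h2.
  apply: (accept_of_fixed _ dV hv); first by move=> k /gsU[].
  by rewrite -/T in hfix.
- move=> [psi hw hacc].
  have [v hv hfix] := fixed_of_accept (fun k hk => (gsU hk).1) dV hw hacc.
  have [ps h1 h2] := fixed_cycle hv hfix.
  exact: (cyc_det_of_fix L0 n0 d0 D0 rP cind h1 h2).
Qed.
End Decide.

(** * Proof of the theorem *)

Definition polybounded (f : nat -> nat) := exists k, forall n, f n <= n ^ k + k.

Lemma pb_le f g : (forall n, f n <= g n) -> polybounded g -> polybounded f.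
Proof. by move=> h [k hk]; exists k => n; apply: leq_trans (h n) (hk n). Qed.

Lemma pb_const c : polybounded (fun=> c).
Proof. by exists c => n; apply: leq_addl. Qed.

Lemma pb_id : polybounded id.
Proof. by exists 1 => n; rewrite expn1 leq_addr. Qed.

(** For [n <= 1] powers give nothing and the additive [k] must do; for larger [n] the power alone is
    enough. *)
Lemma pb_case k a n : (n <= 1 -> a <= k) -> (1 < n -> a <= n ^ k) -> a <= n ^ k + k.
Proof.
move=> h1 h2; case: (leqP n 1) => hn; first by apply: leq_trans (h1 hn) (leq_addl _ _).
by apply: leq_trans (h2 hn) (leq_addr _ _).
Qed.

Lemma pb_small k n : n <= 1 -> n ^ k + k <= k.+1.
Proof. by case: n => [|[|]] // _; [case: k => [|k]; rewrite ?expn0 ?exp0n|rewrite exp1n]; lia. Qed.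

Lemma pb_large k n : 1 < n -> n ^ k + k <= n ^ k.+1.
Proof.
move=> hn; have : k <= n ^ k by apply: ltnW; apply: ltn_expl.
by rewrite expnS; set X := n ^ k; nia.
Qed.

Lemma pb_mul f g : polybounded f -> polybounded g -> polybounded (fun n => f n * g n).
Proof.
move=> [a ha] [b hb]; exists (a.+1 * b.+1 + a.+1 + b.+1) => n; apply: pb_case => hn.
  have := leq_trans (ha n) (pb_small a hn); have := leq_trans (hb n) (pb_small b hn); nia.
have h1 := leq_trans (ha n) (pb_large a hn); have h2 := leq_trans (hb n) (pb_large b hn).
apply: leq_trans (leq_mul h1 h2) _; rewrite -expnD leq_exp2l //; lia.
Qed.

Lemma pb_S f : polybounded f -> polybounded (fun n => (f n).+1).
Proof.
move=> [k hk]; exists k.+2 => n; apply: pb_case => hn.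
  by have := leq_trans (hk n) (pb_small k hn).
have h := leq_trans (hk n) (pb_large k hn); rewrite [n ^ k.+2]expnS.
by have := expn_gt0 n k.+1; move: h; set X := n ^ _; nia.
Qed.

Lemma pb_add f g : polybounded f -> polybounded g -> polybounded (fun n => f n + g n).
Proof. by move=> hf hg; apply: pb_le (pb_mul (pb_S hf) (pb_S hg)) => n; nia. Qed.

Lemma pb_exp f k : polybounded f -> polybounded (fun n => f n ^ k).
Proof.
move=> hf; elim: k => [|k IH]; first by apply: pb_le (pb_const 1) => n.
by apply: pb_le (pb_mul hf IH) => n; rewrite expnS.
Qed.

Lemma le_exp2 x : x <= 2 ^ x. Proof. by apply: ltnW; apply: ltn_expl. Qed.

(** With [M = 3 * Z + 2 + dd] the dimension is at most [2 ^ M]: [2 * Z + 2] bits pay for the number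
    of factors, [Z] for the qubits and [dd] for the blocks. The base then takes three times [M]
    bits, [K] for the entries, and 8 for the numerical constants. *)
Lemma space_need_le dd K n T Z : n <= Z -> T <= Z ->
  space_need dd K n T <= 2 ^ ((3 * (3 * Z + 2 + dd) + K + 8) * (3 * Z + 2 + dd + 3)).
Proof.
move=> hn hT; set M := 3 * Z + 2 + dd; rewrite /space_need; set N := hist_dim dd n T.
have hN : N <= 2 ^ M.
  rewrite /N /hist_dim /M.
  have -> : 3 * Z + 2 + dd = (Z + Z).+2 + Z + dd by lia.
  rewrite !expnD; apply: leq_mul (le_exp2 dd); apply: leq_mul; last by rewrite leq_exp2l.
  by apply: leq_trans (le_exp2 _); lia.
have hb : bitlen N <= M + 1.
  by apply: bitlen_le; apply: leq_ltn_trans hN _; rewrite ltn_exp2l // addn1.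
have hK := le_exp2 K.
have hbase : N.+1 ^ 3 + 2 * (N * (N * K) + 1) + 2 <= 2 ^ (3 * M + K + 8).
  have e : 2 ^ (3 * M + K + 8) = 256 * (2 ^ M * 2 ^ M * 2 ^ M) * 2 ^ K.
    by have -> : 3 * M + K + 8 = 8 + (M + M + M) + K by [lia]; rewrite !expnD.
  have x1 : 0 < 2 ^ M by rewrite expn_gt0.
  have k1 : 0 < 2 ^ K by rewrite expn_gt0.
  rewrite e !expnS expn0 muln1; move: hN hK x1 k1; move: (2 ^ M) (2 ^ K) => X Q hN hK x1 k1.
  have hNN : N * N <= X * X by apply: leq_mul.
  have h3 : N.+1 * (N.+1 * N.+1) <= 8 * (X * X * X).
    have : N.+1 <= 2 * X by lia.
    by move=> h; apply: leq_trans (leq_mul h (leq_mul h h)) _; lia.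
  have h4 : N * (N * K) <= X * X * X * Q.
    rewrite mulnA; apply: leq_mul hK; apply: leq_trans hNN _; rewrite leq_pmulr //.
  have h5 : 1 <= X * X * X by rewrite !muln_gt0 x1.
  have h6 : X * X * X <= X * X * X * Q by rewrite leq_pmulr.
  move: h3 h4 h5 h6; set V := X * X * X; rewrite -[256 * V * Q]mulnA.
  by set W := V * Q => *; lia.
apply: (@leq_trans ((2 ^ (3 * M + K + 8)) ^ (bitlen N + 2))).
  by rewrite leq_exp2r // addn2.
by rewrite -expnM leq_exp2l // leq_mul2l; apply/orP; right; lia.
Qed.

(** The machine makes its own budget: the input length gives an exponent that dominates both [E] and
    the input registers, and repeated doubling gives [S]. Values polynomial in [S] have polynomially
    many bits. *)
Lemma in_PSPACE_of_decider (P : seq nat -> bool) (Ayes Ano : pred (seq bool)) (E : nat -> nat) :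
  LSb 3 P -> polybounded E ->
  (forall x S, 2 ^ E (size x) <= S ->
     (Ayes x -> P [:: inregs x 0; inregs x 1; S]) /\ (Ano x -> ~~ P [:: inregs x 0; inregs x 1; S])) ->
  in_PSPACE Ayes Ano.
Proof.
move=> [e3 [c3 [wf3 wd3 h3]]] [k hk] hP.
pose len e := bitlen (nth 0 e 1); pose Ef e := len e ^ k + k + len e.
have hEf : LS 2 Ef.
  have hl := LS_bitlen (LS_var 2 1).
  exact: (LS_add (LS_add (LS_exp k hl) (LS_const 2 k)) hl).
have hdouble : LS 3 (fun e => nth 0 e 0 + nth 0 e 0) := LS_add (LS_var _ _) (LS_var _ _).
case: hEf hdouble => [eE [cE [wfE wdE hE]]] [e2 [cd [wf2 wd2 hd]]].
pose eS := EIter eE (ESucc EZero) e2.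
pose e := EComp e3 (ECons (EVar 0) (ECons (EVar 1) eS)).
have wfe : wf e by rewrite /= wf3 wfE wf2 wdE wd2.
have [M hM] := expr_space wfe wd3.
pose ex n := n ^ k + k + n.
pose c := maxn 1 (maxn c3 (maxn cE cd)).
pose W n := (ex n + 2) * c + 1.
have [kW hW] : polybounded (fun n => (W n).+2).
  have hex : polybounded ex.
    by apply: pb_add pb_id; apply: pb_add (pb_const k); apply: pb_exp pb_id.
  have := pb_add (pb_add (pb_mul (pb_add hex (pb_const 2)) (pb_const c)) (pb_const 1)) (pb_const 2).
  by apply: pb_le => n; rewrite /W; lia.
exists M, kW => x; set env := [:: inregs x 0; inregs x 1]; set n := size x.
pose S := 2 ^ ex n.
have hr0 : inregs x 0 < 2 ^ n.
  rewrite /inregs /= /n; elim: (x) => //= a y IH; rewrite expnS; case: a; lia.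
have hr1 : inregs x 1 < 2 ^ n by rewrite /inregs /= -/n prednK ?expn_gt0.
have hnS : 2 ^ n <= S by rewrite leq_exp2l // /ex leq_addl.
have lenE : len env = n by rewrite /len bitlen_input.
have [eE1 oE] := hE env erefl.
have eEv : Ef env = ex n by rewrite /Ef lenE.
have itS j : iter j (fun vs => eval e2 (vs ++ env)) [:: 1] = [:: 2 ^ j].
  elim: j => // j IH; rewrite iterS IH.
  by have [-> _] := hd ([:: 2 ^ j] ++ env) erefl; rewrite /= addnn -mul2n expnS.
have evS : eval eS env = [:: S] by rewrite /= eE1 /= eEv itS.
pose B := (S + 2) ^ c.
have S2B : S + 2 <= B by rewrite /B -[X in X <= _]expn1 leq_exp2l ?leq_maxl // addn2.
have pw j : j <= c -> (S + 2) ^ j <= B by move=> h; rewrite /B leq_exp2l // addn2.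
have mxle X j : X <= S -> j <= c -> (X + 2) ^ j <= B.
  move=> hX hj; apply: leq_trans (pw j hj); case: j {hj} => // j.
  by rewrite leq_exp2r // leq_add2r.
have mxenv : mx env <= S by rewrite /mx /= maxn0 geq_max; lia.
have oke : ok B e env.
  have [ev3 ok3] := h3 [:: inregs x 0; inregs x 1; S] erefl.
  split; last first.
    rewrite [eval _ _]/= -/env -[iter _ _ _]/(eval eS env) evS.
    apply: ok_mono ok3; apply: mxle; last by rewrite /c !leq_max leqnn !orbT.
    by rewrite /mx /= maxn0 !geq_max leqnn; lia.
  split; first by rewrite /=; lia.
  split; first by rewrite /=; lia.
  split.
  - by apply: ok_mono oE; apply: mxle => //; rewrite /c !leq_max leqnn !orbT.
  - by split=> //=; lia.
  - move=> j; rewrite eE1 /= eEv => hj; rewrite itS.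
    have [_ od] := hd ([:: 2 ^ j] ++ env) erefl.
    apply: ok_mono od; apply: mxle; last by rewrite /c !leq_max leqnn !orbT.
    rewrite mx_cat geq_max mxenv andbT /= maxn0 leq_exp2l //; exact: ltnW.
have hBW : B < 2 ^ W n.
  rewrite /W addn1 expnS expnM; have h : B <= (2 ^ (ex n + 2)) ^ c.
    rewrite /B leq_exp2r; last by rewrite /c leq_max.
    by rewrite expnD /S; have := expn_gt0 2 (ex n); lia.
  have b0 : 0 < B by rewrite expn_gt0 addn2.
  lia.
have hxW : size x <= W n.
  by rewrite /W /ex -/n; have : 0 < c by [rewrite /c leq_max]; nia.
have [t [t1 t2 t3]] := hM x (W n) B oke hBW hxW.
have hsp := leq_trans t2 (hW n).
suff [hy hno] : (Ayes x -> tm_accept (cf_state (tm_run M x t))) /\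
  (Ano x -> ~~ tm_accept (cf_state (tm_run M x t))) by exists t.
have [ev3 _] := h3 [:: inregs x 0; inregs x 1; S] erefl.
have acc : tm_accept (cf_state (tm_run M x t)) = P [:: inregs x 0; inregs x 1; S].
  by rewrite t3 /= -[iter _ _ _]/(eval eS env) evS ev3; case: (P _).
have hS : 2 ^ E n <= S by rewrite leq_exp2l // /ex; have := hk n; lia.
by have [hy hno] := hP x S hS; rewrite acc.
Qed.

Lemma enc_desc_size (d : desc) :
  d.1.2 <= size (enc_desc d) /\ size d.2 <= size (enc_desc d).
Proof.
by case: d => [[m n] cs]; rewrite /= !size_cat /enc_nat !size_rcons !size_nseq; lia.
Qed.

Theorem theorem11 (R : realType) (gs : seq (gate R)) :
  (forall k, (k < size gs)%N ->
     unitary_gate (nth (id_gate R) gs k) /\ algebraic_gate (nth (id_gate R) gs k)) ->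
  forall Ayes Ano : pred (seq bool),
    in_QMA1_lt1 gs Ayes Ano -> in_PSPACE Ayes Ano.
Proof.
move=> hgs Ayes Ano [V [hV dV hyes hno]].
have [b [c0 [c1 [B [k [Out [_ c01 hOut hsim]]]]]]] := simulate hV.
have [P [dd [K [hP Pok]]]] := LS_decide hgs b c01.
have hP3 : LSb 3 (fun e => P [:: Out e; nth 0 e 2]).
  exact: (LS_comp hP (LSv_cons hOut (LSv_cons (LS_var 3 2) (LSv_nil 3)))).
(* [T] bounds the running time of the generator and [Z] the length of its output, hence the numbers
   of qubits and gates. [E1], [Z] and [E2] are the bits needed for the simulation, for [2 ^ n] with
   [n] qubits, and for [space_need]; [E1] rests on [B <= 2 ^ B]. *)
pose T n := n ^ k + k; pose Z n := T n + n + 1.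
pose E1 n := B * (T n + 1 + (T n + n + 2)).
pose E2 n := (3 * (3 * Z n + 2 + dd) + K + 8) * (3 * Z n + 2 + dd + 3).
have pbT : polybounded T by apply: pb_add (pb_const k); apply: pb_exp pb_id.
have pbZ : polybounded Z by exact: (pb_add (pb_add pbT pb_id) (pb_const 1)).
have pb3 : polybounded (fun n => 3 * Z n + 2 + dd).
  exact: (pb_add (pb_add (pb_mul (pb_const 3) pbZ) (pb_const 2)) (pb_const dd)).
have pbE1 : polybounded E1.
  apply: pb_mul (pb_const B) _; apply: pb_add (pb_add pbT (pb_const 1)) _.
  exact: (pb_add (pb_add pbT pb_id) (pb_const 2)).
have pbE2 : polybounded E2.
  apply: pb_mul; last exact: (pb_add pb3 (pb_const 3)).
  exact: (pb_add (pb_add (pb_mul (pb_const 3) pb3) (pb_const K)) (pb_const 8)).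
apply: (in_PSPACE_of_decider hP3 (pb_add (pb_add pbE1 pbZ) pbE2)) => x S hS /=.
have le_S i : i <= E1 (size x) + Z (size x) + E2 (size x) -> 2 ^ i <= S.
  by move=> hi; apply: leq_trans hS; rewrite leq_exp2l.
have hB : B ^ (T (size x) + 1 + (T (size x) + size x + 2)) <= S.
  apply: leq_trans (le_S (E1 (size x)) _); last by rewrite -addnA leq_addr.
  rewrite /E1 expnM leq_exp2r ?le_exp2 //; lia.
have [hdig hZ hsY _] := hsim x S hB.
have [hn hT] := enc_desc_size (V x).
have hnZ := leq_trans hn hZ; have hTZ := leq_trans hT hZ.
have h2n : 2 ^ (V x).1.2 <= S by apply: le_S; rewrite /Z /T; lia.
have hsp : space_need dd K (V x).1.2 (size (V x).2) <= S.
  by apply: leq_trans (space_need_le dd K hnZ hTZ) (le_S _ _); rewrite leq_addl.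
have hdec := Pok _ S (V x) (dV x) hsY hdig h2n hsp.
split=> [/hyes[psi [hw hacc]]|/hno hlt]; first by apply/hdec; exists psi.
by apply/negP => /hdec[psi hw hacc]; move: (hlt psi hw); rewrite hacc Order.POrderTheory.ltxx.
Qed.
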